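(* Let $n\ge2$, let $b$ be a non-degenerate complex symmetric bilinear form on $\mathbb C^n=\mathbb R^{2n}$ and let $\langle\ ,\ \rangle$ be its imaginary part, which has signature $(n,n)$. Let $r,s\ge0$ be integers such that $n-r-s=2k$ for an integer $k\ge0$. Then each of the orbits $\mathcal O_{(r,s)}\subset G/P:=IGr^\pm(n,\mathbb R^{(n,n)})$ is an embedded submanifold. For each point $x\in\mathcal O_{(r,s)}$ there is an open neighborhood $U$ of $x$ in $G/P$ and a diffeomorphism $\varphi$ from $U$ onto an open neighborhood of $(U\cap\mathcal O_{(r,s)})\times\{0\}$ in $(U\cap\mathcal O_{(r,s)})\times\mathcal H_k$ such that $U\subset\bigcup_{r'\ge r,\,s'\ge s}\mathcal O_{(r',s')}$ and a point $y\in U$ lies in $\mathcal O_{(r',s')}$ if and only if the second component of $\varphi(y)$ has signature $(r'-r,s'-s)$.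
   Context: $G=SO_0(n,n)$ is the connected component of the special orthogonal group of $\langle\ ,\ \rangle$, and $H=SO(n,\mathbb C)\subset G$ is the special orthogonal group of $b$. The $n$-dimensional real subspaces of $\mathbb R^{2n}$ isotropic for $\langle\ ,\ \rangle$ split into two $G$-homogeneous spaces $IGr^{+}(n,\mathbb R^{(n,n)})$ and $IGr^-(n,\mathbb R^{(n,n)})$ of self-dual, respectively anti-self-dual, subspaces; each is of the form $G/P$ for a parabolic subgroup $P$. $\mathcal O_{(r,s)}$ is the $H$-orbit of those maximal isotropic subspaces $V$ for which the restriction of $\mathrm{Re}(b)$ to $V$ has signature $(r,s)$; it is non-empty only if $n-r-s$ is even, and lies in $IGr^+$ if $n-s$ is even and in $IGr^-$ if $n-s$ is odd. $\mathcal H_k$ denotes the vector space of real $2k\times2k$-matrices that represent (via $\mathbb C^k\cong\mathbb R^{2k}$) complex $k\times k$-matrices that are Hermitian; these are real symmetric matrices, and their signature is meant as real symmetric matrices (so both entries are even). *)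

(* Defs.v *)
From HB Require Import structures.
From mathcomp Require Import all_boot all_order all_algebra.
From mathcomp Require Import all_classical all_reals all_analysis.
From mathcomp Require Import complex.

Set Implicit Arguments.
Unset Strict Implicit.
Unset Printing Implicit Defensive.

Import Order.TTheory GRing.Theory Num.Theory numFieldNormedType.Exports.

Local Open Scope classical_set_scope.
Local Open Scope ring_scope.
Local Open Scope complex_scope.

(** * Smooth manifolds presented by an atlas *)

Section Smooth.
Context {R : realType}.

(** For open [U]: all partial derivatives of [f] of order [k] exist and are
    continuous on [U]. *)
Fixpoint Ck (k : nat) {m p : nat} (U : set 'rV[R]_m)
    (f : 'rV[R]_m -> 'rV[R]_p) : Prop :=
  if k is k'.+1 then
    forall j : 'I_m, (forall x, U x -> derivable f x (delta_mx 0 j)) /\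
                     Ck k' U ('D_(delta_mx 0 j) f)
  else forall x, U x -> {for x, continuous f}.

Definition smooth_on {m p : nat} (U : set 'rV[R]_m)
    (f : 'rV[R]_m -> 'rV[R]_p) : Prop := forall k, Ck k U f.

(** A chart is a pair (domain, coordinate map); the values of the coordinate map
    outside of the domain are irrelevant. *)
Definition chart (T : Type) (m : nat) : Type := (set T * (T -> 'rV[R]_m))%type.

(** The points of the manifold form a subset of an ambient type [T]; its
    topology is the one for which the charts are homeomorphisms, see [mopen].
    Only the data are recorded here. *)
Record manifold (T : Type) (m : nat) := Manifold {
  points : set T;
  atlas : set (chart T m) }.

Definition is_chart {T : Type} {m : nat} (c : chart T m) : Prop :=
  set_inj c.1 c.2 /\ open (c.2 @` c.1).

(** The transition map c'.2 o c.2^-1 is defined on an open set and smooth. *)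
Definition smooth_transition {T : Type} {m : nat} (c c' : chart T m) : Prop :=
  open (c.2 @` (c.1 `&` c'.1)) /\
  exists g : 'rV[R]_m -> 'rV[R]_m,
    smooth_on (c.2 @` (c.1 `&` c'.1)) g /\
    forall x, (c.1 `&` c'.1) x -> c'.2 x = g (c.2 x).

Definition maximal_atlas {T : Type} {m : nat} (M : manifold T m) :
    set (chart T m) :=
  [set c | [/\ c.1 `<=` points M, is_chart c &
     forall c', atlas M c' -> smooth_transition c c' /\ smooth_transition c' c]].

Definition mopen {T : Type} {m : nat} (M : manifold T m) (U : set T) : Prop :=
  U `<=` points M /\ forall c, atlas M c -> open (c.2 @` (c.1 `&` U)).

(** [F] is defined on the open subset [U] of [M], and around each point of [U]
    it is smooth in suitable charts of [M] and [N]. *)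
Definition smooth_map {T T' : Type} {m p : nat} (M : manifold T m)
    (N : manifold T' p) (U : set T) (F : T -> T') : Prop :=
  forall x, U x -> exists (c : chart T m) (c' : chart T' p)
      (W : set 'rV[R]_m) (g : 'rV[R]_m -> 'rV[R]_p),
    [/\ atlas M c, atlas N c', c.1 x & c'.1 (F x)] /\
    [/\ open W, W (c.2 x), W `<=` c.2 @` (c.1 `&` U), smooth_on W g &
        forall y, c.1 y -> W (c.2 y) -> c'.1 (F y) /\ c'.2 (F y) = g (c.2 y)].

Definition diffeomorphism {T T' : Type} {m p : nat} (M : manifold T m)
    (N : manifold T' p) (U : set T) (W : set T') (F : T -> T') : Prop :=
  [/\ set_bij U W F, smooth_map M N U F &
      exists G : T' -> T, (forall x, U x -> G (F x) = x) /\ smooth_map N M W G].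

(** Charts in which [S] is the set where all but the first [d] coordinates
    vanish. *)
Definition slice_chart {T : Type} {m d : nat} (M : manifold T m)
    (hd : (d <= m)%N) (S : set T) (c : chart T m) : Prop :=
  maximal_atlas M c /\
  forall y, c.1 y -> (S y <-> forall i : 'I_m, (d <= i)%N -> c.2 y 0 i = 0).

Definition embedded_submanifold {T : Type} {m d : nat} (M : manifold T m)
    (hd : (d <= m)%N) (S : set T) : Prop :=
  S `<=` points M /\
  forall x, S x -> exists2 c, slice_chart M hd S c & c.1 x.

Definition submanifold {T : Type} {m d : nat} (M : manifold T m)
    (hd : (d <= m)%N) (S : set T) : manifold T d :=
  Manifold S
    [set c' | exists2 c, slice_chart M hd S c &
       c' = (c.1 `&` S, fun y => \row_(i < d) c.2 y 0 (widen_ord hd i))].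

Definition product_manifold {T T' : Type} {m p : nat} (M : manifold T m)
    (N : manifold T' p) : manifold (T * T') (m + p) :=
  Manifold (points M `*` points N)
    [set c | exists a a', [/\ atlas M a, atlas N a' &
       c = (a.1 `*` a'.1, fun y => row_mx (a.2 y.1) (a'.2 y.2))]].

(** A [d]-dimensional linear subspace [E], with its linear coordinates. *)
Definition linear_manifold (vT : vectType R) (d : nat) (E : set vT) :
    manifold vT d :=
  Manifold E
    [set c | exists2 L : {linear vT -> 'rV[R]_d}, set_bij E setT L &
       c = (E, L : vT -> 'rV[R]_d)].

End Smooth.

(** * Signatures *)

(** The symmetric bilinear form [beta], restricted to [V], has [p] positive and
    [q] negative squares. *)
Definition signature {R : realType} {vT : vectType R} (beta : vT -> vT -> R)
    (V : {vspace vT}) (p q : nat) : Prop :=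
  (p + q <= \dim V)%N /\
  exists e : (\dim V).-tuple vT, basis_of V e /\
    forall i j : 'I_(\dim V), beta (tnth e i) (tnth e j) =
      if i != j then 0
      else if (i < p)%N then 1 else if (i < p + q)%N then -1 else 0.

Definition mx_signature {R : realType} {m : nat} (S : 'M[R]_m) (p q : nat) :
    Prop :=
  signature (fun x y : 'rV[R]_m => (x *m S *m y^T) 0 0) fullv p q.

(** The real matrix of the complex matrix Z = X + iY acting on column vectors,
    with x + iy in C^k identified with (x, y) in R^(2k). *)
Definition real_mx {R : realType} {k : nat} (Z : 'M[R[i]]_k) : 'M[R]_(k + k) :=
  block_mx (map_mx (@complex.Re R) Z) (- map_mx (@complex.Im R) Z)
           (map_mx (@complex.Im R) Z) (map_mx (@complex.Re R) Z).

Definition Hermitian_mx (R : realType) (k : nat) : set 'M[R]_(k + k) :=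
  [set real_mx Z | Z in [set Z : 'M[R[i]]_k | Z = map_mx (@conjc R) Z^T]].

Arguments Hermitian_mx : clear implicits.

Definition skew_mx (R : realType) (n : nat) : set 'M[R]_n :=
  [set X | X^T = - X].

Arguments skew_mx : clear implicits.

(** * Maximal isotropic subspaces of R^(2n) = C^n *)

Section Isotropic.
Context {R : realType} {n : nat}.
Context (b : 'rV[R[i]]_n -> 'rV[R[i]]_n -> R[i]).

(** x + iy in C^n is identified with (x, y) in R^(2n). *)
Definition to_complex (u : 'rV[R]_(n + n)) : 'rV[R[i]]_n :=
  \row_j (lsubmx u 0 j +i* rsubmx u 0 j).

Definition re_form (u v : 'rV[R]_(n + n)) : R :=
  complex.Re (b (to_complex u) (to_complex v)).

Definition im_form (u v : 'rV[R]_(n + n)) : R :=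
  complex.Im (b (to_complex u) (to_complex v)).

Definition row_space (A : 'M[R]_(n, n + n)) : {vspace 'rV[R]_(n + n)} :=
  <<[seq row i A | i : 'I_n]>>%VS.

Definition im_gram {p q : nat} (A : 'M[R]_(p, n + n)) (B : 'M[R]_(q, n + n)) :
    'M[R]_(p, q) :=
  \matrix_(i, j) im_form (row i A) (row j B).

(** The volume form of < , >, evaluated on the rows of [M]. The orientation
    dx_1 ... dx_n dy_1 ... dy_n is the one for which the span of the vectors
    i e_j is self-dual when b = z_1^2 + ... + z_n^2, for every n. *)
Definition volume (M : 'M[R]_(n + n)) : R :=
  Num.sqrt `|\det (im_gram 1%:M 1%:M)| * \det M.

(** For V = span(v_1, ..., v_n) and v = v_1 /\ ... /\ v_n, the Hodge star is
    given by w /\ *v = <w, v> vol, where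
      <w_1 /\ ... /\ w_n, v_1 /\ ... /\ v_n> = det <w_i, v_j>;
    so the equation below is *v = v for e = false, *v = - v for e = true. *)
Definition dual (e : bool) (V : {vspace 'rV[R]_(n + n)}) : Prop :=
  exists A : 'M[R]_(n, n + n), [/\ row_free A, row_space A = V &
    forall W : 'M[R]_(n, n + n),
      volume (col_mx W A) = (-1) ^+ e * \det (im_gram W A)].

Definition isotropic (V : {vspace 'rV[R]_(n + n)}) : Prop :=
  forall u v, u \in V -> v \in V -> im_form u v = 0.

(** IGr^+ for e = false, IGr^- for e = true. *)
Definition IGr (e : bool) : set {vspace 'rV[R]_(n + n)} :=
  [set V | [/\ \dim V = n, isotropic V & dual e V]].

(** The smooth structure of G/P: for a Witt basis E_1, ..., E_n, F_1, ..., F_n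
    and P the stabilizer of span(E), the unipotent radical opposite to P
    consists of the maps g_X fixing each F_j with g_X E_i = E_i + sum_j X_ij F_j,
    X skew-symmetric; the charts are the inverses of X |-> g_X span(E). *)
Definition IGr_manifold (e : bool) :
    manifold (R := R) {vspace 'rV[R]_(n + n)} 'C(n, 2) :=
  Manifold (IGr e)
    [set c | exists (E F : 'M[R]_(n, n + n)) (l : chart 'M[R]_n 'C(n, 2)),
       [/\ IGr e (row_space E),
           [/\ im_gram E E = 0, im_gram F F = 0 & im_gram E F = 1%:M],
           atlas (linear_manifold 'C(n, 2) (skew_mx R n)) l,
           c.1 = [set row_space (E + X *m F) | X in skew_mx R n] &
           forall X, skew_mx R n X -> c.2 (row_space (E + X *m F)) = l.2 X]].

(** An orbit of SO(n, C), except that for r = s = 0 it is the union of the two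
    SO(n, C)-orbits of maximal b-isotropic complex subspaces. *)
Definition orbit_rs (r s : nat) : set {vspace 'rV[R]_(n + n)} :=
  [set V | [/\ \dim V = n, isotropic V & signature re_form V r s]].

End Isotropic.

(* Main.v *)
Require Import Defs.
From HB Require Import structures.
From mathcomp Require Import all_boot all_order all_algebra.
From mathcomp Require Import all_classical all_reals all_analysis.
From mathcomp Require Import complex.
From mathcomp Require Import ring lra zify.

(** Choose a basis E = (e, f, if) of x, where [Re b] is [eps = diag(1, .., -1, ..)]
    on the real span of e and f is a complex basis of x /\ ix, and a Witt dual
    F = (i eps e, ig, g) with f, g hyperbolic partners.  Near x every point of G/P
    is the graph E + XF of a skew matrix X = (A B; -B^T C), and the Gram matrix
    of [Re b] on it is D - (JX + XJ) + XDX, with D = diag(eps, 0) and J = diag(0, J')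
    the Gram matrices of [Re b] on (E, E) and (E, F).

    Eliminating the block [eps + A eps A], of signature (r, s) for small A, leaves a
    Schur complement which becomes linear after a rational change of variables
    (A, B, C) |-> (A, B0, C'): it is H = - (J'C' + C'J'), which is Hermitian, and
    C' |-> H maps the skew matrices onto H_k.  In the coordinates (A, B0, C') the point
    lies in O_(r',s') iff H has signature (r' - r, s' - s), so O_(r,s) is the slice
    H = 0 and phi splits off H.  Elements of SO(n, C) fixing g and acting trivially
    on g^perp / g, applied to graphs with B = 0, produce this change of variables.

    V is (anti-)self-dual according to the sign of the determinant of (F; E), which
    is that of (-1)^r because the basis (e, f, g, ie, if, ig) is positive. *)

Set Implicit Arguments.
Unset Strict Implicit.
Unset Printing Implicit Defensive.

Import Order.TTheory GRing.Theory Num.Theory numFieldNormedType.Exports.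

Local Open Scope classical_set_scope.
Local Open Scope ring_scope.
Local Open Scope complex_scope.

(** * Smooth functions *)

(** The elimination is a matrix identity valid for every B0 and C'. Only A has to be small: this
    keeps the signature of [eps + A eps A] at (r, s) and makes [denom_mx A] invertible. Hence the
    neighborhood U is unbounded in the direction of H_k, and phi maps it onto a full product.

    The obstacle is the inverse of [eps + A eps A], which the Schur complement contains when it is
    written in (A, B, C). B0 is, up to the factors [eps] and J, the eliminating matrix itself; with
    B0 as a coordinate the complement is polynomial. Its terms other than - (J C' + C' J) have the
    form J K + K J with K skew, so that a shift of C absorbs them.

    The dimension d of the orbit is never computed: a linear right inverse of X |-> H splits off the
    coordinates of H, and d is the rank of the complementary projection. *)

Section ScalarSmooth.
Context {R : realType} {m : nat}.
Implicit Types (U V : set 'rV[R]_m) (f g : 'rV[R]_m -> R).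

Fixpoint Ck_fun (k : nat) U f : Prop :=
  if k is k'.+1 then
    forall j : 'I_m, (forall x, U x -> derivable f x (delta_mx 0 j)) /\
                     Ck_fun k' U ('D_(delta_mx 0 j) f)
  else forall x, U x -> {for x, continuous f}.

(** [Ck_fun k.+1] does not mention the continuity of [f] itself; the product rule
    needs all the orders up to [k]. *)
Definition Ck_le k U f := forall j, (j <= k)%N -> Ck_fun j U f.

Definition smooth_fun U f := forall k, Ck_fun k U f.

(** Derivatives at a point depend on the values nearby; this is where openness enters. *)
Lemma Ck_fun_ext k U f g : open U -> (forall x, U x -> f x = g x) ->
  Ck_fun k U f -> Ck_fun k U g.
Proof.
move=> oU; elim: k f g => [|k IH] f g fg /= Hf.
  move=> x Ux; have nfg : {near x, f =1 g}.
    by near=> y; apply: fg; near: y; exact: open_nbhs_nbhs.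
  rewrite /prop_for /continuous_at -(fg _ Ux); apply: cvg_trans (Hf x Ux).
  exact: (near_eq_cvg nfg).
move=> j; have [Hd Hk] := Hf j.
have nfg x : U x -> {near x, f =1 g}.
  by move=> Ux; near=> y; apply: fg; near: y; exact: open_nbhs_nbhs.
split=> [x Ux|].
  by apply: near_eq_derivable (nfg x Ux) (Hd x Ux).
by apply: IH Hk => x Ux; apply: near_eq_derive (nfg x Ux).
Unshelve. all: by end_near. Qed.

Lemma Ck_fun_subset k U V f : V `<=` U -> Ck_fun k U f -> Ck_fun k V f.
Proof.
move=> VU; elim: k f => [|k IH] f /= Hf; first by move=> x /VU /Hf.
move=> j; have [Hd Hk] := Hf j; split; last exact: IH.
by move=> x /VU /Hd.
Qed.

Lemma Ck_le_derive k U f : Ck_le k.+1 U f -> forall j : 'I_m,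
  (forall x, U x -> derivable f x (delta_mx 0 j)) /\
  Ck_le k U ('D_(delta_mx 0 j) f).
Proof.
move=> H j; split; first exact: (H k.+1 (leqnn _) j).1.
by move=> i ik; exact: (H i.+1 ik j).2.
Qed.

Lemma Ck_le_intro k U f : (forall x, U x -> {for x, continuous f}) ->
  (forall j : 'I_m, (forall x, U x -> derivable f x (delta_mx 0 j)) /\
  Ck_le k U ('D_(delta_mx 0 j) f)) -> Ck_le k.+1 U f.
Proof.
move=> f0 H [|i] ik //= j; split; first exact: (H j).1.
exact: (H j).2.
Qed.

Lemma Ck_le_ext k U f g : open U -> (forall x, U x -> f x = g x) ->
  Ck_le k U f -> Ck_le k U g.
Proof. by move=> oU fg H j jk; exact: Ck_fun_ext (H j jk). Qed.

Lemma Ck_leW k U f : Ck_le k.+1 U f -> Ck_le k U f.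
Proof. by move=> H j jk; apply: H; rewrite ltnW. Qed.

Lemma Ck_le_continuous k U f : Ck_le k U f -> forall x, U x -> {for x, continuous f}.
Proof. by move=> /(_ 0%N (leq0n _)). Qed.

Lemma Ck_le_cst k U (a : R) : Ck_le k U (fun=> a).
Proof.
elim: k a => [|k IH] a.
  by move=> [|//] _ /= x _; exact: cst_continuous.
apply: Ck_le_intro => [x _|j]; first exact: cst_continuous.
split=> [x _|]; first exact: derivable_cst.
by rewrite (_ : 'D_ _ _ = fun=> 0) //; apply/funext => x; rewrite derive_cst.
Qed.

Lemma Ck_leD k U f g : open U -> Ck_le k U f -> Ck_le k U g ->
  Ck_le k U (fun x => f x + g x).
Proof.
move=> oU; elim: k f g => [|k IH] f g Hf Hg.
  move=> [|//] _ /= x Ux; exact: (continuousD (Ck_le_continuous Hf Ux) (Ck_le_continuous Hg Ux)).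
apply: Ck_le_intro => [x Ux|j].
  by exact: (continuousD (Ck_le_continuous Hf Ux) (Ck_le_continuous Hg Ux)).
have [df Df] := Ck_le_derive Hf j; have [dg Dg] := Ck_le_derive Hg j.
split=> [x Ux|]; first exact: derivableD (df x Ux) (dg x Ux).
apply: Ck_le_ext (IH _ _ Df Dg) => // x Ux.
by rewrite -[RHS]/('D_ _ (f + g) x) deriveD //; [exact: df|exact: dg].
Qed.

Lemma Ck_leM k U f g : open U -> Ck_le k U f -> Ck_le k U g ->
  Ck_le k U (fun x => f x * g x).
Proof.
move=> oU; elim: k f g => [|k IH] f g Hf Hg.
  move=> [|//] _ /= x Ux; exact: (continuousM (Ck_le_continuous Hf Ux) (Ck_le_continuous Hg Ux)).
apply: Ck_le_intro => [x Ux|j].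
  by exact: (continuousM (Ck_le_continuous Hf Ux) (Ck_le_continuous Hg Ux)).
have [df Df] := Ck_le_derive Hf j; have [dg Dg] := Ck_le_derive Hg j.
split=> [x Ux|]; first exact: derivableM (df x Ux) (dg x Ux).
apply: (@Ck_le_ext _ _ (fun x => f x * 'D_(delta_mx 0 j) g x + g x * 'D_(delta_mx 0 j) f x)) => //.
  by move=> x Ux; rewrite -[RHS]/('D_ _ (f * g) x) deriveM //; [exact: df|exact: dg].
by apply: Ck_leD => //; apply: IH => //; exact: Ck_leW.
Qed.

Lemma Ck_leV k U f : open U -> (forall x, U x -> f x != 0) -> Ck_le k U f ->
  Ck_le k U (fun x => (f x)^-1).
Proof.
move=> oU f0; elim: k f f0 => [|k IH] f f0 Hf.
  by move=> [|//] _ /= x Ux; exact: (continuousV (f0 _ Ux) (Ck_le_continuous Hf Ux)).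
apply: Ck_le_intro => [x Ux|j].
  by exact: (continuousV (f0 _ Ux) (Ck_le_continuous Hf Ux)).
have [df Df] := Ck_le_derive Hf j.
split=> [x Ux|]; first by apply: derivableV; [exact: f0|exact: df].
apply: (@Ck_le_ext _ _ (fun x => -1 * ((f x)^-1 * (f x)^-1) * 'D_(delta_mx 0 j) f x)) => //.
  by move=> x Ux; rewrite deriveV ?f0 //; [rewrite -exprVn expr2 mulN1r|exact: df].
apply: Ck_leM => //; apply: Ck_leM => //; first exact: Ck_le_cst.
by apply: Ck_leM => //; apply: IH => //; exact: Ck_leW.
Qed.

Lemma smooth_funP U f : smooth_fun U f <-> forall k, Ck_le k U f.
Proof. by split=> [H k j _|H k]; [exact: H|exact: (H k k)]. Qed.

Lemma smooth_fun_ext U f g : open U -> (forall x, U x -> f x = g x) -> smooth_fun U f -> smooth_fun U g.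
Proof. by move=> oU fg H k; exact: Ck_fun_ext (H k). Qed.

Lemma smooth_fun_subset U V f : V `<=` U -> smooth_fun U f -> smooth_fun V f.
Proof. by move=> VU H k; exact: Ck_fun_subset (H k). Qed.

Lemma smooth_fun_cst U (a : R) : smooth_fun U (fun=> a).
Proof. by apply/smooth_funP => k; exact: Ck_le_cst. Qed.

Lemma smooth_funD U f g : open U -> smooth_fun U f -> smooth_fun U g -> smooth_fun U (fun x => f x + g x).
Proof. by move=> oU /smooth_funP Hf /smooth_funP Hg; apply/smooth_funP => k; exact: Ck_leD. Qed.

Lemma smooth_funM U f g : open U -> smooth_fun U f -> smooth_fun U g -> smooth_fun U (fun x => f x * g x).
Proof. by move=> oU /smooth_funP Hf /smooth_funP Hg; apply/smooth_funP => k; exact: Ck_leM. Qed.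

Lemma smooth_funV U f : open U -> (forall x, U x -> f x != 0) -> smooth_fun U f ->
  smooth_fun U (fun x => (f x)^-1).
Proof. by move=> oU f0 /smooth_funP Hf; apply/smooth_funP => k; exact: Ck_leV. Qed.

Lemma smooth_funN U f : open U -> smooth_fun U f -> smooth_fun U (fun x => - f x).
Proof.
move=> oU Hf; apply: (@smooth_fun_ext _ (fun x => -1 * f x)) => //.
  by move=> x _; rewrite mulN1r.
by apply: smooth_funM => //; exact: smooth_fun_cst.
Qed.

Lemma smooth_fun_sum U (I : Type) (r : seq I) (P : pred I) (F : I -> 'rV[R]_m -> R) :
  open U -> (forall i, smooth_fun U (F i)) -> smooth_fun U (fun x => \sum_(i <- r | P i) F i x).
Proof.
move=> oU HF; elim: r => [|i r IH].
  by apply: (@smooth_fun_ext _ (fun=> 0)) (smooth_fun_cst _ _) => // x _; rewrite big_nil.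
apply: (@smooth_fun_ext _ (fun x => (if P i then F i x else 0) + \sum_(i <- r | P i) F i x)) => //.
  by move=> x _; rewrite big_cons; case: ifP => // _; rewrite add0r.
by apply: smooth_funD => //; case: (P i) => //; exact: smooth_fun_cst.
Qed.

Lemma smooth_fun_prod U (I : Type) (r : seq I) (P : pred I) (F : I -> 'rV[R]_m -> R) :
  open U -> (forall i, smooth_fun U (F i)) -> smooth_fun U (fun x => \prod_(i <- r | P i) F i x).
Proof.
move=> oU HF; elim: r => [|i r IH].
  by apply: (@smooth_fun_ext _ (fun=> 1)) (smooth_fun_cst _ _) => // x _; rewrite big_nil.
apply: (@smooth_fun_ext _ (fun x => (if P i then F i x else 1) * \prod_(i <- r | P i) F i x)) => //.
  by move=> x _; rewrite big_cons; case: ifP => // _; rewrite mul1r.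
by apply: smooth_funM => //; case: (P i) => //; exact: smooth_fun_cst.
Qed.

Lemma smooth_fun_coord U (i : 'I_m) : smooth_fun U (fun x => x 0 i).
Proof.
move=> [|k] /=; first by move=> x _; exact: coord_continuous.
have key (x v : 'rV[R]_m) : is_derive x v (fun x : 'rV[R]_m => x 0 i) (v 0 i).
  have := @derivable_mxP R 'rV[R]_m 1 m id x v; case=> /(_ (@derivable_id _ _ _ _)) H _.
  apply: DeriveDef; first exact: H.
  have := derive_mx (@derivable_id _ _ x v).
  by rewrite derive_id => /(congr1 (fun M : 'rV[R]_m => M 0 i)); rewrite mxE => ->.
move=> j; split=> [x _|]; first by have [] := key x (delta_mx 0 j).
rewrite (_ : 'D_ _ _ = fun=> (delta_mx 0 j : 'rV[R]_m) 0 i); first exact: smooth_fun_cst.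
by apply/funext => x; have [] := key x (delta_mx 0 j).
Qed.

Lemma smooth_fun_continuous U f : smooth_fun U f -> forall x, U x -> {for x, continuous f}.
Proof. by move=> /(_ 0%N). Qed.

Lemma open_smooth_preimage U f (A : set R) : open U -> smooth_fun U f -> open A ->
  open [set x | U x /\ A (f x)].
Proof.
move=> oU /smooth_fun_continuous Hf oA; rewrite openE => x /= [Ux Ax].
apply: filterI; first exact: open_nbhs_nbhs.
by apply: (Hf x Ux); exact: open_nbhs_nbhs.
Qed.

End ScalarSmooth.

(** Smoothness is tested on entries, so that products, determinants and inverses of matrices reduce
    to the algebra of scalar functions. *)
Definition smooth_mx {R : realType} {m a b} (U : set 'rV[R]_m)
  (F : 'rV[R]_m -> 'M[R]_(a, b)) := forall i j, smooth_fun U (fun x => F x i j).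

(** * Smooth families of matrices *)

Section MatrixSmooth.
Context {R : realType} {m : nat}.
Implicit Types (U V : set 'rV[R]_m).

Lemma continuous_mx a b (F : 'rV[R]_m -> 'M[R]_(a, b)) x :
  (forall i j, {for x, continuous (fun y => F y i j)}) -> {for x, continuous F}.
Proof.
move=> H; apply/(@cvgrPdist_le _ _ _ (nbhs x)) => /= e e0.
near=> y; rewrite [leLHS]/Num.Def.normr/= mx_normrE (bigmax_le _ (ltW e0))//= => i _.
rewrite !mxE/=; move: i; near: y; apply: filter_forall => /= i.
by have /cvgrPdist_le := H i.1 i.2; apply.
Unshelve. all: by end_near. Qed.

(** The way back to the vector-valued derivatives in the definition of a smooth transition. *)
Lemma smooth_onP U p (F : 'rV[R]_m -> 'rV[R]_p) : open U ->
  smooth_mx U F -> smooth_on U F.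
Proof.
move=> oU HF k; elim: k F HF => [|k IH] F HF /=.
  move=> x Ux; apply: continuous_mx => i j; exact: (smooth_fun_continuous (HF i j) Ux).
move=> j; have dF x : U x -> derivable F x (delta_mx 0 j).
  by move=> Ux; apply/derivable_mxP => a i; exact: ((HF a i 1%N) j).1.
split=> //; apply: IH => a i.
apply: (@smooth_fun_ext _ _ _ ('D_(delta_mx 0 j) (fun x => F x a i))) => //.
  by move=> x Ux; rewrite derive_mx ?mxE //; exact: dF.
by move=> l; exact: ((HF a i l.+1) j).2.
Qed.

Lemma smooth_mx_ext U a b (F G : 'rV[R]_m -> 'M[R]_(a, b)) : open U ->
  (forall x, U x -> F x = G x) -> smooth_mx U F -> smooth_mx U G.
Proof.
by move=> oU FG H i j; apply: smooth_fun_ext (H i j) => // x Ux; rewrite FG.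
Qed.

Lemma smooth_mx_subset U V a b (F : 'rV[R]_m -> 'M[R]_(a, b)) : V `<=` U ->
  smooth_mx U F -> smooth_mx V F.
Proof. by move=> VU H i j; exact: smooth_fun_subset (H i j). Qed.

Lemma smooth_mx_cst U a b (A : 'M[R]_(a, b)) : smooth_mx U (fun=> A).
Proof. by move=> i j; exact: smooth_fun_cst. Qed.

Lemma smooth_mxD U a b (F G : 'rV[R]_m -> 'M[R]_(a, b)) : open U ->
  smooth_mx U F -> smooth_mx U G -> smooth_mx U (fun x => F x + G x).
Proof.
move=> oU HF HG i j; apply: smooth_fun_ext (smooth_funD oU (HF i j) (HG i j)) => // x _.
by rewrite mxE.
Qed.

Lemma smooth_mxN U a b (F : 'rV[R]_m -> 'M[R]_(a, b)) : open U ->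
  smooth_mx U F -> smooth_mx U (fun x => - F x).
Proof.
by move=> oU HF i j; apply: smooth_fun_ext (smooth_funN oU (HF i j)) => // x _; rewrite mxE.
Qed.

Lemma smooth_mxZ U a b (c : R) (F : 'rV[R]_m -> 'M[R]_(a, b)) : open U ->
  smooth_mx U F -> smooth_mx U (fun x => c *: F x).
Proof.
move=> oU HF i j; apply: smooth_fun_ext (smooth_funM oU (smooth_fun_cst U c) (HF i j)) => // x _.
by rewrite mxE.
Qed.

Lemma smooth_mxM U a b c (F : 'rV[R]_m -> 'M[R]_(a, b)) (G : 'rV[R]_m -> 'M[R]_(b, c)) :
  open U -> smooth_mx U F -> smooth_mx U G -> smooth_mx U (fun x => F x *m G x).
Proof.
move=> oU HF HG i j; apply: (@smooth_fun_ext _ _ _ (fun x => \sum_k F x i k * G x k j)) => //.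
  by move=> x _; rewrite mxE.
by apply: smooth_fun_sum => // k; exact: smooth_funM.
Qed.

Lemma smooth_mx_tr U a b (F : 'rV[R]_m -> 'M[R]_(a, b)) : open U ->
  smooth_mx U F -> smooth_mx U (fun x => (F x)^T).
Proof.
by move=> oU HF i j; apply: smooth_fun_ext (HF j i) => // x _; rewrite mxE.
Qed.

Lemma smooth_fun_det U a (F : 'rV[R]_m -> 'M[R]_a) : open U ->
  smooth_mx U F -> smooth_fun U (fun x => \det (F x)).
Proof.
move=> oU HF; apply: smooth_fun_sum => // s; apply: smooth_funM => //; first exact: smooth_fun_cst.
by apply: smooth_fun_prod => // i; exact: HF.
Qed.

Lemma smooth_mx_inv U a (F : 'rV[R]_m -> 'M[R]_a) : open U ->
  (forall x, U x -> F x \in unitmx) -> smooth_mx U F -> smooth_mx U (fun x => invmx (F x)).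
Proof.
move=> oU F0 HF i j.
(* Cramer's rule, which agrees with [invmx] on [U] only. *)
apply: (@smooth_fun_ext _ _ _ (fun x => (\det (F x))^-1 * cofactor (F x) j i)) => //.
  by move=> x Ux; rewrite /invmx F0 // !mxE.
apply: smooth_funM => //.
  apply: smooth_funV => // [x Ux|]; last exact: smooth_fun_det.
  by have := F0 x Ux; rewrite unitmxE unitfE.
apply: smooth_funM => //; first exact: smooth_fun_cst.
apply: smooth_fun_det => // k l.
by apply: smooth_fun_ext (HF (lift j k) (lift i l)) => // x _; rewrite !mxE.
Qed.

Lemma smooth_mx_linear U a b c d (L : {linear 'M[R]_(a, b) -> 'M[R]_(c, d)})
  (F : 'rV[R]_m -> 'M[R]_(a, b)) : open U -> smooth_mx U F -> smooth_mx U (fun x => L (F x)).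
Proof.
move=> oU HF i j.
apply: (@smooth_fun_ext _ _ _ (fun x => \sum_k \sum_l F x k l * L (delta_mx k l) i j)) => //.
  move=> x _; rewrite {2}[F x]matrix_sum_delta linear_sum summxE; apply: eq_bigr => k _.
  by rewrite linear_sum summxE; apply: eq_bigr => l _; rewrite linearZ !mxE.
apply: smooth_fun_sum => // k; apply: smooth_fun_sum => // l.
exact: (smooth_funM oU (HF k l) (smooth_fun_cst U _)).
Qed.

Lemma smooth_mx_id U : smooth_mx U (fun x => x).
Proof. by move=> i j; rewrite ord1; exact: smooth_fun_coord. Qed.

Lemma smooth_mx_row U a b c (F : 'rV[R]_m -> 'M[R]_(a, b)) (G : 'rV[R]_m -> 'M[R]_(a, c)) :
  open U -> smooth_mx U F -> smooth_mx U G -> smooth_mx U (fun x => row_mx (F x) (G x)).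
Proof.
move=> oU HF HG i j.
case: (split_ordP j) => k ->.
  by apply: smooth_fun_ext (HF i k) => // x _; rewrite row_mxEl.
by apply: smooth_fun_ext (HG i k) => // x _; rewrite row_mxEr.
Qed.

Lemma smooth_mx_col U a b c (F : 'rV[R]_m -> 'M[R]_(a, b)) (G : 'rV[R]_m -> 'M[R]_(c, b)) :
  open U -> smooth_mx U F -> smooth_mx U G -> smooth_mx U (fun x => col_mx (F x) (G x)).
Proof.
move=> oU HF HG i j.
case: (split_ordP i) => k ->.
  by apply: smooth_fun_ext (HF k j) => // x _; rewrite col_mxEu.
by apply: smooth_fun_ext (HG k j) => // x _; rewrite col_mxEd.
Qed.

Lemma smooth_mx_block U a b c d (F : 'rV[R]_m -> 'M[R]_(a, b)) (G : 'rV[R]_m -> 'M[R]_(a, c))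
  (H : 'rV[R]_m -> 'M[R]_(d, b)) (K : 'rV[R]_m -> 'M[R]_(d, c)) :
  open U -> smooth_mx U F -> smooth_mx U G -> smooth_mx U H -> smooth_mx U K ->
  smooth_mx U (fun x => block_mx (F x) (G x) (H x) (K x)).
Proof. by move=> oU HF HG HH HK; apply: smooth_mx_col => //; apply: smooth_mx_row. Qed.

Lemma smooth_mx_blocks U a b c d (F : 'rV[R]_m -> 'M[R]_(a + b, c + d)) :
  open U -> smooth_mx U F -> [/\ smooth_mx U (fun x => ulsubmx (F x)), smooth_mx U (fun x => ursubmx (F x)),
   smooth_mx U (fun x => dlsubmx (F x)) & smooth_mx U (fun x => drsubmx (F x))].
Proof.
move=> oU HF; split=> i j;
 [apply: smooth_fun_ext (HF (lshift _ i) (lshift _ j))|apply: smooth_fun_ext (HF (lshift _ i) (rshift _ j))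
 |apply: smooth_fun_ext (HF (rshift _ i) (lshift _ j))|apply: smooth_fun_ext (HF (rshift _ i) (rshift _ j))] => // x _; by rewrite !mxE.
Qed.

End MatrixSmooth.

(** * Sylvester's law of inertia *)

Section Inertia.
Context {R : rcfType}.

Definition quad_form {N} (S : 'M[R]_N) (x : 'rV_N) : R := (x *m S *m x^T) 0 0.

Definition inertia_mx p q N : 'M[R]_N :=
  diag_mx (\row_i (if (i < p)%N then 1 else if (i < p + q)%N then -1 else 0)).

Definition has_inertia {N} (S : 'M[R]_N) p q :=
  (p + q <= N)%N /\ exists2 T, T \in unitmx & T *m S *m T^T = inertia_mx p q N.

(** The rows of [U] are not required to be independent: positivity implies it. *)
Definition posdef_dim {N} (S : 'M[R]_N) p :=
  exists U : 'M[R]_(p, N), forall x, x != 0 -> 0 < quad_form S (x *m U).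

Lemma quad_form_mul N M (S : 'M[R]_N) (U : 'M[R]_(M, N)) x :
  quad_form S (x *m U) = quad_form (U *m S *m U^T) x.
Proof. by rewrite /quad_form trmx_mul !mulmxA. Qed.

Lemma quad_form_diag N (d : 'rV[R]_N) x : quad_form (diag_mx d) x = \sum_i d 0 i * x 0 i ^+ 2.
Proof.
rewrite /quad_form mxE; apply: eq_bigr => i _; rewrite mul_mx_diag !mxE; ring.
Qed.

Lemma quad_form1_gt0 N (x : 'rV[R]_N) : x != 0 -> 0 < quad_form 1%:M x.
Proof.
move=> x0; rewrite /quad_form mulmx1 mxE.
have [i xi] : exists i, x 0 i != 0.
  apply/existsP; apply: contraNT x0; rewrite negb_exists => /forallP H.
  by apply/eqP/rowP => i; rewrite mxE; apply/eqP; have := H i; rewrite negbK.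
rewrite (bigD1 i) //= ltr_wpDr //.
  by apply: sumr_ge0 => j _; rewrite mxE -expr2 sqr_ge0.
by rewrite mxE -expr2 exprn_even_gt0.
Qed.

Lemma quad_formN N (S : 'M[R]_N) x : quad_form (- S) x = - quad_form S x.
Proof. by rewrite /quad_form mulmxN mulNmx mxE. Qed.

Lemma posdef_dim_congr N (S T : 'M[R]_N) p : T \in unitmx ->
  posdef_dim S p -> posdef_dim (T *m S *m T^T) p.
Proof.
move=> Tu [U HU]; exists (U *m invmx T) => x x0.
by rewrite -quad_form_mul !mulmxA mulmxKV //; exact: HU.
Qed.

(** A positive definite subspace meets the kernel of [M] in 0 only, so [M] embeds it into a space of
    dimension [l]. *)
Lemma posdef_dim_le N l (S : 'M[R]_N) (M : 'M[R]_(N, l)) p :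
  (forall y, y *m M = 0 -> quad_form S y <= 0) -> posdef_dim S p -> (p <= l)%N.
Proof.
move=> HM [U HU].
suff : row_free (U *m M) by rewrite /row_free => /eqP <-; exact: rank_leq_col.
apply: inj_row_free => v; rewrite mulmxA => /HM.
by apply: contraTeq => v0; rewrite -ltNge; exact: HU.
Qed.

Lemma ord_shift o l N : (o + l <= N)%N ->
  exists f : 'I_l -> 'I_N, forall i, f i = (o + i)%N :> nat.
Proof.
move=> H; have f_lt (i : 'I_l) : (o + i < N)%N by have := ltn_ord i; lia.
by exists (fun i => Ordinal (f_lt i)).
Qed.

Lemma rowsub_diag N l (f : 'I_l -> 'I_N) (d : 'rV[R]_N) c : injective f ->
  (forall i, d 0 (f i) = c) ->
  rowsub f 1%:M *m diag_mx d *m (rowsub f 1%:M)^T = c%:M.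
Proof.
move=> fI fc; rewrite mul_rowsub_mx mul1mx; apply/matrixP => i j.
rewrite mxE (bigD1 (f j)) //= big1 => [|k kj].
  rewrite !mxE eqxx mulr1 addr0 (inj_eq fI); case: eqP => [->|//].
  by rewrite !mulr1n fc.
by rewrite !mxE (eq_sym (f j)) (negPf kj) mulr0.
Qed.

Lemma mul_colsub0 N l (f : 'I_l -> 'I_N) (y : 'rV[R]_N) :
  y *m (rowsub f 1%:M)^T = 0 -> forall i, y 0 (f i) = 0.
Proof.
move=> H i; have := congr1 (fun M : 'rV_l => M 0 i) H; rewrite /= !mxE => <-.
rewrite (bigD1 (f i)) //= big1 => [|k kj]; first by rewrite !mxE eqxx mulr1 addr0.
by rewrite !mxE (eq_sym (f i)) (negPf kj) mulr0.
Qed.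

Lemma inertia_mx_posdef_dim p q N : (p + q <= N)%N ->
  posdef_dim (inertia_mx p q N) p /\ posdef_dim (- inertia_mx p q N) q.
Proof.
move=> pqN.
have [f fE] : exists f : 'I_p -> 'I_N, forall i, f i = (0 + i)%N :> nat.
  by apply: ord_shift; lia.
have [g gE] := ord_shift pqN.
have fI : injective f by move=> i j /(congr1 val) /=; rewrite !fE => /val_inj.
have gI : injective g.
  by move=> i j /(congr1 val) /=; rewrite !gE => /eqP; rewrite eqn_add2l => /eqP/val_inj.
split; [exists (rowsub f 1%:M)|exists (rowsub g 1%:M)] => x x0.
  rewrite quad_form_mul (@rowsub_diag _ _ _ _ 1) //; first exact: quad_form1_gt0.
  by move=> i; rewrite mxE fE ltn_ord.
rewrite quad_formN quad_form_mul (@rowsub_diag _ _ _ _ (-1)) //; last first.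
  by move=> i; rewrite mxE gE ltn_add2l ltn_ord ltnNge leq_addr.
rewrite (_ : (-1)%:M = - 1%:M :> 'M[R]_q); last by rewrite -[RHS]scaleN1r scalemx1.
by rewrite quad_formN opprK; exact: quad_form1_gt0.
Qed.

(** For the matrix in [posdef_dim_le] take the projection to the p positive, respectively q
    negative, coordinates: where these vanish the form has the opposite sign or is 0. *)
Lemma inertia_mx_posdef_dim_le p q N l : (p + q <= N)%N ->
  (posdef_dim (inertia_mx p q N) l -> (l <= p)%N) /\ (posdef_dim (- inertia_mx p q N) l -> (l <= q)%N).
Proof.
move=> pqN.
have [f fE] : exists f : 'I_p -> 'I_N, forall i, f i = (0 + i)%N :> nat.
  by apply: ord_shift; lia.
have [g gE] := ord_shift pqN.
split; [apply: (@posdef_dim_le _ _ _ (rowsub f 1%:M)^T)|apply: (@posdef_dim_le _ _ _ (rowsub g 1%:M)^T)]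
  => y /mul_colsub0 Hy; rewrite ?quad_formN quad_form_diag.
  apply: sumr_le0 => i _; rewrite mxE; case: ifP => [ip|_].
    by rewrite (_ : i = f (Ordinal ip)) ?Hy ?expr2 ?mulr0 //; apply/val_inj; rewrite /= fE.
  by case: ifP => _; rewrite ?mulN1r ?mul0r // oppr_le0 sqr_ge0.
rewrite oppr_le0; apply: sumr_ge0 => i _; rewrite mxE; case: ifP => [ip|ip].
  by rewrite mul1r sqr_ge0.
case: ifP => [iq|_]; last by rewrite mul0r.
have iq' : (i - p < q)%N by lia.
rewrite (_ : i = g (Ordinal iq')) ?Hy ?expr2 ?mulr0 //.
by apply/val_inj; rewrite /= gE /=; lia.
Qed.

(** The matrix D satisfies D D = [pid_mx (p + q)] and [pid_mx (p + q)] D = D, so each of the two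
    ranks bounds the other. *)
Lemma rank_inertia_mx p q N : (p + q <= N)%N -> \rank (inertia_mx p q N) = (p + q)%N.
Proof.
move=> pqN.
have D2 : inertia_mx p q N *m inertia_mx p q N = pid_mx (p + q).
  rewrite mul_diag_mx; apply/matrixP => i j; rewrite !mxE.
  have [->|ij] := eqVneq i j; last by rewrite (_ : (i == j :> nat) = false) ?mulr0 //; exact: negPf.
  rewrite eqxx /= mulr1n; case: ifP => [|_]; last by case: (j < p + q)%N; rewrite ?mulr0 //= mulrNN mulr1.
  by move=> jp; rewrite mul1r; have -> : (j < p + q)%N by lia.
have Dp : pid_mx (p + q) *m inertia_mx p q N = inertia_mx p q N.
  rewrite mul_mx_diag; apply/matrixP => i j; rewrite !mxE.
  have [->|ij] := eqVneq i j; last by rewrite (_ : (i == j :> nat) = false) ?mul0r //; exact: negPf.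
  rewrite eqxx mulr1n /=; case: ifP => [|_]; last by case: (j < p + q)%N; rewrite ?mulr0 ?mul1r.
  by move=> jp; rewrite (_ : (j < p + q)%N) ?mul1r //; lia.

apply/eqP; rewrite eqn_leq; apply/andP; split.
  by rewrite -{1}Dp (leq_trans (mxrankM_maxl _ _)) // rank_pid_mx.
by rewrite -{1}(@rank_pid_mx R N N (p + q)) // -D2 mxrankM_maxl.
Qed.

(** The numbers p and q are the maximal dimensions of definite subspaces. [l] is a test dimension,
    set to 0 wherever only the first three conclusions are wanted. *)
Lemma has_inertia_unique_aux N (S : 'M[R]_N) p q l : has_inertia S p q ->
  [/\ posdef_dim S p, posdef_dim (- S) q, \rank S = (p + q)%N,
      posdef_dim S l -> (l <= p)%N & posdef_dim (- S) l -> (l <= q)%N].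
Proof.
move=> [pqN [T Tu TS]].
have Tu' : invmx T \in unitmx by rewrite unitmx_inv.
have SE : S = invmx T *m inertia_mx p q N *m (invmx T)^T.
  by rewrite -TS trmx_inv !mulmxA mulVmx // mul1mx mulmxK // unitmx_tr.
have [P1 P2] := inertia_mx_posdef_dim pqN; have [L1 L2] := inertia_mx_posdef_dim_le l pqN.
have NTS : T *m (- S) *m T^T = - inertia_mx p q N by rewrite mulmxN mulNmx TS.
split.
- by rewrite SE; exact: posdef_dim_congr.
- by rewrite SE -mulNmx -mulmxN; exact: posdef_dim_congr.
- rewrite -(rank_inertia_mx pqN) SE mxrankMfree ?row_free_unit ?unitmx_tr //.
  by rewrite eqmxMfull // row_full_unit.
- by move=> /(posdef_dim_congr Tu); rewrite TS.
- by move=> /(posdef_dim_congr Tu); rewrite NTS.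
Qed.

Lemma inertia_mx_consl p q N : block_mx 1%:M 0 0 (inertia_mx p q N) = inertia_mx p.+1 q (1 + N).
Proof.
apply/matrixP => i j; case: (split_ordP i) => i' ->; case: (split_ordP j) => j' ->.
- rewrite block_mxEul !mxE !(ord1 i') !(ord1 j') !eqxx /=; ring.
- by rewrite block_mxEur !mxE eq_lrshift.
- by rewrite block_mxEdl !mxE eq_rlshift.
- by rewrite block_mxEdr !mxE eq_rshift.
Qed.

Lemma inertia_mx_consr q N : block_mx (-1)%:M 0 0 (inertia_mx 0 q N) = inertia_mx 0 q.+1 (1 + N).
Proof.
apply/matrixP => i j; case: (split_ordP i) => i' ->; case: (split_ordP j) => j' ->.
- by rewrite block_mxEul !mxE !(ord1 i') !(ord1 j') !eqxx /=.
- by rewrite block_mxEur !mxE eq_lrshift.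
- by rewrite block_mxEdl !mxE eq_rlshift.
- by rewrite block_mxEdr !mxE eq_rshift.
Qed.

(** One step of orthogonalization: the rows of [K] are a basis of the orthogonal complement of [x],
    which is a hyperplane not containing [x] because [c] is nonzero. *)
Lemma sym_split N (S : 'M[R]_(1 + N)) x (c : R) : S^T = S -> c != 0 ->
  quad_form S x = c ->
  exists (K : 'M[R]_(N, 1 + N)), col_mx x K \in unitmx /\
   col_mx x K *m S *m (col_mx x K)^T = block_mx c%:M 0 0 (K *m S *m K^T).
Proof.
move=> Ssym c0 xc.
have Sx0 : S *m x^T != 0.
  by apply: contraNneq c0 => H; rewrite -xc /quad_form -mulmxA H mulmx0 mxE.
have rk : \rank (kermx (S *m x^T)) = N.
  rewrite mxrank_ker (_ : \rank (S *m x^T) = 1%N) ?add1n ?subn1 //.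
  by apply/eqP; rewrite eqn_leq rank_leq_col lt0n mxrank_eq0.
have [K Kf Kx] : exists2 K : 'M[R]_(N, 1 + N), row_free K & K *m S *m x^T = 0.
  move: (row_base_free (kermx (S *m x^T))) (eq_row_base (kermx (S *m x^T))).
  move: (row_base _); rewrite rk => K Kf KE; exists K => //.
  by apply/eqP; rewrite -mulmxA -sub_kermx KE.
have Kx' : x *m S *m K^T = 0.
  by apply: trmx_inj; rewrite !trmx_mul trmxK Ssym trmx0 mulmxA.
exists K; split.
  rewrite -row_free_unit; apply: inj_row_free => v.
  rewrite -[v]hsubmxK mul_row_col => vK.
  have := congr1 (fun M => M *m S *m x^T) vK.
  rewrite /= !mul0mx !mulmxDl -!mulmxA (mulmxA K) Kx mulmx0 addr0.
  rewrite (mulmxA x) [x *m S *m x^T]mx11_scalar -/(quad_form S x) xc mul_mx_scalar.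
  move=> /eqP; rewrite scaler_eq0 (negPf c0) /= => /eqP v1.
  move: vK; rewrite v1 mul0mx add0r => /eqP.
  by rewrite mulmx_free_eq0 // => /eqP ->; rewrite row_mx0.
rewrite tr_col_mx mul_col_mx mul_col_row Kx Kx'.
by rewrite [x *m S *m x^T]mx11_scalar -/(quad_form S x) xc.
Qed.

Lemma has_inertia_cons N (S : 'M[R]_(1 + N)) (S' : 'M[R]_N) (T : 'M[R]_(1 + N)) c p q p' q' :
  T \in unitmx -> T *m S *m T^T = block_mx c%:M 0 0 S' -> has_inertia S' p q ->
  (p' + q' = (p + q).+1)%N -> block_mx c%:M 0 0 (inertia_mx p q N) = inertia_mx p' q' (1 + N) ->
  has_inertia S p' q'.
Proof.
move=> Tu TS [pqN [T' Tu' TS']] pq' E; split; first by rewrite pq' add1n.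
exists (block_mx 1%:M 0 0 T' *m T).
  by rewrite unitmx_mul Tu andbT !unitmxE det_ublock det1 mul1r.
rewrite trmx_mul !mulmxA -(mulmxA _ T) -(mulmxA _ (T *m S)) TS.
rewrite tr_block_mx !trmx0 trmx1 !mulmx_block !mul0mx !mulmx0 !addr0 !add0r.
by rewrite mul1mx mulmx1 !mul0mx ?mulmx0 TS' -E.
Qed.

(** Rescaling to the values 1 and -1 takes square roots, hence the real closed field. *)
Lemma quad_form_normalize N (S : 'M[R]_N) x : quad_form S x != 0 ->
  exists y, quad_form S y = Num.sg (quad_form S x).
Proof.
move=> x0; exists ((Num.sqrt `|quad_form S x|)^-1 *: x).
rewrite /quad_form linearZ /= -!scalemxAl -scalemxAr scalerA mxE -/(quad_form S x).
rewrite -expr2 exprVn sqr_sqrtr ?normr_ge0 // {2}[quad_form S x]numEsg.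
by rewrite mulrC mulfK // normr_eq0.
Qed.

Lemma sym_quad_form0 N (S : 'M[R]_N) : S^T = S -> (forall x, quad_form S x = 0) -> S = 0.
Proof.
move=> Ssym H; have Hp (x y : 'rV_N) : (x *m S *m y^T) 0 0 = 0.
  have := H (x + y); have := H x; have := H y; rewrite /quad_form.
  rewrite linearD /= !mulmxDl !mulmxDr [(_ + _ + _ : 'M[R]_(1, 1)) 0 0]mxE.
  rewrite [(x *m S *m x^T + _ : 'M[R]_(1, 1)) 0 0]mxE [(_ + _ : 'M[R]_(1, 1)) 0 0]mxE => -> ->.
  rewrite add0r addr0.
  have -> : (y *m S *m x^T) 0 0 = (x *m S *m y^T) 0 0.
    by rewrite -[in LHS](trmxK y) -{1}Ssym -!trmx_mul mulmxA [LHS]mxE.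
  by move=> ?; lra.
apply/matrixP => i j; rewrite mxE -(Hp (delta_mx 0 i) (delta_mx 0 j)).
by rewrite -rowE trmx_delta -colE !mxE.
Qed.

Lemma sym_congr N M (S : 'M[R]_N) (K : 'M[R]_(M, N)) : S^T = S ->
  (K *m S *m K^T)^T = K *m S *m K^T.
Proof. by move=> Ssym; rewrite !trmx_mul trmxK Ssym mulmxA. Qed.

Lemma has_inertia0 N : has_inertia (0 : 'M[R]_N) 0 0.
Proof.
split => //; exists 1%:M; first exact: unitmx1.
by rewrite mulmx0 mul0mx; apply/matrixP => i j; rewrite !mxE /= mul0rn.
Qed.

(** The normal form lists the entries 1 before the entries -1, and prepending -1 preserves this only
    when there is no 1. So the semidefinite case comes first, and the general case splits off
    positive vectors until it is reached. *)
Lemma has_inertia_neg N (S : 'M[R]_N) : S^T = S -> (forall x, quad_form S x <= 0) ->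
  exists q, has_inertia S 0 q.
Proof.
elim: N S => [|N IH] S Ssym HS.
  by exists 0%N; rewrite (_ : S = 0); [exact: has_inertia0|apply/matrixP => -[]].
have [[x x0]|H] := pselect (exists x, quad_form S x != 0); last first.
  exists 0%N; rewrite (_ : S = 0); first exact: has_inertia0.
  by apply: sym_quad_form0 => // x; apply/eqP/negPn/negP => xS; case: H; exists x.
have [y yS] := quad_form_normalize x0.
have yS1 : quad_form S y = -1 by rewrite yS ltr0_sg // lt_neqAle x0 HS.
have [|K [Ku KE]] := sym_split Ssym _ yS1; first by rewrite oppr_eq0 oner_eq0.
have [q Hq] := IH _ (sym_congr K Ssym) (fun x => ltac:(rewrite -quad_form_mul; exact: HS)).
by exists q.+1; apply: (has_inertia_cons Ku KE Hq) => //; exact: inertia_mx_consr.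
Qed.

Lemma has_inertia_exists N (S : 'M[R]_N) : S^T = S -> exists p q, has_inertia S p q.
Proof.
elim: N S => [|N IH] S Ssym.
  by exists 0%N, 0%N; rewrite (_ : S = 0); [exact: has_inertia0|apply/matrixP => -[]].
have [[x x0]|H] := pselect (exists x, 0 < quad_form S x); last first.
  exists 0%N; apply: has_inertia_neg => // x.
  by rewrite leNgt; apply/negP => xS; case: H; exists x.
have [y yS] := quad_form_normalize (lt0r_neq0 x0).
have yS1 : quad_form S y = 1 by rewrite yS gtr0_sg.
have [|K [Ku KE]] := sym_split Ssym _ yS1; first exact: oner_neq0.
have [p [q Hq]] := IH _ (sym_congr K Ssym).
by exists p.+1, q; apply: (has_inertia_cons Ku KE Hq) => //; exact: inertia_mx_consl.
Qed.

(** Unlike [has_inertia], the right-hand side does not order a basis, so that it is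
    compatible with block sums. *)
Lemma has_inertiaP N (S : 'M[R]_N) p q : S^T = S ->
  has_inertia S p q <-> [/\ posdef_dim S p, posdef_dim (- S) q & \rank S = (p + q)%N].
Proof.
move=> Ssym; split=> [H|[H1 H2 H3]].
  by have [] := has_inertia_unique_aux 0 H.
have [p' [q' H]] := has_inertia_exists Ssym.
have [_ _ H3' /(_ H1) pp' _] := has_inertia_unique_aux p H.
have [_ _ _ _ /(_ H2) qq'] := has_inertia_unique_aux q H.
have -> : p = p' by lia.
by have -> : q = q' by lia.
Qed.

Lemma has_inertia_unique N (S : 'M[R]_N) p q p' q' :
  has_inertia S p q -> has_inertia S p' q' -> p = p' /\ q = q'.
Proof.
move=> H H'.
have [P1 P2 _ _ _] := has_inertia_unique_aux 0 H; have [P1' P2' _ _ _] := has_inertia_unique_aux 0 H'.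
have [_ _ _ A _] := has_inertia_unique_aux p H'; have [_ _ _ _ B] := has_inertia_unique_aux q H'.
have [_ _ _ A' _] := has_inertia_unique_aux p' H; have [_ _ _ _ B'] := has_inertia_unique_aux q' H.
by split; apply/eqP; rewrite eqn_leq; [rewrite A // A'|rewrite B // B'].
Qed.

Lemma posdef_dim_block N M (P : 'M[R]_N) (S : 'M[R]_M) p q :
  posdef_dim P p -> posdef_dim S q -> posdef_dim (block_mx P 0 0 S) (p + q).
Proof.
move=> [U HU] [V HV]; exists (block_mx U 0 0 V) => x x0.
rewrite -[x]hsubmxK mul_row_block !mulmx0 addr0 add0r /quad_form.
rewrite mul_row_block !mulmx0 addr0 add0r tr_row_mx mul_row_col mxE.
rewrite -/(quad_form P _) -/(quad_form S _).
have H1 : 0 <= quad_form P (lsubmx x *m U).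
  have [->|/HU/ltW//] := eqVneq (lsubmx x) 0.
  by rewrite mul0mx /quad_form !mul0mx mxE.
have H2 : 0 <= quad_form S (rsubmx x *m V).
  have [->|/HV/ltW//] := eqVneq (rsubmx x) 0.
  by rewrite mul0mx /quad_form !mul0mx mxE.
have [x1|/HU x1] := eqVneq (lsubmx x) 0; last by rewrite ltr_wpDr.
rewrite ltr_wpDl // HV //; apply: contraNneq x0 => x2.
by rewrite -[x]hsubmxK x1 x2 row_mx0.
Qed.

Lemma has_inertia_block N M (P : 'M[R]_N) (S : 'M[R]_M) r s p q : P^T = P -> S^T = S ->
  has_inertia P r s -> has_inertia S p q -> has_inertia (block_mx P 0 0 S) (r + p) (s + q).
Proof.
move=> Ps Ss /(has_inertiaP _ _ Ps) [P1 P2 P3] /(has_inertiaP _ _ Ss) [S1 S2 S3].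
apply/has_inertiaP; first by rewrite tr_block_mx Ps Ss !trmx0.
split; first exact: posdef_dim_block.
  by rewrite opp_block_mx !oppr0; exact: posdef_dim_block.
by rewrite rank_diag_block_mx P3 S3; lia.
Qed.

Lemma has_inertia_congr N (S T : 'M[R]_N) p q : T \in unitmx ->
  has_inertia (T *m S *m T^T) p q <-> has_inertia S p q.
Proof.
move=> Tu; split=> -[pqN [T' Tu' TS]]; split=> //.
  by exists (T' *m T); rewrite ?unitmx_mul ?Tu' // trmx_mul !mulmxA -!mulmxA in TS *.
exists (T' *m invmx T); first by rewrite unitmx_mul Tu' unitmx_inv.
rewrite trmx_mul !mulmxA mulmxKV //.
by rewrite trmx_inv -(mulmxA _ T^T) mulmxV ?unitmx_tr // mulmx1.
Qed.

End Inertia.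

(** * Signatures of subspaces as inertia of Gram matrices *)

Section RowSpace.
Context {R : realType}.

Lemma mem_span_rows N M (A : 'M[R]_(N, M)) u :
  (u \in <<[seq row i A | i : 'I_N]>>%VS) = (u <= A)%MS.
Proof.
apply/idP/idP => [|/submxP[D ->]]; last first.
  rewrite mulmx_sum_row; apply: memv_suml => i _; apply: memvZ.
  by rewrite memv_span //; apply/mapP; exists i; rewrite ?mem_enum.
move=> uA; rewrite (coord_span (X := in_tuple _) uA).
apply: summx_sub => i _; apply: scalemx_sub.
have : (in_tuple [seq row i A | i : 'I_N])`_i \in [seq row i A | i : 'I_N].
  exact: mem_nth.
by case/mapP => j _ ->; exact: row_sub.
Qed.

Lemma free_rows N M (X : N.-tuple 'rV[R]_M) :
  free X = row_free (\matrix_i tnth X i).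
Proof.
apply/idP/idP => [/freeP H|H].
  apply: inj_row_free => v vX; apply/rowP => i; rewrite mxE.
  apply: (H (v 0)); rewrite -[RHS]vX mulmx_sum_row.
  by apply: eq_bigr => j _; rewrite rowK (tnth_nth 0).
apply/freeP => k Hk i.
have : (\row_j k j) *m (\matrix_i tnth X i) = 0.
  rewrite -[RHS]Hk mulmx_sum_row; apply: eq_bigr => j _.
  by rewrite rowK mxE (tnth_nth 0).
by move/eqP; rewrite mulmx_free_eq0 // => /eqP /rowP /(_ i); rewrite !mxE.
Qed.

Lemma dim_span_rows N M (A : 'M[R]_(N, M)) : row_free A ->
  \dim <<[seq row i A | i : 'I_N]>>%VS = N.
Proof.
move=> Af; have : free [tuple row i A | i < N].
  rewrite free_rows (_ : \matrix_i _ = A) //.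
  by apply/row_matrixP => i; rewrite rowK tnth_mktuple.
by rewrite /free size_tuple => /eqP.
Qed.

(** Both sides ask for a diagonalizing basis of [V], and the bases of [V] are the rows of T A with T
    invertible. *)
Lemma signatureP N M (G : 'M[R]_M) (A : 'M[R]_(N, M)) (V : {vspace 'rV[R]_M}) beta p q :
  (forall u v, beta u v = (u *m G *m v^T) 0 0) ->
  (forall u, (u \in V) = (u <= A)%MS) -> row_free A -> \dim V = N ->
  signature beta V p q <-> has_inertia (A *m G *m A^T) p q.
Proof.
move=> bE VA Af dV; rewrite /signature dV.
have gramE (X : N.-tuple 'rV[R]_M) i j :
    ((\matrix_i tnth X i) *m G *m (\matrix_i tnth X i)^T) i j = beta (tnth X i) (tnth X j).
  rewrite bE [LHS]mxE [RHS]mxE; apply: eq_bigr => k _; rewrite !mxE.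
  by congr (_ * _); apply: eq_bigr => l _; rewrite !mxE.
have inertia_mxE i j : inertia_mx p q N i j = if i != j then 0 : R
      else if (i < p)%N then 1 else if (i < p + q)%N then -1 else 0.
  by rewrite !mxE; case: eqVneq => [->|_] /=; rewrite ?mulr1n ?mulr0n.
split=> -[pqN].
  case=> e [be eE]; split=> //; have [T TE] : exists T, \matrix_i tnth e i = T *m A.
    apply/submxP/row_subP => i; rewrite rowK -VA -(span_basis be) memv_span //.
    exact: mem_tnth.
  exists T.
    rewrite -row_free_unit /row_free -(mxrankMfree _ Af) -TE -/(row_free _) -free_rows.
    exact: basis_free be.
  apply/matrixP => i j; rewrite inertia_mxE -eE -gramE TE.
  by rewrite trmx_mul !mulmxA.
case=> T Tu TE; split=> //; exists [tuple row i (T *m A) | i < N].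
have eM : \matrix_i tnth [tuple row i (T *m A) | i < N] i = T *m A.
  by apply/row_matrixP => i; rewrite rowK tnth_mktuple.
split; last first.
  by move=> i j; rewrite -gramE eM -inertia_mxE -TE trmx_mul !mulmxA.
rewrite basisEdim size_tuple dV leqnn andbT; apply/subvP => u.
rewrite VA => uA.
have := mem_span_rows (T *m A) u; rewrite (eqmxMfull _ _) ?row_full_unit // uA.
by move=> /= ->.
Qed.

End RowSpace.

(** * Real coordinates on complex vector spaces *)

Section ComplexMatrices.
Context {R : realType}.
Local Notation C := R[i].

Definition cmx {p q} (A : 'M[R]_(p, q)) : 'M[C]_(p, q) := map_mx (real_complex R) A.
Definition remx {p q} (A : 'M[C]_(p, q)) : 'M[R]_(p, q) := map_mx (@complex.Re R) A.
Definition immx {p q} (A : 'M[C]_(p, q)) : 'M[R]_(p, q) := map_mx (@complex.Im R) A.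

Lemma Im_realM (a : R) (z : C) : complex.Im (a%:C * z) = a * complex.Im z.
Proof. by case: z => x y /=; ring. Qed.

Lemma immx_cmull p q r (A : 'M[R]_(p, q)) (Z : 'M[C]_(q, r)) :
  immx (cmx A *m Z) = A *m immx Z.
Proof.
apply/matrixP => i j; rewrite !mxE (raddf_sum (@complex.Im R : Rcomplex R -> R)).
apply: eq_bigr => k _; rewrite !mxE; exact: Im_realM.
Qed.

Lemma immx_cmulr p q r (A : 'M[R]_(q, r)) (Z : 'M[C]_(p, q)) :
  immx (Z *m cmx A) = immx Z *m A.
Proof.
apply/matrixP => i j; rewrite !mxE (raddf_sum (@complex.Im R : Rcomplex R -> R)).
by apply: eq_bigr => k _; rewrite !mxE mulrC [RHS]mulrC; exact: Im_realM.
Qed.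

Lemma complex_mxE p q (Z : 'M[C]_(p, q)) : Z = cmx (remx Z) + 'i *: cmx (immx Z).
Proof. by apply/matrixP => i j; rewrite !mxE {1}[Z i j]complexE. Qed.

Lemma remx_cmx p q (A B : 'M[R]_(p, q)) : remx (cmx A + 'i *: cmx B) = A.
Proof. by apply/matrixP => i j; rewrite !mxE /=; ring. Qed.

Lemma immx_cmx p q (A B : 'M[R]_(p, q)) : immx (cmx A + 'i *: cmx B) = B.
Proof. by apply/matrixP => i j; rewrite !mxE /=; ring. Qed.

Lemma immxZi p q (Z : 'M[C]_(p, q)) : immx ('i *: Z) = remx Z.
Proof. by apply/matrixP => i j; rewrite !mxE; case: (Z i j) => x y /=; ring. Qed.

Lemma immx_cmx0 p q (A : 'M[R]_(p, q)) : immx (cmx A) = 0.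
Proof. by apply/matrixP => i j; rewrite !mxE /=. Qed.

Lemma remx_cmx0 p q (A : 'M[R]_(p, q)) : remx (cmx A) = A.
Proof. by apply/matrixP => i j; rewrite !mxE /=. Qed.

Lemma i_squared : 'i * 'i = -1 :> C.
Proof. by apply/eqP; rewrite eq_complex /=; apply/andP; split; apply/eqP; ring. Qed.

Lemma cmxM p q r (A : 'M[R]_(p, q)) (B : 'M[R]_(q, r)) : cmx (A *m B) = cmx A *m cmx B.
Proof. exact: map_mxM. Qed.
Lemma cmxT p q (A : 'M[R]_(p, q)) : cmx A^T = (cmx A)^T.
Proof. by rewrite /cmx map_trmx. Qed.
Lemma cmxN p q (A : 'M[R]_(p, q)) : cmx (- A) = - cmx A.
Proof. exact: map_mxN. Qed.
Lemma cmx1 n : cmx (1%:M : 'M[R]_n) = 1%:M.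
Proof. exact: map_mx1. Qed.
Lemma cmx0 m n : cmx (0 : 'M[R]_(m, n)) = 0.
Proof. exact: map_mx0. Qed.

Definition complexify_mx n : 'M[C]_(n + n, n) := col_mx 1%:M 'i%:M.
(** Acts on row vectors from the right: (x, y) goes to (-y, x). *)
Definition mul_i_mx n : 'M[R]_(n + n) := block_mx 0 1%:M (- 1%:M) 0.

Definition toC {p n} (A : 'M[R]_(p, n + n)) : 'M[C]_(p, n) := cmx A *m complexify_mx n.
Definition ofC {p n} (Z : 'M[C]_(p, n)) : 'M[R]_(p, n + n) := row_mx (remx Z) (immx Z).

Lemma toC_row p n (A B : 'M[R]_(p, n)) : toC (row_mx A B) = cmx A + 'i *: cmx B.
Proof.
by rewrite /toC /cmx map_row_mx mul_row_col mulmx1 mul_mx_scalar.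
Qed.

Lemma ofCK p n (Z : 'M[C]_(p, n)) : toC (ofC Z) = Z.
Proof. by rewrite toC_row -complex_mxE. Qed.

Lemma toCK p n (A : 'M[R]_(p, n + n)) : ofC (toC A) = A.
Proof. by rewrite -[A]hsubmxK toC_row /ofC remx_cmx immx_cmx. Qed.

Lemma to_complexE n (u : 'rV[R]_(n + n)) : to_complex u = toC u.
Proof.
rewrite -[RHS]/(toC u) -{2}[u]hsubmxK toC_row; apply/rowP => j; rewrite !mxE.
by apply/eqP; rewrite eq_complex /=; apply/andP; split; apply/eqP; ring.
Qed.

Lemma toC_mul p q n (X : 'M[R]_(p, q)) (A : 'M[R]_(q, n + n)) :
  toC (X *m A) = cmx X *m toC A.
Proof. by rewrite /toC cmxM mulmxA. Qed.

Lemma mul_i_complexify n : cmx (mul_i_mx n) *m complexify_mx n = 'i *: complexify_mx n.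
Proof.
rewrite /mul_i_mx /cmx map_block_mx -!/(cmx _) cmxN cmx1 !cmx0 mul_block_col.
rewrite !mul0mx add0r addr0 mul1mx mulNmx mul1mx scale_col_mx scalemx1.
by rewrite scale_scalar_mx i_squared raddfN.
Qed.

Lemma toC_mul_i p n (A : 'M[R]_(p, n + n)) : toC (A *m mul_i_mx n) = 'i *: toC A.
Proof. by rewrite /toC cmxM -mulmxA mul_i_complexify scalemxAr. Qed.

Lemma mul_i_mx_sq n : mul_i_mx n *m mul_i_mx n = - 1%:M.
Proof.
rewrite /mul_i_mx mulmx_block !mul0mx !mulmx0 mul1mx mulmx1 !addr0 !add0r.
by rewrite -[in RHS]/(1%:M) (scalar_mx_block n n) opp_block_mx oppr0.
Qed.

Lemma toC_inj p n : injective (@toC p n).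
Proof. exact: can_inj (@toCK p n). Qed.

End ComplexMatrices.

(** * Real matrices of the real and imaginary parts of the form *)

Section Form.
Context {R : realType} {n : nat}.
Local Notation C := R[i].
Context (b : {symmetric 'rV[C]_n}) (hb : nondegenerate b).

Definition form_mx : 'M[C]_n := matrix_of_form b.

Lemma form_mxE u v : b u v = (u *m form_mx *m v^T) 0 0.
Proof.
rewrite -[LHS](matrix_of_formK (theta := idfun) b u v) /form_of_matrix.
by rewrite [X in \tr X]mx11_scalar mxtrace_scalar mulr1n map_mx_id.
Qed.

Lemma form_mx_sym : form_mx^T = form_mx.
Proof. by apply/matrixP => i j; rewrite !mxE hermC /= expr0 mul1r. Qed.

Lemma form_mx_unit : form_mx \in unitmx.
Proof.
rewrite -row_free_unit; apply: inj_row_free => v vB.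
apply/eqP; rewrite -memv0; move: hb => /eqP <-; apply/mem_orthovP => u _.
by rewrite form_mxE vB mul0mx mxE.
Qed.

Definition im_form_mx : 'M[R]_(n + n) := immx (complexify_mx n *m form_mx *m (complexify_mx n)^T).

Lemma im_toC p q (A : 'M[R]_(p, n + n)) (B : 'M[R]_(q, n + n)) :
  immx (toC A *m form_mx *m (toC B)^T) = A *m im_form_mx *m B^T.
Proof.
by rewrite /toC trmx_mul !mulmxA -cmxT immx_cmulr -!mulmxA immx_cmull !mulmxA.
Qed.

(** Since Re z = Im (i z), the matrix of Im b together with multiplication by i describes both real
    forms. *)
Lemma re_toC p q (A : 'M[R]_(p, n + n)) (B : 'M[R]_(q, n + n)) :
  remx (toC A *m form_mx *m (toC B)^T) = A *m (mul_i_mx n *m im_form_mx) *m B^T.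
Proof. by rewrite -immxZi 2!scalemxAl -toC_mul_i im_toC !mulmxA. Qed.

Lemma im_formE u v : im_form b u v = (u *m im_form_mx *m v^T) 0 0.
Proof. by rewrite /im_form form_mxE !to_complexE -im_toC [RHS]mxE. Qed.

Lemma re_formE u v : re_form b u v = (u *m (mul_i_mx n *m im_form_mx) *m v^T) 0 0.
Proof. by rewrite /re_form form_mxE !to_complexE -re_toC [RHS]mxE. Qed.

Lemma im_gramE p q (A : 'M[R]_(p, n + n)) (B : 'M[R]_(q, n + n)) :
  im_gram b A B = A *m im_form_mx *m B^T.
Proof.
apply/matrixP => i j; rewrite mxE im_formE [LHS]mxE [RHS]mxE.
apply: eq_bigr => k _; rewrite !mxE.
by congr (_ * _); apply: eq_bigr => l _; rewrite !mxE.
Qed.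

Lemma im_form_mx_sym : im_form_mx^T = im_form_mx.
Proof. by rewrite /im_form_mx /immx map_trmx !trmx_mul trmxK form_mx_sym mulmxA. Qed.

(** Multiplication by i is self-adjoint for Im b because b is complex bilinear rather than
    sesquilinear. *)
Lemma mul_i_im_form : mul_i_mx n *m im_form_mx = im_form_mx *m (mul_i_mx n)^T.
Proof.
have -> : mul_i_mx n *m im_form_mx = immx (toC (mul_i_mx n) *m form_mx *m (toC 1%:M)^T).
  by rewrite im_toC trmx1 mulmx1.
have -> : im_form_mx *m (mul_i_mx n)^T = immx (toC 1%:M *m form_mx *m (toC (mul_i_mx n))^T).
  by rewrite im_toC mul1mx.
have -> : toC (mul_i_mx n : 'M[R]_(n + n)) = 'i *: toC 1%:M by rewrite -{1}[mul_i_mx n]mul1mx toC_mul_i.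
by rewrite linearZ /= -!scalemxAl -scalemxAr.
Qed.

(** A vector in the radical of Im b is in the radical of Re b as well, because i can be moved to the
    other argument; so it is b-orthogonal to all of C^n. *)
Lemma im_form_mx_unit : im_form_mx \in unitmx.
Proof.
rewrite -row_free_unit; apply: inj_row_free => v vG.
have H : toC v *m form_mx *m (toC (ofC 1%:M))^T = 0.
  rewrite [LHS]complex_mxE im_toC vG mul0mx cmx0 scaler0 addr0 re_toC.
  by rewrite mul_i_im_form mulmxA vG !mul0mx cmx0.
move: H; rewrite ofCK trmx1 mulmx1 => /eqP.
rewrite mulmx_free_eq0 ?row_free_unit ?form_mx_unit // => /eqP v0.
by apply: toC_inj; rewrite v0 /toC cmx0 mul0mx.
Qed.

End Form.

(** * Witt bases and graphs of skew matrices *)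

Section Witt.
Context {R : realType} {n : nat}.
Local Notation C := R[i].
Context (b : {symmetric 'rV[C]_n}) (hb : nondegenerate b).
Local Notation G := (im_form_mx b).

Lemma mem_row_space (A : 'M[R]_(n, n + n)) u : (u \in row_space A) = (u <= A)%MS.
Proof. exact: mem_span_rows. Qed.

Lemma row_space_eqP (A B : 'M[R]_(n, n + n)) : row_free A -> row_free B ->
  row_space A = row_space B <-> exists2 Q, Q \in unitmx & A = Q *m B.
Proof.
move=> Af Bf; split=> [AB|[Q Qu ->]].
  have /submxP[Q QE] : (A <= B)%MS.
    by apply/row_subP => i; rewrite -mem_row_space -AB mem_row_space row_sub.
  exists Q => //; rewrite -row_free_unit /row_free -(mxrankMfree _ Bf) -QE.
  exact: Af.
by apply/vspaceP => u; rewrite !mem_row_space eqmxMfull // row_full_unit.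
Qed.

Definition witt (E F : 'M[R]_(n, n + n)) :=
  [/\ im_gram b E E = 0, im_gram b F F = 0 & im_gram b E F = 1%:M].

Lemma im_gramT p q (A : 'M[R]_(p, n + n)) (B : 'M[R]_(q, n + n)) :
  (im_gram b A B)^T = im_gram b B A.
Proof. by rewrite !im_gramE !trmx_mul trmxK im_form_mx_sym mulmxA. Qed.

Lemma im_gram_mull p q r (X : 'M[R]_(r, p)) (A : 'M[R]_(p, n + n)) (B : 'M[R]_(q, n + n)) :
  im_gram b (X *m A) B = X *m im_gram b A B.
Proof. by rewrite !im_gramE !mulmxA. Qed.

Lemma im_gram_mulr p q r (X : 'M[R]_(r, q)) (A : 'M[R]_(p, n + n)) (B : 'M[R]_(q, n + n)) :
  im_gram b A (X *m B) = im_gram b A B *m X^T.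
Proof. by rewrite !im_gramE trmx_mul !mulmxA. Qed.

Lemma im_gramDl p q (A A' : 'M[R]_(p, n + n)) (B : 'M[R]_(q, n + n)) :
  im_gram b (A + A') B = im_gram b A B + im_gram b A' B.
Proof. by rewrite !im_gramE !mulmxDl. Qed.

Lemma im_gramDr p q (A : 'M[R]_(p, n + n)) (B B' : 'M[R]_(q, n + n)) :
  im_gram b A (B + B') = im_gram b A B + im_gram b A B'.
Proof. by rewrite !im_gramE linearD /= !mulmxDr. Qed.

Lemma im_gram_row p q (A A' : 'M[R]_(p, n + n)) (B B' : 'M[R]_(q, n + n)) :
  im_gram b (col_mx A A') (col_mx B B') =
  block_mx (im_gram b A B) (im_gram b A B') (im_gram b A' B) (im_gram b A' B').
Proof. by rewrite !im_gramE tr_col_mx mul_col_mx mul_col_row. Qed.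

Lemma wittC E F : witt E F -> im_gram b F E = 1%:M.
Proof. by move=> [_ _ EF]; rewrite -im_gramT EF trmx1. Qed.

Lemma witt_unit E F : witt E F -> col_mx E F \in unitmx.
Proof.
move=> W; have [EE FF EF] := W.
have H : col_mx E F *m (G *m (col_mx E F)^T *m block_mx 0 1%:M 1%:M 0) = 1%:M.
  rewrite !mulmxA -im_gramE im_gram_row EE FF EF (wittC W) mulmx_block.
  by rewrite !mul0mx !mulmx0 !mul1mx !addr0 !add0r (scalar_mx_block n n).
exact: (mulmx1_unit H).1.
Qed.

Lemma witt_expand E F p (M : 'M[R]_(p, n + n)) : witt E F ->
  M = im_gram b M F *m E + im_gram b M E *m F.
Proof.
move=> W; have [EE FF EF] := W.
have u : G *m (col_mx E F)^T \in unitmx.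
  by rewrite unitmx_mul im_form_mx_unit // unitmx_tr witt_unit.
apply: (can_inj (mulmxK u)); rewrite !mulmxA -!im_gramE.
have gr p' (A : 'M[R]_(p', n + n)) :
    im_gram b A (col_mx E F) = row_mx (im_gram b A E) (im_gram b A F).
  by rewrite !im_gramE tr_col_mx mul_mx_row.
rewrite gr [RHS]gr !im_gramDl !im_gram_mull EE FF EF (wittC W).
by rewrite !mulmx1 !mulmx0 addr0 add0r.
Qed.

Lemma witt_free E F : witt E F -> row_free E.
Proof.
move=> [_ _ EF]; apply/row_freeP; exists (G *m F^T).
by rewrite mulmxA -im_gramE.
Qed.

(** For X = Y this shows that a graph is isotropic exactly when its matrix is skew. *)
Lemma gram_graph E F X Y : witt E F ->
  im_gram b (E + X *m F) (E + Y *m F) = X + Y^T.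
Proof.
move=> W; have [EE FF EF] := W.
rewrite !im_gramDl !im_gramDr !im_gram_mull !im_gram_mulr EE FF EF (wittC W).
by rewrite mul0mx !mulmx0 mul1mx mulmx1 add0r addr0 addrC.
Qed.

Lemma witt_graph E F X : witt E F -> skew_mx R n X -> witt (E + X *m F) F.
Proof.
move=> W Xs; have [EE FF EF] := W; split=> //.
  by rewrite gram_graph // Xs subrr.
by rewrite im_gramDl im_gram_mull FF EF mulmx0 addr0.
Qed.

Lemma graph_inj E F X Y Q : witt E F -> E + X *m F = Q *m (E + Y *m F) ->
  Q = 1%:M /\ X = Y.
Proof.
move=> W; have [EE FF EF] := W => H.
have Q1 : Q = 1%:M.
  have := congr1 (fun M => im_gram b M F) H.
  by rewrite /= im_gram_mull !im_gramDl !im_gram_mull FF EF !mulmx0 !addr0 mulmx1.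
split=> //; move: H; rewrite Q1 mul1mx => /addrI /(congr1 (fun M => im_gram b M E)).
by rewrite /= !im_gram_mull (wittC W) !mulmx1.
Qed.

Lemma isotropic_row_space (A : 'M[R]_(n, n + n)) :
  isotropic b (row_space A) <-> im_gram b A A = 0.
Proof.
split=> [H|H u v].
  by apply/matrixP => i j; rewrite !mxE H // mem_row_space row_sub.
rewrite !mem_row_space => /submxP[x ->] /submxP[y ->].
by rewrite im_formE trmx_mul !mulmxA -(mulmxA x) -(mulmxA x) -im_gramE H mulmx0 mul0mx mxE.
Qed.

Lemma dim_row_space (A : 'M[R]_(n, n + n)) : row_free A -> \dim (row_space A) = n.
Proof. exact: dim_span_rows. Qed.

(** Expanding the rows of a test matrix W in the Witt basis, with coefficients <W, E> on F, shows
    that both sides of the Hodge equation are proportional to det <W, E>. So the single test W = F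
    decides. *)
Lemma dualP e E F : witt E F ->
  dual b e (row_space E) <-> volume b (col_mx F E) = (-1) ^+ e.
Proof.
move=> W; have [EE FF EF] := W; split=> [[A [Af AE HA]]|HV].
  have [Q Qu QE] := (row_space_eqP Af (witt_free W)).1 AE.
  have := HA F; rewrite QE im_gram_mulr (wittC W) mul1mx det_tr.
  have -> : col_mx F (Q *m E) = block_mx 1%:M 0 0 Q *m col_mx F E.
    by rewrite mul_block_col mul1mx !mul0mx addr0 add0r.
  rewrite /volume det_mulmx det_ublock det1 mul1r mulrCA [RHS]mulrC.
  by apply: mulfI; move: Qu; rewrite unitmxE unitfE.
exists E; split=> //; first exact: witt_free W.
move=> M; have -> : col_mx M E =
    block_mx (im_gram b M E) (im_gram b M F) 0 1%:M *m col_mx F E.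
  rewrite mul_block_col mul0mx mul1mx add0r [X in col_mx _ X = _]/=.
  by congr col_mx; rewrite addrC; exact: witt_expand.
by rewrite /volume det_mulmx det_ublock det1 mulr1 mulrCA -/(volume b _) HV mulrC.
Qed.

Lemma IGr_graph e E F X : witt E F -> skew_mx R n X ->
  IGr b e (row_space E) -> IGr b e (row_space (E + X *m F)).
Proof.
move=> W Xs [_ _ /(dualP e W) HE]; have W' := witt_graph W Xs.
split; first by rewrite dim_row_space // (witt_free W').
  by apply/isotropic_row_space; case: W'.
apply/(dualP e W'); rewrite -HE.
have -> : col_mx F (E + X *m F) = block_mx 1%:M 0 X 1%:M *m col_mx F E.
  by rewrite mul_block_col !mul1mx mul0mx addr0 addrC.
by rewrite /volume det_mulmx det_lblock !det1 !mul1r.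
Qed.

(** Expand E + XF as M E' + N F' with M = <E + XF, F'> and N = <E + XF, E'>. The same subspace is
    the graph of M^-1 N over E', so changes of chart are fractional linear. *)
Definition transition_denom (E F E' F' : 'M[R]_(n, n + n)) X := im_gram b (E + X *m F) F'.
Definition transition_graph (E F E' F' : 'M[R]_(n, n + n)) X :=
  invmx (transition_denom E F E' F' X) *m im_gram b (E + X *m F) E'.

Lemma transition1 E F E' F' X : witt E F -> witt E' F' -> skew_mx R n X ->
  transition_denom E F E' F' X \in unitmx ->
  row_space (E + X *m F) = row_space (E' + transition_graph E F E' F' X *m F') /\
  skew_mx R n (transition_graph E F E' F' X).
Proof.
move=> W W' Xs u; have WX := witt_graph W Xs.
have H : E + X *m F = transition_denom E F E' F' X *m (E' + transition_graph E F E' F' X *m F').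
  by rewrite mulmxDr mulmxA mulKVmx //; exact: witt_expand.
have H' : E' + transition_graph E F E' F' X *m F' = invmx (transition_denom E F E' F' X) *m (E + X *m F).
  by rewrite H mulKmx.
split.
  apply/row_space_eqP; [exact: witt_free WX| |by exists (transition_denom E F E' F' X)].
  rewrite H' /row_free eqmxMfull ?row_full_unit ?unitmx_inv //.
  exact: witt_free WX.
apply/eqP; rewrite -addr_eq0 addrC -(gram_graph _ _ W') H'.
by rewrite im_gram_mull im_gram_mulr (let: And3 h _ _ := WX in h) mul0mx mulmx0.
Qed.

(** Pairing with F' identifies the base change between the two graphs with the denominator, which is
    therefore invertible wherever both charts are defined. *)
Lemma transition2 E F E' F' X X' : witt E F -> witt E' F' -> skew_mx R n X ->
  skew_mx R n X' -> row_space (E + X *m F) = row_space (E' + X' *m F') ->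
  transition_denom E F E' F' X \in unitmx /\ X' = transition_graph E F E' F' X.
Proof.
move=> W W' Xs Xs'; have WX := witt_graph W Xs; have WX' := witt_graph W' Xs'.
move/(row_space_eqP (witt_free WX) (witt_free WX')) => [Q Qu H].
have [_ FF' EF'] := W'; have [EE' _ _] := W'.
have QE : transition_denom E F E' F' X = Q.
  by rewrite /transition_denom H im_gram_mull im_gramDl im_gram_mull FF' EF' mulmx0 addr0 mulmx1.
rewrite QE; split=> //; rewrite /transition_graph QE H im_gram_mull im_gramDl im_gram_mull EE'.
by rewrite (wittC W') mulmx1 add0r mulKmx.
Qed.

End Witt.

(** * Bases adapted to the signature *)

Section ComplexBasis.
Context {R : realType}.
Local Notation C := R[i].

Lemma toCD p n (A B : 'M[R]_(p, n + n)) : toC (A + B) = toC A + toC B.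
Proof. by rewrite /toC /cmx map_mxD mulmxDl. Qed.

Lemma cmul_toC p q n (Z : 'M[C]_(p, q)) (A : 'M[R]_(q, n + n)) :
  Z *m toC A = toC (remx Z *m A + immx Z *m (A *m mul_i_mx n)).
Proof.
by rewrite toCD (toC_mul (remx Z)) (toC_mul (immx Z)) toC_mul_i {1}[Z]complex_mxE mulmxDl -scalemxAl -scalemxAr.
Qed.

(** A real subspace stable under i is a complex subspace: [f] is a complex basis of it, and f
    together with if a real one, whence q = 2p. *)
Lemma complex_basis q n (v : 'M[R]_(q, n + n)) : row_free v ->
  (v *m mul_i_mx n <= v)%MS -> exists p (f : 'M[C]_(p, n)),
  [/\ row_free f, q = (p + p)%N & (v :=: col_mx (ofC f) (ofC f *m mul_i_mx n))%MS].
Proof.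
move=> vf vI; set N := toC v; pose f := row_base N.
have ff : row_free f by exact: row_base_free.
have Ff : row_free (col_mx (ofC f) (ofC f *m mul_i_mx n)).
  apply: inj_row_free => x.
  rewrite -[x]hsubmxK mul_row_col => /(congr1 toC).
  rewrite toCD (toC_mul (lsubmx x)) (toC_mul (rsubmx x)) toC_mul_i ofCK /toC cmx0 mul0mx -scalemxAr scalemxAl -mulmxDl => /eqP.
  rewrite mulmx_free_eq0 // => /eqP x0.
  have x1 := congr1 remx x0; have x2 := congr1 immx x0.
  move: x1 x2; rewrite remx_cmx immx_cmx => -> ->.
  by rewrite -(cmx0 (R := R)) remx_cmx0 immx_cmx0 row_mx0.
have vF : (v :=: col_mx (ofC f) (ofC f *m mul_i_mx n))%MS.
  apply/eqmxP/andP; split.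
    have /submxP[c cE] : (N <= f)%MS by rewrite eq_row_base.
    apply/submxP; exists (row_mx (remx c) (immx c)).
    by apply: toC_inj; rewrite mul_row_col -cmul_toC ofCK -cE.
  have /submxP[c cE] : (f <= N)%MS by rewrite eq_row_base.
  have fE : ofC f = remx c *m v + immx c *m (v *m mul_i_mx n).
    by apply: toC_inj; rewrite ofCK cE cmul_toC.
  have fv : (ofC f <= v)%MS.
    rewrite fE addmx_sub // ?submxMl //.
    by apply: submx_trans vI; exact: submxMl.
  by rewrite col_mx_sub fv; apply: submx_trans vI; exact: submxMr.
exists (\rank N), f; split=> //.
by apply: etrans (eqP Ff); rewrite -vF; exact/esym/eqP.
Qed.

End ComplexBasis.

Section AdaptedBasis.
Context {R : realType}.
Local Notation C := R[i].

Lemma basis_matrix N M (V : {vspace 'rV[R]_M}) : \dim V = N ->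
  exists2 A : 'M[R]_(N, M), row_free A & forall u, (u \in V) = (u <= A)%MS.
Proof.
move=> dV; move: (vbasisP V); move: (vbasis V); rewrite dV => X XV.
exists (\matrix_i tnth X i); first by rewrite -free_rows; exact: basis_free XV.
move=> u; rewrite -mem_span_rows -(span_basis XV).
congr (u \in span _); apply: (@eq_from_nth _ 0).
  by rewrite size_tuple size_map size_enum_ord.
move=> i; rewrite size_tuple => iN.
have -> : i = val (Ordinal iN) by [].
by rewrite -tnth_nth (nth_map (Ordinal iN)) ?size_enum_ord // nth_ord_enum rowK.
Qed.

Definition Jmx k : 'M[R]_(k + k) := block_mx 0 1%:M (- 1%:M) 0.
Definition block_J m k : 'M[R]_(m + (k + k)) := block_mx 0 0 0 (Jmx k).
Definition block_eps m k (eps : 'M[R]_m) : 'M[R]_(m + (k + k)) := block_mx eps 0 0 0.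

Context {m k : nat}.
Local Notation n := (m + (k + k))%N.
Context (b : {symmetric 'rV[C]_n}) (hb : nondegenerate b).
Local Notation G := (im_form_mx b).

(** The relations satisfied by E = (e, f, if) and F = (i eps e, ig, g). *)
Definition adapted (eps : 'M[R]_m) (E F : 'M[R]_(n, n + n)) :=
  [/\ witt b E F, E *m mul_i_mx n = block_J m k *m E + block_eps k eps *m F &
      F *m mul_i_mx n = - block_eps k eps *m E - block_J m k *m F].

Local Notation P A B := (A *m G *m B^T).
Local Notation Q A B := (A *m (mul_i_mx n *m G) *m B^T).

Lemma im_prod_il p q (A : 'M[R]_(p, n + n)) (B : 'M[R]_(q, n + n)) : P (A *m mul_i_mx n) B = Q A B.
Proof. by rewrite !mulmxA. Qed.

Lemma im_prod_ir p q (A : 'M[R]_(p, n + n)) (B : 'M[R]_(q, n + n)) : P A (B *m mul_i_mx n) = Q A B.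
Proof. by rewrite trmx_mul mul_i_im_form !mulmxA. Qed.

Lemma im_prod_ii p q (A : 'M[R]_(p, n + n)) (B : 'M[R]_(q, n + n)) :
  P (A *m mul_i_mx n) (B *m mul_i_mx n) = - P A B.
Proof. by rewrite im_prod_ir !mulmxA -(mulmxA A) mul_i_mx_sq mulmxN mulmx1 !mulNmx. Qed.

Lemma im_prodT p q (A : 'M[R]_(p, n + n)) (B : 'M[R]_(q, n + n)) : (P A B)^T = P B A.
Proof. by rewrite !trmx_mul trmxK im_form_mx_sym mulmxA. Qed.

Lemma re_prodT p q (A : 'M[R]_(p, n + n)) (B : 'M[R]_(q, n + n)) : (Q A B)^T = Q B A.
Proof. by rewrite !trmx_mul trmxK im_form_mx_sym -mul_i_im_form !mulmxA. Qed.

Lemma im_prod_block p q p' q' (A : 'M[R]_(p, n + n)) (B : 'M[R]_(q, n + n))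
  (A' : 'M[R]_(p', n + n)) (B' : 'M[R]_(q', n + n)) :
  P (col_mx A A') (col_mx B B') = block_mx (P A B) (P A B') (P A' B) (P A' B').
Proof. by rewrite tr_col_mx mul_col_mx mul_col_row. Qed.

Lemma im_prod_row p q q' (A : 'M[R]_(p, n + n)) (B : 'M[R]_(q, n + n)) (B' : 'M[R]_(q', n + n)) :
  P A (col_mx B B') = row_mx (P A B) (P A B').
Proof. by rewrite tr_col_mx mul_mx_row. Qed.

Lemma im_prod_col p q p' (A : 'M[R]_(p, n + n)) (B : 'M[R]_(q, n + n)) (A' : 'M[R]_(p', n + n)) :
  P (col_mx A A') B = col_mx (P A B) (P A' B).
Proof. by rewrite !mul_col_mx. Qed.

(** The second basis is forced by Im b (u, iv) = Re b (u, v): since [eps eps = 1], e is dual to i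
    eps e, while f and if are dual to ig and g. *)
Lemma adapted_of_complex (eps : 'M[R]_m) (e0 : 'M[R]_(m, n + n))
    (f1 g1 : 'M[R]_(k, n + n)) : eps^T = eps -> eps *m eps = 1%:M ->
  [/\ P e0 e0 = 0, P e0 f1 = 0, P e0 g1 = 0 & Q e0 e0 = eps] ->
  [/\ Q e0 f1 = 0, Q e0 g1 = 0, P f1 f1 = 0 & Q f1 f1 = 0] ->
  [/\ P f1 g1 = 0, Q f1 g1 = 1%:M, P g1 g1 = 0 & Q g1 g1 = 0] ->
  adapted eps (col_mx e0 (col_mx f1 (f1 *m mul_i_mx n)))
    (col_mx (eps *m e0 *m mul_i_mx n) (col_mx (g1 *m mul_i_mx n) g1)).
Proof.
move=> epsT eps2 [Pee Pef Peg Qee] [Qef Qeg Pff Qff] [Pfg Qfg Pgg Qgg].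
have Pfe : P f1 e0 = 0 by rewrite -im_prodT Pef trmx0.
have Pge : P g1 e0 = 0 by rewrite -im_prodT Peg trmx0.
have Qfe : Q f1 e0 = 0 by rewrite -re_prodT Qef trmx0.
have Qge : Q g1 e0 = 0 by rewrite -re_prodT Qeg trmx0.
have Pl q (A : 'M[R]_(m, n + n)) (B : 'M[R]_(q, n + n)) :
  P (eps *m A) B = eps *m P A B by rewrite !mulmxA.
have Pr p (A : 'M[R]_(p, n + n)) (B : 'M[R]_(m, n + n)) :
  P A (eps *m B) = P A B *m eps by rewrite trmx_mul epsT !mulmxA.
split.
- rewrite -!mulmxA; split; rewrite im_gramE !im_prod_block !im_prod_row !im_prod_col ?Pl ?Pr.
  + by rewrite !im_prod_ii !im_prod_il !im_prod_ir Pee Pef Pfe Qef Qfe Pff Qff !oppr0 ?(row_mx0, col_mx0, block_mx0).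
  + rewrite ?Pl ?Pr !im_prod_ii !im_prod_il !im_prod_ir Pee Peg Pge Qeg Qge Pgg Qgg !oppr0.
    by rewrite !mulmx0 ?mul0mx ?mulmx0 ?(row_mx0, col_mx0, block_mx0).
  + rewrite ?Pr !im_prod_ii !im_prod_il !im_prod_ir Qee Peg Qeg Pfe Qfe Pfg Qfg eps2 !oppr0.
    by rewrite !mul0mx !col_mx0 !row_mx0 -!scalar_mx_block.
- rewrite /block_J /block_eps /Jmx !mul_block_col !mul_col_mx !mul0mx !add0r !addr0 mul1mx mulNmx mul1mx.
  rewrite !mulmxA eps2 mul1mx add_col_mx add0r addr0.
  by rewrite -(mulmxA f1) mul_i_mx_sq mulmxN mulmx1.
- rewrite mulNmx /block_J /block_eps /Jmx !mul_block_col !mul_col_mx !mul0mx !add0r !addr0 mul1mx mulNmx mul1mx.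
  rewrite !opp_col_mx add_col_mx !oppr0 addr0 add0r opprK.
  by rewrite -!(mulmxA _ (mul_i_mx n)) mul_i_mx_sq !mulmxN !mulmx1.
Qed.

End AdaptedBasis.

(** * The self-dual type of an orbit *)

Section InertiaMatrix.
Context {R : rcfType}.

Lemma inertia_mx_sym p q N : (inertia_mx p q N : 'M[R]_N)^T = inertia_mx p q N.
Proof. by rewrite /inertia_mx tr_diag_mx. Qed.

Lemma inertia_mx_sq p q : (inertia_mx p q (p + q) : 'M[R]_(p + q)) *m inertia_mx p q (p + q) = 1%:M.
Proof.
rewrite mul_diag_mx; apply/matrixP => i j; rewrite !mxE ltn_ord.
by have [->|ij] := eqVneq i j; rewrite ?mulr0 //= !mulr1n; case: ifP => _; rewrite ?mulr1 ?mulrNN ?mulr1.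
Qed.

Lemma inertia_mx_block p q N : inertia_mx p q ((p + q) + N) =
  block_mx (inertia_mx p q (p + q)) 0 0 0 :> 'M[R]_((p + q) + N).
Proof.
apply/matrixP => i j; case: (split_ordP i) => i' ->; case: (split_ordP j) => j' ->.
- by rewrite block_mxEul !mxE eq_lshift.
- by rewrite block_mxEur !mxE eq_lrshift.
- by rewrite block_mxEdl !mxE eq_rlshift.
- by rewrite block_mxEdr !mxE eq_rshift /=; case: ifP => [|_]; [lia|case: ifP => [|_]; [lia|rewrite mul0rn]].
Qed.

Lemma det_N_inertia_mx p q : \det (- inertia_mx p q (p + q) : 'M[R]_(p + q)) = (-1) ^+ p.
Proof.
rewrite /inertia_mx -raddfN det_diag big_split_ord /= (eq_bigr (fun=> -1)); last first.
  by move=> i _; rewrite !mxE /= ltn_ord.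
rewrite [X in _ * X]big1 => [|i _].
  by rewrite mulr1 prodr_const card_ord.
by rewrite !mxE /= ltnNge leq_addr /= ltn_add2l ltn_ord opprK.
Qed.

(** Left multiplication by this matrix exchanges, up to sign, the parts in the image of
    [pi] of the upper and of the lower half. *)
Lemma det_swap N (pi : 'M[R]_N) : pi *m pi = pi ->
  \det (block_mx (1%:M - pi) pi (- pi) (1%:M - pi)) = 1.
Proof.
move=> pi2.
have -> : block_mx (1%:M - pi) pi (- pi) (1%:M - pi) =
    block_mx 1%:M pi 0 1%:M *m block_mx 1%:M 0 (- pi) 1%:M *m block_mx 1%:M pi 0 1%:M.
  rewrite !mulmx_block !(mul0mx, mulmx0, mul1mx, mulmx1, mulmxN, mulNmx, addr0, add0r).
  by rewrite mulmxDl mulNmx mul1mx !pi2 subrr add0r ?(addrC (- pi)).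
by rewrite !det_mulmx det_ublock det_lblock !det1 !mulr1.
Qed.

End InertiaMatrix.

Section RealDet.
Context {R : realType}.
Local Notation C := R[i].

Lemma block_conj_i (K : comNzRingType) n (c : K) (A B : 'M[K]_n) : c * c = -1 ->
  block_mx 1%:M (c%:M) 0 1%:M *m block_mx A B (- B) A *m
    block_mx 1%:M (- c%:M) 0 1%:M = block_mx (A - c *: B) 0 (- B) (A + c *: B).
Proof.
move=> c2; rewrite !mulmx_block.
rewrite !mul0mx !mul1mx !mulmx1 !mulmx0 !add0r !addr0 !mul_scalar_mx.
rewrite !mulmxN !mul_mx_scalar scalerN.
congr block_mx; last by rewrite opprK addrC.
by rewrite scalerBr scalerA c2 scaleN1r opprK (addrC B) addNr.
Qed.

(** Complex linear maps preserve orientation: for X = (A, B) and Z = A + iB the determinant is |det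
    Z|^2, by the triangular form in [block_conj_i]. *)
Lemma det_complex_ge0 n (X : 'M[R]_(n, n + n)) : 0 <= \det (col_mx X (X *m mul_i_mx n)).
Proof.
rewrite -[X]hsubmxK; move: (lsubmx X) (rsubmx X) => A B.
rewrite /mul_i_mx mul_row_block !mulmx0 !mulmx1 mulmxN mulmx1 add0r addr0 -/(block_mx _ _ _ _).
set Z := cmx A + 'i *: cmx B.
have H := block_conj_i (cmx A) (cmx B) i_squared.
have detE : (\det (block_mx A B (- B) A))%:C = conjc (\det Z) * \det Z.
  have := congr1 determinant H; rewrite -/Z.
  have -> : block_mx (cmx A) (cmx B) (- cmx B) (cmx A) = cmx (block_mx A B (- B) A).
    by rewrite /cmx map_block_mx -!/(cmx _) cmxN.
  rewrite !det_mulmx !det_ublock det_lblock !det1 !mul1r !mulr1 det_map_mx => ->.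
  congr (_ * _); rewrite -det_map_mx; congr (\det _).
  apply/matrixP => i j; rewrite !mxE; apply/eqP; rewrite eq_complex /=.
  by apply/andP; split; apply/eqP; ring.
rewrite -lecR detE; move: (\det Z) => -[x y].
by rewrite /= lecE /=; apply/andP; split; [apply/eqP; ring|nra].
Qed.

End RealDet.

Section DualType.
Context {R : realType} {r s k : nat}.
Local Notation C := R[i].
Local Notation m := (r + s)%N.
Local Notation n := (m + (k + k))%N.
Context (b : {symmetric 'rV[C]_n}) (hb : nondegenerate b).
Local Notation G := (im_form_mx b).
Local Notation eps := (inertia_mx r s m : 'M[R]_m).
Local Notation P A B := (A *m G *m B^T).
Local Notation Q A B := (A *m (mul_i_mx n *m G) *m B^T).

Lemma adapted_IGr E F : adapted b eps E F -> IGr b (odd r) (row_space E).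
Proof.
move=> [W EI FI]; have [EE FF EF] := W; split.
- by rewrite dim_row_space // (witt_free W).
- exact/isotropic_row_space.
apply/(dualP hb _ W).
set T := col_mx F E.
(* The Gram matrix of a Witt basis has determinant 1 or -1. So the volume is 1 or -1 and only its
   sign remains to be found. *)
have detT2 : `|\det G| * \det T ^+ 2 = 1.
  have := congr1 determinant (_ : im_gram b T T = block_mx 0 1%:M 1%:M 0).
  rewrite im_gramE !det_mulmx det_tr => H.
  have H1 : `|\det T * \det G * \det T| = 1.
    rewrite H; last by rewrite -im_gramE im_gram_row EE FF EF (wittC W).
    have := congr1 determinant (_ : block_mx 0 1%:M 1%:M 0 *m block_mx 0 1%:M 1%:M 0 = 1%:M :> 'M[R]_(n + n)).
    rewrite det_mulmx det1 -expr2 => H2.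
    apply/eqP; rewrite -sqr_norm_eq1 H2 ?eqxx //.
    by rewrite mulmx_block !(mul0mx, mulmx0, mul1mx, addr0, add0r) -scalar_mx_block.
  by rewrite -H1 !normrM mulrAC -expr2 real_normK ?num_real // mulrC.
have vol2 : volume b T ^+ 2 = 1.
  by rewrite /volume im_gramE mul1mx trmx1 mulmx1 exprMn sqr_sqrtr ?normr_ge0.
suff vol0 : 0 <= (-1) ^+ r * volume b T.
  rewrite signr_odd; have : ((-1) ^+ r * volume b T) ^+ 2 = 1.
    by rewrite exprMn vol2 mulr1 sqrr_sign.
  move=> /eqP; rewrite sqrp_eq1 // => /eqP /(congr1 (fun x => (-1) ^+ r * x)).
  by rewrite mulrA -expr2 sqrr_sign mul1r mulr1.
rewrite /volume mulrCA mulr_ge0 ?sqrtr_ge0 //.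
pose pi : 'M[R]_n := block_mx 1%:M 0 0 (block_mx 1%:M 0 0 0).
have pi2 : pi *m pi = pi.
  by rewrite /pi !mulmx_block !(mul0mx, mulmx0, mul1mx, addr0, add0r).
(* The rows of [X] are (e, f, g). *)
pose X := (1%:M - pi) *m F + pi *m E.
(* After the swap the upper half of [T] is [X] and the lower half is (- i eps e, - ig, if), that is
   [D'] applied to (ie, if, ig). The sign is thus that of det D' = det (- eps) = (-1)^r. *)
pose D' : 'M[R]_n := block_mx (- eps) 0 0 (block_mx 0 (- 1%:M) 1%:M 0).
have ST : block_mx (1%:M - pi) pi (- pi) (1%:M - pi) *m T =
    block_mx 1%:M 0 0 D' *m col_mx X (X *m mul_i_mx n).
  rewrite !mul_block_col mul1mx !mul0mx addr0 add0r; congr col_mx.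
  have cE : D' *m (- ((1%:M - pi) *m block_eps k eps) + pi *m block_J m k) = 1%:M - pi.
    rewrite /D' /block_eps /block_J /Jmx /pi (scalar_mx_block m (k + k)) !(scalar_mx_block k k).
    by do 4!rewrite ?(opp_block_mx, add_block_mx, mulmx_block, subrr, subr0,
      mul0mx, mulmx0, mul1mx, mulmx1, mulNmx, mulmxN, addr0, add0r, oppr0, opprK, block_mx0).
  have cF : D' *m (- ((1%:M - pi) *m block_J m k) + pi *m block_eps k eps) = - pi.
    rewrite /D' /block_eps /block_J /Jmx /pi (scalar_mx_block m (k + k)) !(scalar_mx_block k k).
    by do 4!rewrite ?(opp_block_mx, add_block_mx, mulmx_block, subrr, subr0,
      mul0mx, mulmx0, mul1mx, mulmx1, mulNmx, mulmxN, addr0, add0r, oppr0, opprK, block_mx0) ?inertia_mx_sq.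
  rewrite [LHS](_ : _ = (D' *m (- ((1%:M - pi) *m block_J m k) + pi *m block_eps k eps)) *m F +
    (D' *m (- ((1%:M - pi) *m block_eps k eps) + pi *m block_J m k)) *m E); last by rewrite cE cF.
  rewrite (_ : X *m mul_i_mx n = (1%:M - pi) *m (F *m mul_i_mx n) + pi *m (E *m mul_i_mx n));
    last by rewrite /X mulmxDl -!mulmxA.
  rewrite EI FI.
  move: (1%:M - pi) => pi'.
  rewrite -!(mulmxA D') -mulmxDr; congr (_ *m _).
  rewrite !mulmxDl !mulmxDr !mulmxN !mulNmx mulmxN !mulmxA.
  set x1 := pi' *m _ *m F; set x2 := pi *m _ *m F; set x3 := pi' *m _ *m E; set x4 := pi *m _ *m E.
  by rewrite addrACA (addrC (- x1)) (addrC x2).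
have := congr1 determinant ST; rewrite !det_mulmx det_swap // mul1r => ->.
rewrite det_ublock det1 mul1r det_ublock det_N_inertia_mx mulrA.
rewrite (_ : \det (block_mx 0 (- 1%:M) 1%:M 0) = 1); last first.
  have := @det_swap R k 1%:M (mulmx1 _); rewrite subrr => detJ.
  by rewrite -[RHS]detJ -det_tr tr_block_mx !trmx0 trmx1 raddfN /= trmx1.
by rewrite mulr1 -expr2 sqrr_sign mul1r; exact: det_complex_ge0.
Qed.

End DualType.

(** A dual [g0] of [f] orthogonal to [e] becomes isotropic after subtracting
    half of its Gram matrix times [f]. *)
Lemma hyperbolic_partner (K : fieldType) (m k n : nat) (B : 'M[K]_n) (eps : 'M[K]_m)
    (e : 'M[K]_(m, n)) (f : 'M[K]_(k, n)) : (2 : K) != 0 ->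
  B^T = B -> B \in unitmx -> eps \in unitmx -> row_free f ->
  e *m B *m e^T = eps -> e *m B *m f^T = 0 -> f *m B *m f^T = 0 ->
  exists g : 'M[K]_(k, n),
    [/\ g *m B *m e^T = 0, g *m B *m f^T = 1%:M & g *m B *m g^T = 0].
Proof.
move=> two0 Bs Bu eu ff ee ef fF.
have fe : f *m B *m e^T = 0.
  by apply: trmx_inj; rewrite !trmx_mul trmxK Bs mulmxA ef !trmx0.
have Mf : row_free (col_mx e f).
  apply: inj_row_free => v; rewrite -[v]hsubmxK mul_row_col => H.
  have := congr1 (fun M => M *m B *m e^T) H; rewrite /= !mulmxDl !mul0mx -!mulmxA.
  rewrite (mulmxA e) ee (mulmxA f) fe mulmx0 addr0 => /eqP.
  rewrite mulmx_free_eq0 ?row_free_unit // => /eqP v1.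
  move: H; rewrite v1 mul0mx add0r => /eqP; rewrite mulmx_free_eq0 // => /eqP ->.
  by rewrite row_mx0.
have [D MD] := row_freeP Mf.
pose g0 := row_mx 0 1%:M *m D^T *m invmx B : 'M[K]_(k, n).
have g0M : g0 *m B *m (col_mx e f)^T = row_mx 0 1%:M.
  by rewrite /g0 mulmxKV // -mulmxA -trmx_mul MD trmx1 mulmx1.
clearbody g0.
have [g0e g0f] : g0 *m B *m e^T = 0 /\ g0 *m B *m f^T = 1%:M.
  by move: g0M; rewrite tr_col_mx mul_mx_row => /eq_row_mx.
have fg0 : f *m B *m g0^T = 1%:M.
  by apply: trmx_inj; rewrite !trmx_mul trmxK Bs mulmxA g0f trmx1.
set H := g0 *m B *m g0^T.
have HT : H^T = H by rewrite /H !trmx_mul trmxK Bs mulmxA.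
have gY p (Y : 'M[K]_(n, p)) : (g0 - 2^-1 *: (H *m f)) *m B *m Y =
    g0 *m B *m Y - 2^-1 *: (H *m (f *m B *m Y)).
  by rewrite !mulmxDl !mulNmx -!scalemxAl !mulmxA.
exists (g0 - 2^-1 *: (H *m f)); rewrite ?gY ?fe ?fF ?g0e ?g0f ?mulmx0 ?scaler0 ?subr0; split=> //.
rewrite linearB /= linearZ /= trmx_mul HT !mulmxDr !mulmxN -!scalemxAr -/H.
rewrite !(mulmxA _ f^T H) g0f fg0 fF mul1mx mul0mx ?mulmx0 ?scaler0 ?subr0 ?mulmx1.
rewrite -addrA -opprD -scalerDl -mulr2n -(mulr_natr (2^-1)) mulVf //.
by rewrite scale1r subrr.
Qed.

(** * Existence of adapted bases *)

Section AdaptedExists.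
Context {R : realType} {r s k : nat}.
Local Notation C := R[i].
Local Notation m := (r + s)%N.
Local Notation n := (m + (k + k))%N.
Context (b : {symmetric 'rV[C]_n}) (hb : nondegenerate b).
Local Notation G := (im_form_mx b).
Local Notation eps := (inertia_mx r s m : 'M[R]_m).
Local Notation P A B := (A *m G *m B^T).
Local Notation Q A B := (A *m (mul_i_mx n *m G) *m B^T).

(** The orthogonal complement of the span of [A] contains that span and has dimension 2n - n = n, so
    the two agree. *)
Lemma isotropic_maximal (A : 'M[R]_(n, n + n)) p (w : 'M[R]_(p, n + n)) :
  row_free A -> P A A = 0 -> P w A = 0 -> (w <= A)%MS.
Proof.
move=> Af AA wA.
have Ak : (A <= kermx (G *m A^T))%MS by rewrite sub_kermx mulmxA AA.
have : (kermx (G *m A^T) <= A)%MS.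
  rewrite -(mxrank_leqif_sup Ak) mxrank_ker.
  rewrite (eqP Af) eqmxMfull ?row_full_unit ?im_form_mx_unit // mxrank_tr (eqP Af).
  by rewrite addnK.
by apply: submx_trans; rewrite sub_kermx mulmxA wA.
Qed.

Lemma adapted_exists V : orbit_rs b r s V ->
  exists E F, row_space E = V /\ adapted b eps E F.
Proof.
move=> [dV iV sV].
have [A0 A0f VA0] := basis_matrix dV.
have [_ [T Tu TE]] := (signatureP _ _ (re_formE b) VA0 A0f dV).1 sV.
set A := T *m A0.
have Af : row_free A by rewrite /row_free eqmxMfull ?row_full_unit //; exact: A0f.
have VA u : (u \in V) = (u <= A)%MS by rewrite VA0 eqmxMfull // row_full_unit.
have VE : V = row_space A by apply/vspaceP => u; rewrite mem_row_space VA.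
have AA : P A A = 0 by rewrite -im_gramE; apply/(isotropic_row_space b); rewrite -VE.
have QA : Q A A = inertia_mx r s n by rewrite -TE /A trmx_mul !mulmxA.
move: Af VA {VE} AA QA; rewrite -[A]vsubmxK; move: (usubmx A) (dsubmx A) => e0 v.
move=> Af VA; rewrite im_prod_block -[0]block_mx0 => /eq_block_mx[Pee Pev Pve Pvv].
rewrite inertia_mx_block.
have -> : Q (col_mx e0 v) (col_mx e0 v) = block_mx (Q e0 e0) (Q e0 v) (Q v e0) (Q v v).
  by rewrite tr_col_mx mul_col_mx mul_col_row.
move=> /eq_block_mx[Qee Qev Qve Qvv].
(* The rows of [v] span the radical of Re b on V. Hence iv is orthogonal to V for Im b and lies in V
   by maximality. Its [e0] component vanishes because Re b (iv, e0) = - Im b (v, e0) = 0 and [eps]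
   is invertible. *)
have vI : (v *m mul_i_mx n <= v)%MS.
  have /submxP[c cE] : (v *m mul_i_mx n <= col_mx e0 v)%MS.
    apply: isotropic_maximal => //; first by rewrite im_prod_block Pee Pev Pve Pvv block_mx0.
    by rewrite im_prod_row !im_prod_il Qve Qvv row_mx0.
  have c1 : lsubmx c *m eps = 0.
    have : Q (c *m col_mx e0 v) e0 = 0 by rewrite -cE -im_prod_ir im_prod_ii Pve oppr0.
    rewrite -{1}[c]hsubmxK mul_row_col !mulmxDl -!(mulmxA (lsubmx c)) -!(mulmxA (rsubmx c)).
    by rewrite !(mulmxA e0) !(mulmxA v) in Qee Qve *; rewrite Qee Qve mulmx0 addr0.
  have c0 : lsubmx c = 0 by rewrite -[LHS]mulmx1 -(inertia_mx_sq r s) mulmxA c1 mul0mx.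
  by rewrite cE -[c]hsubmxK mul_row_col c0 mul0mx add0r submxMl.
have vf : row_free v.
  apply: inj_row_free => x xv.
  have : row_mx 0 x *m col_mx e0 v = 0 by rewrite mul_row_col xv mul0mx addr0.
  by move=> /eqP; rewrite mulmx_free_eq0 // => /eqP /(congr1 rsubmx); rewrite row_mxKr linear0.
have [k' [f [ff kk' vF]]] := complex_basis vf vI.
have kk : k' = k by lia.
subst k'.
set f1 := ofC f in vF; pose e := toC e0.
have /submxP[c f1v] : (f1 <= v)%MS by rewrite vF -addsmxE addsmxSl.
have Pef : P e0 f1 = 0 by rewrite f1v trmx_mul mulmxA Pev mul0mx.
have Qef : Q e0 f1 = 0 by rewrite f1v trmx_mul mulmxA Qev mul0mx.
have Pff : P f1 f1 = 0 by rewrite f1v trmx_mul mulmxA -!(mulmxA c) Pvv mul0mx mulmx0.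
have Qff : Q f1 f1 = 0.
  have E : Q f1 f1 = c *m Q v v *m c^T by rewrite f1v trmx_mul !mulmxA.
  by rewrite E Qvv mulmx0 mul0mx.
have gramE p q (A' : 'M[R]_(p, n + n)) (B' : 'M[R]_(q, n + n)) :
  toC A' *m form_mx b *m (toC B')^T = cmx (Q A' B') + 'i *: cmx (P A' B').
  by rewrite [LHS]complex_mxE re_toC im_toC.
have ee : e *m form_mx b *m e^T = cmx eps by rewrite gramE Pee Qee cmx0 scaler0 addr0.
have ef : e *m form_mx b *m f^T = 0 by rewrite -[f]ofCK gramE Pef Qef cmx0 scaler0 addr0.
have fF : f *m form_mx b *m f^T = 0 by rewrite -[f]ofCK gramE Pff Qff cmx0 scaler0 addr0.
have eu : cmx eps \in unitmx.
  by apply: (mulmx1_unit (B := cmx eps) _).1; rewrite -cmxM inertia_mx_sq cmx1.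
have [|g [ge gf gg]] := hyperbolic_partner _ (form_mx_sym b) (form_mx_unit hb) eu ff ee ef fF.
  by rewrite pnatr_eq0.
set g1 := ofC g.
have split0 p q (A' : 'M[R]_(p, n + n)) (B' : 'M[R]_(q, n + n)) (Z W : 'M[R]_(p, q)) :
    toC A' *m form_mx b *m (toC B')^T = cmx Z + 'i *: cmx W -> Q A' B' = Z /\ P A' B' = W.
  rewrite gramE => H; have H1 := congr1 remx H; have H2 := congr1 immx H.
  by move: H1 H2; rewrite !remx_cmx !immx_cmx.
have [Qge Pge] : Q g1 e0 = 0 /\ P g1 e0 = 0.
  by apply: split0; rewrite ofCK ge cmx0 scaler0 addr0.
have [Qgf Pgf] : Q g1 f1 = 1%:M /\ P g1 f1 = 0.
  by apply: split0; rewrite !ofCK gf cmx0 scaler0 addr0 cmx1.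
have [Qgg Pgg] : Q g1 g1 = 0 /\ P g1 g1 = 0.
  by apply: split0; rewrite !ofCK gg cmx0 scaler0 addr0.
have ad : adapted b eps (col_mx e0 (col_mx f1 (f1 *m mul_i_mx n)))
    (col_mx (eps *m e0 *m mul_i_mx n) (col_mx (g1 *m mul_i_mx n) g1)).
  apply: adapted_of_complex.
  - exact: inertia_mx_sym.
  - exact: inertia_mx_sq.
  - by split=> //; rewrite -im_prodT Pge trmx0.
  - by split=> //; rewrite -re_prodT Qge trmx0.
  - by split=> //; [rewrite -im_prodT Pgf trmx0|rewrite -re_prodT Qgf trmx1].
exists (col_mx e0 (col_mx f1 (f1 *m mul_i_mx n))),
  (col_mx (eps *m e0 *m mul_i_mx n) (col_mx (g1 *m mul_i_mx n) g1)).
split=> //; apply/vspaceP => u; rewrite mem_row_space VA.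
by rewrite -!addsmxE (adds_eqmx (eqmx_refl e0) vF).
Qed.

End AdaptedExists.

(** * Straightening the Gram matrix *)

Section Straighten.
Context {R : realType} {m k : nat} (eps : 'M[R]_m).
Hypotheses (epsT : eps^T = eps) (eps2 : eps *m eps = 1%:M).
Local Notation n := (m + (k + k))%N.
Local Notation J := (Jmx k : 'M[R]_(k + k)).

Lemma Jmx_sq : J *m J = - 1%:M.
Proof.
rewrite /Jmx mulmx_block !mul0mx !mulmx0 !mul1mx !mulmx1 !addr0 !add0r.
by rewrite (scalar_mx_block k k) opp_block_mx oppr0.
Qed.

Lemma JmxT : J^T = - J.
Proof. by rewrite /Jmx tr_block_mx opp_block_mx !trmx0 linearN /= trmx1 opprK oppr0. Qed.

(** [bend] is the change of variables (A, B0, C') |-> (A, B, C), and [straighten] its inverse.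
    They solve B = B0 - T B0 with T B0 = A eps B0 J; since T^2 = - (A eps)^2, one has
    (1 - T) (1 + T) = [denom_mx A]. *)
Definition denom_mx (A : 'M[R]_m) : 'M[R]_m := 1%:M + A *m eps *m (A *m eps).
Definition eps_gram (B : 'M[R]_(m, k + k)) := B^T *m eps *m B.
Definition eps_gram3 (A : 'M[R]_m) (B : 'M[R]_(m, k + k)) := B^T *m eps *m A *m eps *m B.
(** With S = [eps_gram B] and Th = [eps_gram3 A B], the map K |-> J K + K J sends the first summand
    to J S J - S and the second to Th J + J Th, by J^2 = -1. These are the terms that the
    elimination leaves over. *)
Definition correction_mx (A : 'M[R]_m) (B : 'M[R]_(m, k + k)) : 'M[R]_(k + k) :=
  2^-1 *: (J *m eps_gram B + eps_gram B *m J) - J *m eps_gram3 A B *m J.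

Definition bend (X : 'M[R]_n) : 'M[R]_n :=
  let A := ulsubmx X in let B0 := ursubmx X in
  let B := B0 - A *m eps *m B0 *m J in
  block_mx A B (- B^T) (drsubmx X + correction_mx A B0).

Definition straighten (X : 'M[R]_n) : 'M[R]_n :=
  let A := ulsubmx X in let B := ursubmx X in
  let B0 := invmx (denom_mx A) *m (B + A *m eps *m B *m J) in
  block_mx A B0 (- B0^T) (drsubmx X - correction_mx A B0).

Lemma skew_blockP (X : 'M[R]_n) : skew_mx R n X ->
  [/\ (ulsubmx X)^T = - ulsubmx X, dlsubmx X = - (ursubmx X)^T &
      (drsubmx X)^T = - drsubmx X].
Proof.
rewrite /skew_mx /= -{1 2}[X]submxK tr_block_mx opp_block_mx => /eq_block_mx[-> _ H ->].
by split=> //; rewrite H opprK.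
Qed.

Lemma skew_block A B C : A^T = - A -> C^T = - C ->
  skew_mx R n (block_mx A B (- B^T) C).
Proof.
by move=> HA HC; rewrite /skew_mx /= tr_block_mx opp_block_mx HA HC linearN /= trmxK opprK.
Qed.

Lemma eps_gram_sym B : (eps_gram B)^T = eps_gram B.
Proof. by rewrite /eps_gram !trmx_mul trmxK epsT mulmxA. Qed.

Lemma correction_mx_skew A B : A^T = - A -> (correction_mx A B)^T = - correction_mx A B.
Proof.
move=> HA; have ThT : (eps_gram3 A B)^T = - eps_gram3 A B.
  by rewrite /eps_gram3 !trmx_mul trmxK epsT HA !mulNmx !mulmxN !mulmxA.
rewrite /correction_mx; move: (eps_gram_sym B) ThT; move: (eps_gram B) (eps_gram3 A B) => S Th ST ThT.
rewrite linearB /= linearZ /= linearD /= !trmx_mul ST ThT JmxT.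
rewrite !(mulNmx, mulmxN) !opprK -opprD scalerN [RHS]opprD opprK mulmxA.
by rewrite (addrC (S *m _)).
Qed.

Lemma bend_skew X : skew_mx R n X -> skew_mx R n (bend X).
Proof.
move=> /skew_blockP[HA HB HC]; apply: skew_block => //.
by rewrite linearD /= correction_mx_skew // HC [RHS]opprD.
Qed.

Lemma straighten_skew X : skew_mx R n X -> skew_mx R n (straighten X).
Proof.
move=> /skew_blockP[HA HB HC]; apply: skew_block => //.
by rewrite linearB /= correction_mx_skew // HC [RHS]opprB opprK addrC.
Qed.

Lemma straighten_ul X : ulsubmx (straighten X) = ulsubmx X. Proof. by rewrite block_mxKul. Qed.
Lemma bend_ul X : ulsubmx (bend X) = ulsubmx X. Proof. by rewrite block_mxKul. Qed.

(** This is T^2 = - (A eps)^2, which turns (1 - T) (1 + T) into [denom_mx A]. *)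
Lemma mul_eps_J_twice A (B : 'M[R]_(m, k + k)) : A *m eps *m (A *m eps *m B *m J) *m J =
  - (A *m eps *m (A *m eps) *m B).
Proof. by rewrite -!mulmxA Jmx_sq !mulmxN mulmx1 -!mulmxN !mulmxA. Qed.

Lemma bendK X : skew_mx R n X -> denom_mx (ulsubmx X) \in unitmx -> straighten (bend X) = X.
Proof.
move=> /skew_blockP[HA HB HC] Nu; rewrite /straighten bend_ul /bend block_mxKur block_mxKdr.
set A := ulsubmx X in HA Nu *; set B := ursubmx X in HB *.
have -> : invmx (denom_mx A) *m ((B - A *m eps *m B *m J) + A *m eps *m (B - A *m eps *m B *m J) *m J) = B.
  rewrite mulmxBr mulmxBl mul_eps_J_twice opprK addrA subrK.
  by rewrite (_ : B + _ = denom_mx A *m B) ?mulKmx // /denom_mx mulmxDl mul1mx.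
by rewrite addrK -HB submxK.
Qed.

Lemma straightenK X : skew_mx R n X -> denom_mx (ulsubmx X) \in unitmx -> bend (straighten X) = X.
Proof.
move=> /skew_blockP[HA HB HC] Nu; rewrite /bend straighten_ul /straighten block_mxKur block_mxKdr.
set A := ulsubmx X in HA Nu *; set B := ursubmx X in HB *.
set B0 := invmx (denom_mx A) *m _.
have cN : A *m eps *m invmx (denom_mx A) = invmx (denom_mx A) *m (A *m eps).
  have cN' : denom_mx A *m (A *m eps) = A *m eps *m denom_mx A.
    by rewrite /denom_mx mulmxDl mulmxDr mul1mx mulmx1 !mulmxA.
  by rewrite -[LHS](mulKmx Nu) (mulmxA (denom_mx A)) cN' mulmxK.
have -> : B0 - A *m eps *m B0 *m J = B.
  rewrite /B0; set Y := B + _; rewrite (mulmxA _ (invmx _) Y) cN -!mulmxA -mulmxBr !mulmxA.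
  have -> : Y - A *m eps *m Y *m J = denom_mx A *m B; last by rewrite mulKmx.
  rewrite /Y mulmxDr mulmxDl mul_eps_J_twice opprD opprK addrA addrK.
  by rewrite /denom_mx mulmxDl mul1mx.
by rewrite subrK -HB submxK.
Qed.

(** Block elimination with [u]; [correction_mx] is chosen to cancel all the terms of the
    Schur complement other than - (J C' + C' J). *)
Lemma gram_bend X : skew_mx R n X ->
  let Y := bend X in let u := J *m (ursubmx X)^T *m eps in
  block_mx 1%:M 0 (- u) 1%:M *m
  (block_eps k eps - (block_J m k *m Y + Y *m block_J m k) + Y *m block_eps k eps *m Y) *m
  (block_mx 1%:M 0 (- u) 1%:M)^T =
  block_mx (eps + ulsubmx X *m eps *m ulsubmx X) 0 0
    (- (J *m drsubmx X + drsubmx X *m J)).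
Proof.
move=> /skew_blockP[HA HB HC] Y u; rewrite /Y /bend {Y}.
move: (ulsubmx X) (ursubmx X) (drsubmx X) HA HB HC @u => A B0 C HA _ HC u.
set B := B0 - _; set C1 := C + _.
pose P := eps + A *m eps *m A.
have im_prodT : P^T = P by rewrite /P linearD /= !trmx_mul epsT HA !(mulNmx, mulmxN) opprK mulmxA.
have uT : u^T = - (eps *m B0 *m J) by rewrite /u !trmx_mul trmxK epsT JmxT !mulmxN mulmxA.
(* The upper right block of the Gram matrix is already [P] times a matrix read off from [B0], so the
   elimination does not involve the inverse of [P]. *)
have YE : A *m eps *m B - B *m J = P *m u^T.
  rewrite uT /B /P mulmxN [in RHS]mulmxDl mulmxBr mulmxBl !mulmxA eps2 mul1mx.
  rewrite -(mulmxA (A *m eps *m B0)) Jmx_sq mulmxN mulmx1 opprK opprD addrC.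
  by rewrite addrA addrNK opprD.
have -> : block_eps k eps - (block_J m k *m block_mx A B (- B^T) C1 + block_mx A B (- B^T) C1 *m block_J m k)
   + block_mx A B (- B^T) C1 *m block_eps k eps *m block_mx A B (- B^T) C1 =
   block_mx P (P *m u^T) (u *m P) (- (J *m C1 + C1 *m J) - B^T *m eps *m B).
  rewrite -YE (_ : u *m P = J *m B^T - B^T *m eps *m A); last first.
    rewrite -[LHS]trmxK trmx_mul im_prodT -YE linearB /= !trmx_mul HA epsT JmxT.
    by rewrite !(mulmxN, mulNmx) opprK mulmxA addrC.
  rewrite /block_J /block_eps !mulmx_block !(mul0mx, mulmx0, addr0, add0r) add_block_mx opp_block_mx add_block_mx.
  rewrite add_block_mx !(mulmxN, mulNmx, oppr0, addr0, add0r, opprK, subr0, opprD).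
  by congr block_mx; rewrite addrC.
rewrite tr_block_mx !trmx1 trmx0 linearN /= !mulmx_block !mul1mx !mul0mx !mulmx0 !mulmx1 !addr0.
rewrite mulNmx addNr mul0mx add0r mulmxN addNr.
congr block_mx.
pose S := eps_gram B0; pose Th := eps_gram3 A B0.
(* The terms quadratic in A, collected in [W], cancel between u P u^T and B^T eps B; those in S and
   Th are left to the correction. *)
pose W := B0^T *m eps *m A *m eps *m A *m eps *m B0.
have uE : u *m (P *m u^T) = - (J *m S *m J) - J *m W *m J.
  rewrite uT /P mulmxN mulmxDl mulmxN mulmxDr /u /S /eps_gram /W !mulmxA.
  by rewrite -(mulmxA (J *m B0^T) eps eps) eps2 mulmx1 opprD.
have BE : B^T *m eps *m B = S - Th *m J - J *m Th + J *m W *m J.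
  have -> : B^T = B0^T - J *m B0^T *m eps *m A.
    rewrite /B linearB /= !trmx_mul epsT HA JmxT.
    by rewrite !(mulNmx, mulmxN) opprK !mulmxA.
  rewrite /B !(mulmxBl, mulmxBr) /S /eps_gram /Th /eps_gram3 /W !mulmxA.
  by rewrite opprB addrA [LHS]addrAC; congr (_ + _); exact: addrAC.
have qE : J *m correction_mx A B0 + correction_mx A B0 *m J = Th *m J + J *m Th - S + J *m S *m J.
  rewrite /correction_mx -/S -/Th mulmxBr mulmxBl -scalemxAr -scalemxAl mulmxDr mulmxDl !mulmxA.
  rewrite Jmx_sq -!(mulmxA _ J J) Jmx_sq !(mulNmx, mulmxN) !mul1mx !mulmx1.
  by apply/matrixP => i j; rewrite !mxE; field.
rewrite mulNmx uE BE /C1 mulmxDr mulmxDl addrACA qE.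
by apply/matrixP => i j; rewrite !mxE; ring.
Qed.

End Straighten.

(** * Small perturbations of a nondegenerate form *)

Section SmallForms.
Context {R : rcfType}.

Lemma quad_formD N (S T : 'M[R]_N) x : quad_form (S + T) x = quad_form S x + quad_form T x.
Proof. by rewrite /quad_form mulmxDr mulmxDl mxE. Qed.

(** Each term is estimated by |x_i x_j| <= (x_i^2 + x_j^2) / 2. *)
Lemma quad_form_small N (M : 'M[R]_N) c (x : 'rV_N) : 0 <= c -> (forall i j, `|M i j| <= c) ->
  `|quad_form M x| <= c * N%:R * quad_form 1%:M x.
Proof.
move=> c0 HM; have q1 : quad_form 1%:M x = \sum_i x 0 i ^+ 2.
  by rewrite /quad_form mulmx1 mxE; apply: eq_bigr => i _; rewrite mxE expr2.
have -> : quad_form M x = \sum_j \sum_i x 0 i * M i j * x 0 j.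
  by rewrite /quad_form mxE; apply: eq_bigr => j _; rewrite !mxE mulr_suml.
have -> : c * N%:R * quad_form 1%:M x = \sum_j \sum_i (c / 2 * (x 0 i ^+ 2 + x 0 j ^+ 2)).
  under eq_bigr do rewrite -mulr_sumr big_split /= -q1 sumr_const card_ord.
  rewrite -mulr_sumr big_split /= sumr_const card_ord sumrMnl -q1 -mulrnDl -(mulr_natr (_ + _)).
  by field.
apply: le_trans (ler_norm_sum _ _ _) _; apply: ler_sum => j _.
apply: le_trans (ler_norm_sum _ _ _) _; apply: ler_sum => i _.
rewrite !normrM -(real_normK (num_real (x 0 i))) -(real_normK (num_real (x 0 j))).
have := HM i j; have := normr_ge0 (x 0 i); have := normr_ge0 (x 0 j).
move: `|x 0 i| `|x 0 j| `|M i j| => a d e d0 a0 ec.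
have H1 : a * e * d <= a * c * d by rewrite ler_wpM2r // ler_wpM2l.
apply: le_trans H1 _.
have : 0 <= c * (a - d) ^+ 2 by rewrite mulr_ge0 // sqr_ge0.
by rewrite sqrrB; nra.
Qed.

(** For an N x N block A with entries below 1 / (N + 1), the entries of A eps A are too
    small to change the signs of [eps]. *)
Definition small_radius N : R := N.+1%:R^-1.

(** The perturbation is smaller than the Euclidean form, so the coordinate subspaces of dimensions r
    and s on which [eps] is definite stay definite. As r + s is the full size, these lower bounds
    determine the inertia. *)
Lemma small_has_inertia r s (A : 'M[R]_(r + s)) : A^T = - A ->
  (forall i j, `|A i j| < small_radius (r + s)) ->
  has_inertia (inertia_mx r s (r + s) + A *m inertia_mx r s (r + s) *m A) r s.
Proof.
set N := (r + s)%N; set eps := inertia_mx r s N => AT HA.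
set M := A *m eps *m A.
have d0 : 0 < small_radius N by rewrite invr_gt0 ltr0n.
have HM i j : `|M i j| <= N%:R * small_radius N ^+ 2.
  rewrite /M mul_mx_diag mxE; apply: le_trans (ler_norm_sum _ _ _) _.
  have -> : N%:R * small_radius N ^+ 2 = \sum_(l < N) small_radius N ^+ 2.
    by rewrite sumr_const card_ord mulr_natl.
  apply: ler_sum => l _.
  rewrite !mxE !normrM.
  have e1 : `|(if (l < r)%N then 1 else if (l < r + s)%N then -1 else 0) : R| <= 1.
    by case: ifP => _; [|case: ifP => _]; rewrite ?normrN ?normr1 ?normr0 ?ler01 ?lexx.
  rewrite expr2; apply: ler_pM; [by rewrite mulr_ge0|by []| |exact/ltW/HA].
  by rewrite -[leRHS]mulr1; apply: ler_pM => //; exact/ltW/HA.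
(* The bound is (N / (N + 1))^2; N + 1 in place of N makes the inequality strict and covers N =
   0. *)
have c1 : N%:R * small_radius N ^+ 2 * N%:R < 1.
  have -> : N%:R * small_radius N ^+ 2 * N%:R = (N%:R * small_radius N) ^+ 2 by ring.
  rewrite expr_lt1 // ?mulr_ge0 ?ler0n ?(ltW d0) //.
  by rewrite ltr_pdivrMr ?ltr0n // mul1r ltr_nat.
have qM x : x != 0 -> `|quad_form M x| < quad_form 1%:M x.
  move=> x0; apply: le_lt_trans (quad_form_small x _ HM) _.
    by rewrite mulr_ge0 ?ler0n ?sqr_ge0.
  by rewrite gtr_pMl // quad_form1_gt0.
have Ms : (eps + M)^T = eps + M.
  rewrite linearD /= /M !trmx_mul /eps inertia_mx_sym AT.
  by rewrite mulNmx !mulmxN opprK mulmxA.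
have P1 : posdef_dim (eps + M) r.
  exists (row_mx 1%:M 0) => x x0; rewrite mul_mx_row mulmx1 mulmx0 quad_formD.
  have y0 : row_mx x 0 != 0 :> 'rV_(r + s).
    by apply: contraNneq x0 => /(congr1 lsubmx); rewrite row_mxKl linear0 => ->.
  have qe : quad_form eps (row_mx x 0) = quad_form 1%:M (row_mx x 0 : 'rV_(r + s)).
    rewrite -diag_const_mx !quad_form_diag !big_split_ord /=; congr (_ + _).
      by apply: eq_bigr => i _; rewrite !mxE /= ltn_ord.
    by apply: eq_bigr => i _; rewrite !row_mxEr !mxE expr2 !mulr0.
  have := qM _ y0; rewrite qe ltr_norml => /andP[+ _]; lra.
have P2 : posdef_dim (- (eps + M)) s.
  exists (row_mx 0 1%:M) => x x0; rewrite mul_mx_row mulmx1 mulmx0 quad_formN quad_formD.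
  have y0 : row_mx 0 x != 0 :> 'rV_(r + s).
    by apply: contraNneq x0 => /(congr1 rsubmx); rewrite row_mxKr linear0 => ->.
  have qe : quad_form eps (row_mx 0 x) = - quad_form 1%:M (row_mx 0 x : 'rV_(r + s)).
    rewrite -diag_const_mx !quad_form_diag !big_split_ord /= opprD; congr (_ + _).
      by rewrite !big1 ?oppr0 // => i _; rewrite !row_mxEl !mxE expr2 !mulr0.
    rewrite -sumrN; apply: eq_bigr => i _; rewrite !mxE /= ltnNge leq_addr /= ltn_add2l ltn_ord.
    by rewrite mulN1r mul1r.
  have := qM _ y0; rewrite qe ltr_norml => /andP[_]; lra.
have [p [q Hpq]] := has_inertia_exists Ms.
have [_ _ _ /(_ P1) rp _] := has_inertia_unique_aux r Hpq.
have [_ _ _ _ /(_ P2) sq] := has_inertia_unique_aux s Hpq.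
have pqN := Hpq.1.
have -> : r = p by lia.
by have -> : s = q by lia.
Qed.

End SmallForms.

(** * Orbits in graph coordinates *)

Section Orbits.
Context {R : realType} {r s k : nat}.
Local Notation C := R[i].
Local Notation m := (r + s)%N.
Local Notation n := (m + (k + k))%N.
Context (b : {symmetric 'rV[C]_n}).
Local Notation G := (im_form_mx b).
Local Notation eps := (inertia_mx r s m : 'M[R]_m).
Local Notation Q A B := (A *m (mul_i_mx n *m G) *m B^T).

Definition hermitian_part (C : 'M[R]_(k + k)) := - (Jmx k *m C + C *m Jmx k).

Lemma mx_signatureP N (S : 'M[R]_N) p q : mx_signature S p q <-> has_inertia S p q.
Proof.
rewrite /mx_signature (@signatureP R N N S 1%:M _ _ p q (fun _ _ => erefl)).
- by rewrite mul1mx trmx1 mulmx1.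
- by move=> u; rewrite memvf submx1.
- by rewrite row_free_unit unitmx1.
- by rewrite dimvf /dim /= mul1n.
Qed.

Lemma re_prod_graph E F X : adapted b eps E F -> skew_mx R n X ->
  Q (E + X *m F) (E + X *m F) =
  block_eps k eps - (block_J m k *m X + X *m block_J m k) + X *m block_eps k eps *m X.
Proof.
move=> [W EI FI] Xs; have [EE FF EF] := W.
rewrite -im_prod_il -im_gramE mulmxDl -(mulmxA X) EI FI.
rewrite mulmxBr mulNmx mulmxN !mulmxA.
have NN (A B : 'M[R]_(n, n + n)) : im_gram b (- A) B = - im_gram b A B.
  by rewrite !im_gramE !mulNmx.
rewrite !im_gramDl !NN !im_gram_mull !im_gramDr !im_gram_mulr EE FF EF (wittC W).
rewrite !mul0mx !addr0 !add0r !mul1mx Xs !mulmx1 !mulmxN opprK opprD.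
by rewrite (addrC (- (block_J m k *m X))) -!addrA; congr (_ + (_ + _)); exact: addrC.
Qed.

Lemma orbit_graphP E F X p q : adapted b eps E F -> skew_mx R n X ->
  orbit_rs b p q (row_space (E + X *m F)) <->
  has_inertia (block_eps k eps - (block_J m k *m X + X *m block_J m k) + X *m block_eps k eps *m X) p q.
Proof.
move=> ad Xs; have [W _ _] := ad; have WX := witt_graph W Xs.
have f := witt_free WX; have [EE _ _] := WX.
rewrite -(re_prod_graph ad Xs).
have := signatureP p q (re_formE b) (mem_row_space (E + X *m F)) f (dim_row_space f).
move=> sP; split=> [[_ _ /sP //]|/sP H]; split=> //; first exact: dim_row_space.
exact/isotropic_row_space.
Qed.

Definition small_block (X : 'M[R]_n) := forall i j, `|ulsubmx X i j| < small_radius m.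

Lemma hermitian_part_sym (C : 'M[R]_(k + k)) : C^T = - C -> (hermitian_part C)^T = hermitian_part C.
Proof.
move=> HC; rewrite /hermitian_part linearN /= linearD /= !trmx_mul HC JmxT.
by rewrite !(mulmxN, mulNmx) !opprK addrC.
Qed.

Lemma orbit_bend E F X p q : adapted b eps E F -> skew_mx R n X ->
  orbit_rs b p q (row_space (E + bend eps X *m F)) <->
  has_inertia (block_mx (eps + ulsubmx X *m eps *m ulsubmx X) 0 0 (hermitian_part (drsubmx X))) p q.
Proof.
move=> ad Xs.
have := gram_bend (inertia_mx_sym r s m) (inertia_mx_sq r s) Xs.
rewrite -/(hermitian_part _) => <-; set T := block_mx 1%:M 0 _ 1%:M.
have Tu : T \in unitmx by rewrite unitmxE det_lblock !det1 mulr1 unitr1.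
rewrite has_inertia_congr //; apply: orbit_graphP => //.
by apply: bend_skew; rewrite ?inertia_mx_sym.
Qed.

Lemma small_sym (A : 'M[R]_m) : A^T = - A -> (eps + A *m eps *m A)^T = eps + A *m eps *m A.
Proof.
move=> AT; rewrite linearD /= !trmx_mul inertia_mx_sym AT.
by rewrite mulNmx !mulmxN opprK mulmxA.
Qed.

Lemma orbit_bend_signature E F X p q : adapted b eps E F -> skew_mx R n X -> small_block X ->
  has_inertia (hermitian_part (drsubmx X)) p q ->
  orbit_rs b (r + p) (s + q) (row_space (E + bend eps X *m F)).
Proof.
move=> ad Xs Xd H; apply/(orbit_bend _ _ ad Xs).
have [HA _ HC] := skew_blockP Xs.
apply: has_inertia_block => //; [exact: small_sym|exact: hermitian_part_sym|exact: small_has_inertia].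
Qed.

(** By the law of inertia the total signature determines that of the Hermitian block. The hypotheses
    r <= p and s <= q keep the natural subtractions exact. *)
Lemma signature_orbit_bend E F X p q : adapted b eps E F -> skew_mx R n X -> small_block X ->
  (r <= p)%N -> (s <= q)%N ->
  orbit_rs b p q (row_space (E + bend eps X *m F)) ->
  has_inertia (hermitian_part (drsubmx X)) (p - r) (q - s).
Proof.
move=> ad Xs Xd rp sq /(orbit_bend _ _ ad Xs) H.
have [HA _ HC] := skew_blockP Xs.
have [p' [q' H']] := has_inertia_exists (hermitian_part_sym HC).
have H2 := has_inertia_block (small_sym HA) (hermitian_part_sym HC) (small_has_inertia HA Xd) H'.
have [pE qE] := has_inertia_unique H H2.
have -> : (p - r)%N = p' by lia.
by have -> : (q - s)%N = q' by lia.
Qed.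

(** [denom_mx] is (eps + A eps A) eps, and the first factor has full rank by its inertia. *)
Lemma denom_mx_unit (A : 'M[R]_m) : A^T = - A -> (forall i j, `|A i j| < small_radius m) ->
  denom_mx eps A \in unitmx.
Proof.
move=> AT Ad; have H := small_has_inertia AT Ad.
have [_ _ rk _ _] := has_inertia_unique_aux 0 H.
have Pu : eps + A *m eps *m A \in unitmx by rewrite -row_free_unit /row_free rk.
have -> : denom_mx eps A = (eps + A *m eps *m A) *m eps.
  by rewrite /denom_mx mulmxDl inertia_mx_sq !mulmxA.
rewrite unitmx_mul Pu /=; exact: (mulmx1_unit (inertia_mx_sq r s)).1.
Qed.

End Orbits.

(** * Charts by graphs *)

Section GraphCharts.
Context {R : realType} {n N : nat}.
Local Notation C := R[i].
Context (b : {symmetric 'rV[C]_n}) (hb : nondegenerate b).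
Local Notation T := {vspace 'rV[R]_(n + n)}.

(** Smoothness and openness are tested on smooth families of matrices, so that
    compositions of transition maps need no chain rule. *)
Definition smooth_plots (D : set 'M[R]_n) a c (la : 'M[R]_n -> 'M[R]_(a, c)) :=
  forall q (O : set 'rV[R]_q) (X : 'rV[R]_q -> 'M[R]_n), open O -> smooth_mx O X ->
    (forall v, O v -> D (X v)) -> smooth_mx O (fun v => la (X v)).

Definition plot_open (D : set 'M[R]_n) :=
  forall q (O : set 'rV[R]_q) (X : 'rV[R]_q -> 'M[R]_n), open O -> smooth_mx O X ->
    (forall v, O v -> skew_mx R n (X v)) -> open [set v | O v /\ D (X v)].

(** Covers the charts of the atlas (all skew matrices, linear coordinates) and the slice charts
    (small A, straightened coordinates), so that one argument proves all transitions smooth. *)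
Definition graph_chart (c : chart T N) (E F : 'M[R]_(n, n + n)) (D : set 'M[R]_n)
    (la : 'M[R]_n -> 'rV[R]_N) (mu : 'rV[R]_N -> 'M[R]_n) :=
  [/\ [/\ witt b E F, D `<=` skew_mx R n & c.1 = [set row_space (E + X *m F) | X in D]],
      [/\ forall X, D X -> c.2 (row_space (E + X *m F)) = la X & forall X, D X -> mu (la X) = X],
      [/\ open (la @` D) & smooth_mx (la @` D) mu] &
      [/\ smooth_plots D la & plot_open D]].

Lemma graph_chart_is_chart c E F D la mu : graph_chart c E F D la mu ->
  is_chart c /\ c.2 @` c.1 = la @` D.
Proof.
move=> [[W Dskew c1] [c2 muK] [oD smu] _].
have E1 : c.2 @` c.1 = la @` D.
  rewrite c1; apply/seteqP; split=> [_ [_ [X DX <-] <-]|_ [X DX <-]].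
    by exists X => //; rewrite c2.
  by exists (row_space (E + X *m F)); [exists X|exact: c2].
split=> //; split; last by rewrite E1.
move=> y y'; rewrite !inE c1 => -[X DX <-] [X' DX' <-].
by rewrite !c2 // => /(congr1 mu); rewrite !muK // => ->.
Qed.

Lemma graph_chart_transition c c' E F D la mu E' F' D' la' mu' :
  graph_chart c E F D la mu -> graph_chart c' E' F' D' la' mu' ->
  smooth_transition c c'.
Proof.
move=> [[W Dskew c1] [c2 muK] [oD smu] _] [[W' D'skew c1'] [c2' _] _ [sla' oD']].
pose a v := transition_denom b E F E' F' (mu v).
pose x' v := transition_graph b E F E' F' (mu v).
pose O2 := [set v | (la @` D) v /\ \det (a v) != 0].
have muD v : (la @` D) v -> skew_mx R n (mu v).
  by move=> [X DX <-]; rewrite muK //; exact: Dskew.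
have sE : smooth_mx (la @` D) (fun v => E + mu v *m F).
  apply: smooth_mxD => //; first exact: smooth_mx_cst.
  by apply: smooth_mxM => //; exact: smooth_mx_cst.
have sG (B : 'M[R]_(n, n + n)) : smooth_mx (la @` D) (fun v => im_gram b (E + mu v *m F) B).
  apply: (@smooth_mx_ext _ _ _ _ _ (fun v => (E + mu v *m F) *m im_form_mx b *m B^T)) => //.
    by move=> v _; rewrite im_gramE.
  by apply: smooth_mxM; [|apply: smooth_mxM => //; exact: smooth_mx_cst|exact: smooth_mx_cst].
have oO2 : open O2.
  apply: (open_smooth_preimage oD (A := [set x : R | x != 0])).
    by apply: smooth_fun_det => //; exact: sG.
  exact: open_neq.
have O2D : O2 `<=` la @` D by move=> v [].
have au v : O2 v -> a v \in unitmx by move=> [_ h]; rewrite unitmxE unitfE.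
have sx' : smooth_mx O2 x'.
  apply: smooth_mxM => //; last exact: smooth_mx_subset O2D (sG _).
  by apply: smooth_mx_inv => //; exact: smooth_mx_subset O2D (sG _).
have x's v : O2 v -> skew_mx R n (x' v).
  by move=> Ov; have [] := transition1 hb W W' (muD v (O2D v Ov)) (au v Ov).
have imE : c.2 @` (c.1 `&` c'.1) = [set v | O2 v /\ D' (x' v)].
  apply/seteqP; split=> [v [y [+ +] <-]|v [Ov D'v]].
    rewrite c1 c1' => -[X DX <-] [X' DX' XE].
    have [tu X'E] := transition2 W W' (Dskew X DX) (D'skew X' DX') (esym XE).
    rewrite c2 //; split; last by rewrite /x' muK // -X'E.
    split; first by exists X.
    by rewrite /a muK // -unitfE -unitmxE.
  have [X DX XE] := O2D v Ov.
  have [r _] := transition1 hb W W' (muD v (O2D v Ov)) (au v Ov).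
  exists (row_space (E + X *m F)); last by rewrite c2.
  split; first by rewrite c1; exists X.
  by rewrite c1'; exists (x' v) => //; rewrite -r -XE muK.
have oI : open [set v | O2 v /\ D' (x' v)] by exact: oD'.
split; first by rewrite imE.
exists (fun v => la' (x' v)); split.
  rewrite imE; apply: smooth_onP => //; apply: sla' => //.
    by apply: smooth_mx_subset sx' => v [].
  by move=> v [].
move=> y []; rewrite c1 c1' => -[X DX <-] [X' DX' XE].
have [_ X'E] := transition2 W W' (Dskew X DX) (D'skew X' DX') (esym XE).
by rewrite -XE c2' // XE c2 // /x' muK // -X'E.
Qed.

End GraphCharts.

(** * Linear coordinates *)

Section LinearCoordinates.
Context {R : realType}.

Lemma linear_section (vT : lmodType R) N (E : set vT) (L : {linear vT -> 'rV[R]_N}) :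
  (forall a u v, E u -> E v -> E (a *: u + v)) -> set_bij E setT L ->
  exists mu : {linear 'rV[R]_N -> vT},
    [/\ forall v, E (mu v), forall v, L (mu v) = v & forall x, E x -> mu (L x) = x].
Proof.
move=> Elin [_ injL surL].
have [mu muP] : {mu : 'rV[R]_N -> vT & forall v, E (mu v) /\ L (mu v) = v}.
  by apply: (@choice _ _ (fun v x => E x /\ L x = v)) => v; have [x Ex <-] := surL v I; exists x.
have muK x : E x -> mu (L x) = x.
  by move=> Ex; apply: injL; rewrite ?inE //; [exact: (muP _).1|exact: (muP _).2].
have mu_lin : linear mu.
  move=> a u v; apply: injL; rewrite ?inE; first exact: (muP _).1.
    by apply: Elin; exact: (muP _).1.
  by rewrite linearP !(muP _).2.
pose muL := HB.pack mu (GRing.isLinear.Build R 'rV[R]_N vT *:%R mu mu_lin) : {linear 'rV[R]_N -> vT}.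
exists muL; split => [v|v|x /muK //]; [exact: (muP v).1|exact: (muP v).2].
Qed.

Lemma linear_build (U V : lmodType R) (f : U -> V) : linear f ->
  exists g : {linear U -> V}, g =1 f.
Proof.
by move=> lin; exists (HB.pack f (GRing.isLinear.Build R U V *:%R f lin) : {linear U -> V}).
Qed.

Lemma pairs_index n : exists f : 'I_'C(n, 2) -> 'I_n * 'I_n,
  [/\ injective f, forall t, ((f t).1 < (f t).2)%N &
      forall i j : 'I_n, (i < j)%N -> exists t, f t = (i, j)].
Proof.
pose A := [set p : 'I_n * 'I_n | (p.1 < p.2)%N]%SET.
have cA : #|A| = 'C(n, 2).
  rewrite -sum1_card (eq_bigl (fun p : 'I_n * 'I_n => (p.1 < p.2)%N)); last first.
    by move=> p; rewrite inE.
  rewrite -(pair_big_dep xpredT (fun i j : 'I_n => (i < j)%N) (fun _ _ => 1%N)) /=.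
  rewrite (exchange_big_dep xpredT) //= -bin2_sum big_mkord.
  apply: eq_bigr => j _; rewrite sum1_card.
  have wI : injective (widen_ord (ltnW (ltn_ord j))).
    by move=> x y /(congr1 val) /= /val_inj.
  rewrite -[RHS]card_ord -(card_imset _ wI).
  apply: eq_card => i; rewrite unfold_in /=; apply/idP/imsetP => [ij|[i' _ ->]] /=.
    by exists (Ordinal ij) => //; apply/val_inj.
  exact: ltn_ord.
rewrite -cA; exists enum_val; split.
- exact: enum_val_inj.
- by move=> t; have := enum_valP t; rewrite inE.
- move=> i j ij; have pA : (i, j) \in A by rewrite inE.
  by exists (enum_rank_in pA (i, j)); rewrite enum_rankK_in.
Qed.

Lemma skew_lin n a (u v : 'M[R]_n) : skew_mx R n u -> skew_mx R n v ->
  skew_mx R n (a *: u + v).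
Proof. by rewrite /skew_mx /= => Hu Hv; rewrite linearP /= Hu Hv scalerN opprD. Qed.

Lemma skew_coords n : exists L : {linear 'M[R]_n -> 'rV[R]_'C(n, 2)},
  set_bij (skew_mx R n) setT L.
Proof.
have [f [fI fl fS]] := pairs_index n.
have [L LE] : exists L : {linear 'M[R]_n -> 'rV[R]_'C(n, 2)},
    L =1 (fun X => \row_t X (f t).1 (f t).2).
  by apply: linear_build => a u v; apply/rowP => t; rewrite !mxE.
exists L; split=> //.
- move=> X Y; rewrite !inE !LE => Xs Ys /rowP E.
  have lt (i j : 'I_n) : (i < j)%N -> X i j = Y i j.
    by move=> ij; have [t ft] := fS i j ij; have := E t; rewrite !mxE ft.
  have sw (Z : 'M[R]_n) i j : skew_mx R n Z -> Z j i = - Z i j.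
    by move=> Zs; have := congr1 (fun M : 'M[R]_n => M i j) Zs; rewrite !mxE.
  apply/matrixP => i j; have [/lt//|/lt ji|/val_inj ->] := ltngtP i j.
    by rewrite (sw X j i) // (sw Y j i) // ji.
  have H (Z : 'M[R]_n) : skew_mx R n Z -> Z j j = 0.
    by move=> /(sw Z j j) H; lra.
  by rewrite !H.
move=> v _; pose F i j := \sum_t v 0 t * (f t == (i, j))%:R.
exists (\matrix_(i, j) (F i j - F j i)).
  by apply/matrixP => i j; rewrite !mxE opprB.
rewrite LE; apply/rowP => t; rewrite !mxE /F [X in _ - X]big1 => [|t' _].
  rewrite subr0 (bigD1 t) //= -surjective_pairing eqxx mulr1 big1 ?addr0 // => t' tt'.
  by rewrite (inj_eq fI) (negPf tt') mulr0.
case: eqP => [E|]; last by rewrite mulr0.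
by have := fl t'; rewrite E /= ltnNge ltnW // fl.
Qed.

(** The real part of a Hermitian matrix is symmetric and its imaginary part skew, so their sum is an
    arbitrary real k x k matrix from which both can be recovered. *)
Definition herm_coord k (H : 'M[R]_(k + k)) : 'rV[R]_(k * k) :=
  mxvec (ulsubmx H + dlsubmx H).

(** Commuting with J means being complex linear, and for such matrices transposition is the
    conjugate transpose. *)
Lemma hermitianP k (H : 'M[R]_(k + k)) :
  Hermitian_mx R k H <-> H^T = H /\ Jmx k *m H = H *m Jmx k.
Proof.
split=> [[Z ZH <-]|[HT HJ]].
  have ZE i j : Z i j = conjc (Z j i) by rewrite {1}ZH !mxE.
  have re : (map_mx (@complex.Re R) Z)^T = map_mx (@complex.Re R) Z.
    by apply/matrixP => i j; rewrite !mxE (ZE j i); case: (Z i j).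
  have im : (map_mx (@complex.Im R) Z)^T = - map_mx (@complex.Im R) Z.
    by apply/matrixP => i j; rewrite !mxE (ZE j i); case: (Z i j).
  rewrite /real_mx; split; first by rewrite tr_block_mx re linearN /= im opprK.
  rewrite /Jmx !mulmx_block !mul0mx !mulmx0 !mul1mx !mulmx1 !mulNmx !mulmxN.
  by rewrite !mul1mx !mulmx1 !addr0 !add0r opprK.
move: HJ HT; rewrite -[H]submxK.
move: (ulsubmx H) (ursubmx H) (dlsubmx H) (drsubmx H) => P Q Q' S.
rewrite /Jmx !mulmx_block !mul0mx !mulmx0 !mul1mx !mulmx1 !mulNmx !mulmxN.
rewrite !mul1mx !mulmx1 !addr0 !add0r => /eq_block_mx[QE SE _ _].
rewrite tr_block_mx => /eq_block_mx[im_prodT Q'T _ _].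
exists (\matrix_(i, j) (P i j +i* Q' i j)).
  have PTE i j : P i j = P j i by rewrite -{1}im_prodT mxE.
  have Q'TE i j : Q' i j = - Q' j i.
    have := congr1 (fun M : 'M[R]_k => M j i) Q'T; rewrite mxE => ->.
    by rewrite QE mxE opprK.
  by apply/matrixP => i j; rewrite !mxE PTE Q'TE.
rewrite /real_mx; congr block_mx; apply/matrixP => i j; rewrite ?mxE //.
- by rewrite QE mxE opprK.
- by rewrite -SE.
Qed.

Lemma herm_lin k a (u v : 'M[R]_(k + k)) : Hermitian_mx R k u -> Hermitian_mx R k v ->
  Hermitian_mx R k (a *: u + v).
Proof.
rewrite !hermitianP => -[uT uJ] [vT vJ]; split; first by rewrite linearP /= uT vT.
by rewrite mulmxDr mulmxDl -scalemxAr -scalemxAl uJ vJ.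
Qed.

Lemma herm_coords k : exists L : {linear 'M[R]_(k + k) -> 'rV[R]_(k * k)},
  set_bij (Hermitian_mx R k) setT L.
Proof.
have [L LE] : exists L : {linear 'M[R]_(k + k) -> 'rV[R]_(k * k)}, L =1 @herm_coord k.
  apply: linear_build => a u v.
  by rewrite /herm_coord -linearP; congr mxvec; apply/matrixP => i j; rewrite !mxE; ring.
have HE H : Hermitian_mx R k H ->
    let M := vec_mx (herm_coord H) in
    H = block_mx (2^-1 *: (M + M^T)) (- (2^-1 *: (M - M^T))) (2^-1 *: (M - M^T)) (2^-1 *: (M + M^T)).
  move=> [Z ZH <-] M; rewrite /M /herm_coord mxvecK block_mxKul block_mxKdl.
  have ZE i j : Z i j = conjc (Z j i) by rewrite {1}ZH !mxE.
  rewrite /real_mx; congr block_mx; apply/matrixP => i j; rewrite !mxE (ZE i j);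
    by case: (Z j i) => x y /=; field.
exists L; split=> //.
  by move=> X Y; rewrite !inE !LE => Xs Ys E; rewrite (HE X Xs) (HE Y Ys) E.
move=> v _; pose M := vec_mx v.
exists (block_mx (2^-1 *: (M + M^T)) (- (2^-1 *: (M - M^T))) (2^-1 *: (M - M^T)) (2^-1 *: (M + M^T))).
  apply/hermitianP; split.
    have t1 : (M + M^T)^T = M + M^T by rewrite linearD /= trmxK addrC.
    have t2 : (M - M^T)^T = - (M - M^T) by rewrite linearB /= trmxK opprB.
    have t3 : (- (2^-1 *: (M - M^T)))^T = 2^-1 *: (M - M^T).
      by rewrite linearN /= linearZ /= t2 scalerN opprK.
    by rewrite tr_block_mx t3 !linearZ /= t1 t2 scalerN.
  rewrite /Jmx !mulmx_block !mul0mx !mulmx0 !mul1mx !mulmx1 !mulNmx !mulmxN.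
  by rewrite !mul1mx !mulmx1 !addr0 !add0r opprK.
rewrite LE /herm_coord block_mxKul block_mxKdl -[RHS]vec_mxK -/M; congr mxvec.
by apply/matrixP => i j; rewrite !mxE; field.
Qed.

(** [1 - Ph s] is the projection onto the kernel of [Ph] along the image of [s]; its rank
    factorization provides the complementary coordinates. *)
Lemma split_section N p (Ph : 'M[R]_(N, p)) (s : 'M[R]_(p, N)) : s *m Ph = 1%:M ->
  exists d, N = (d + p)%N /\ exists (Kc : 'M[R]_(N, d)) (Rm : 'M[R]_(d, N)),
    [/\ Kc *m Rm + Ph *m s = 1%:M, Rm *m Kc = 1%:M, Rm *m Ph = 0 & s *m Kc = 0].
Proof.
move=> sP; pose Pi := 1%:M - Ph *m s.
have sPi : s *m Pi = 0 by rewrite /Pi mulmxBr mulmx1 mulmxA sP mul1mx subrr.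
have PiP : Pi *m Ph = 0 by rewrite /Pi mulmxBl mul1mx -mulmxA sP mulmx1 subrr.
have PiPi : Pi *m Pi = Pi by rewrite {1}/Pi mulmxBl mul1mx -mulmxA sPi mulmx0 subr0.
have rs : \rank s = p.
  by apply/eqP; rewrite eqn_leq rank_leq_row -{1}(mxrank1 R p) -sP mxrankM_maxl.
have rPs : (\rank (Ph *m s) <= p)%N by rewrite -{2}rs mxrankM_maxr.
have NE : N = (\rank Pi + p)%N.
  apply/eqP; rewrite eqn_leq; apply/andP; split.
    rewrite -{1}(mxrank1 R N) -(subrK (Ph *m s) 1%:M) -/Pi.
    by apply: leq_trans (mxrank_add _ _) _; rewrite leq_add2l.
  by have := mulmx0_rank_max sPi; rewrite rs addnC.
exists (\rank Pi); split=> //; exists (col_base Pi), (row_base Pi).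
have cb : col_base Pi *m row_base Pi = Pi by exact: mulmx_base.
have rf : row_free (row_base Pi) by exact: row_base_free.
have cf : row_full (col_base Pi) by exact: col_base_full.
have lc p' (A B : 'M[R]_(_, p')) : col_base Pi *m A = col_base Pi *m B -> A = B.
  exact: row_full_inj.
have rc p' (A B : 'M[R]_(p', _)) : A *m row_base Pi = B *m row_base Pi -> A = B.
  exact: row_free_inj.
split.
- by rewrite cb subrK.
- apply: lc; apply: rc; rewrite mulmx1 cb.
  by rewrite (mulmxA (col_base Pi)) cb -mulmxA cb.
- by apply: lc; rewrite mulmxA cb PiP mulmx0.
- by apply: rc; rewrite -mulmxA cb sPi mul0mx.
Qed.

End LinearCoordinates.

(** * Splitting off the normal coordinates of a slice chart *)

Section Assembly.
Context {R : realType} {T : Type}.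

(** The cast is there because the binomial coefficient ['C(n, 2)] equals d + k * k only
    propositionally. *)
Definition left_part {N d p} (hN : N = (d + p)%N) (v : 'rV[R]_N) : 'rV[R]_d :=
  lsubmx (castmx (erefl 1%N, hN) v).
Definition right_part {N d p} (hN : N = (d + p)%N) (v : 'rV[R]_N) : 'rV[R]_p :=
  rsubmx (castmx (erefl 1%N, hN) v).

Lemma open_row_mx0 d p (A : set 'rV[R]_(d + p)) : open A ->
  open [set v : 'rV[R]_(d + p) | A (row_mx (lsubmx v) 0)].
Proof.
move=> oA; apply: (@open_comp _ _ (fun v : 'rV[R]_(d + p) => row_mx (lsubmx v) 0)) => // v _.
apply: continuous_mx => i j.
have S : smooth_mx setT (fun v : 'rV[R]_(d + p) => row_mx (lsubmx v) 0 : 'rV_(d + p)).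
  apply: smooth_mx_row; [exact: openT| |exact: smooth_mx_cst].
  move=> i' j'; apply: (@smooth_fun_ext _ _ _ (fun v => v 0 (lshift _ j'))); [exact: openT| |].
    by move=> x _; rewrite mxE ord1.
  exact: smooth_fun_coord.
exact: (smooth_fun_continuous (S i j) I).
Qed.

Lemma slice_chart_part N d p (hN : N = (d + p)%N) (hd : (d <= N)%N) (M : manifold (R := R) T N)
  (S : set T) c : maximal_atlas M c ->
  (forall y, c.1 y -> S y <-> right_part hN (c.2 y) = 0) -> slice_chart M hd S c.
Proof.
move=> Mc H; split=> // y cy; rewrite H //; subst N; rewrite /right_part castmx_id; split=> [r0 i di|r0].
  have ip : (i - d < p)%N by have := ltn_ord i; lia.
  have -> : i = rshift d (Ordinal ip) by apply/val_inj; rewrite /= subnKC.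
  by have := congr1 (fun v : 'rV_p => v 0 (Ordinal ip)) r0; rewrite !mxE.
by apply/rowP => j; rewrite !mxE r0 //= leq_addr.
Qed.

(** The fibres of the slice chart being complete, W is all of (U /\ O) x H. *)
Lemma slice_chart_splitting (N d p : nat) (hN : N = (d + p)%N) (hd : (d <= N)%N)
    (M : manifold (R := R) T N) (O : set T) (vT : vectType R) (H : set vT)
    (LH : {linear vT -> 'rV[R]_p}) (c0 c1 : chart T N) :
  set_bij H setT LH -> H 0 -> maximal_atlas M c0 -> atlas M c1 -> set_inj c1.1 c1.2 ->
  c0.1 `<=` c1.1 ->
  (forall y, c0.1 y -> O y <-> right_part hN (c0.2 y) = 0) ->
  (forall y w, c0.1 y -> exists2 y', c0.1 y' &
     left_part hN (c0.2 y') = left_part hN (c0.2 y) /\ right_part hN (c0.2 y') = w) ->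
  let U := c0.1 in
  let UO := product_manifold (submanifold M hd (U `&` O)) (linear_manifold p H) in
  exists phi W, [/\ mopen M U, mopen UO W /\ (U `&` O) `*` [set 0] `<=` W,
    diffeomorphism M UO U W phi &
    forall y, U y -> H (phi y).2 /\ LH (phi y).2 = right_part hN (c0.2 y)].
Proof.
subst N; rewrite /left_part /right_part.
move=> bLH H0 Mc0 Mc1 inj1 c01 sl fib.
set U := c0.1; set UO := product_manifold _ _.
have [_ injL surL] := bLH.
have {}sl y : c0.1 y -> O y <-> rsubmx (c0.2 y) = 0 by move/sl; rewrite castmx_id.
have {}fib y w : c0.1 y -> exists2 y', c0.1 y' & c0.2 y' = row_mx (lsubmx (c0.2 y)) w.
  move=> /(fib y w) [y' y'0]; rewrite !castmx_id => -[l r]; exists y' => //.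
  by rewrite -[LHS]hsubmxK l r.
have [c0M [inj0 open0] tr0] := Mc0.
have [[oT01 [g2 [sg2 g2E]]] [oT10 [g1 [sg1 g1E]]]] := tr0 c1 Mc1.
have sc0 : slice_chart M hd (U `&` O) c0.
  apply: (@slice_chart_part _ _ _ erefl) => // y yU.
  by rewrite /right_part castmx_id -sl //; split=> [[]|].
(* The retraction onto the slice: the normal coordinates are set to 0. *)
have [zf zfP] : {zf : T -> T & forall y, c0.1 y ->
    c0.1 (zf y) /\ c0.2 (zf y) = row_mx (lsubmx (c0.2 y)) 0}.
  apply: (@choice _ _ (fun y z => c0.1 y -> c0.1 z /\ c0.2 z = row_mx (lsubmx (c0.2 y)) 0)) => y.
  have [/(fib y 0)[z z0 zE]|ny] := pselect (c0.1 y); last by exists y.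
  by exists z.
have [hinv hinvP] : {hinv : 'rV[R]_p -> vT & forall w, H (hinv w) /\ LH (hinv w) = w}.
  by apply: (@choice _ _ (fun w h => H h /\ LH h = w)) => w; have [h Hh hE] := surL w I; exists h.
(* The inverse of [phi]: the normal coordinates of a point of the slice are replaced by those of the
   element of [H]. *)
have [Gi GiP] : {Gi : T * vT -> T & forall zh, c0.1 zh.1 ->
    c0.1 (Gi zh) /\ c0.2 (Gi zh) = row_mx (lsubmx (c0.2 zh.1)) (LH zh.2)}.
  apply: (@choice _ _ (fun zh y => c0.1 zh.1 ->
    c0.1 y /\ c0.2 y = row_mx (lsubmx (c0.2 zh.1)) (LH zh.2))) => zh.
  have [/(fib _ (LH zh.2))[z z0 zE]|ny] := pselect (c0.1 zh.1).
    by exists z.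
  by exists zh.1.
pose phi y := (zf y, hinv (rsubmx (c0.2 y))).
pose S := U `&` O; pose W := S `*` H.
have phiW y : U y -> W (phi y).
  move=> Uy; have [z0 zE] := zfP y Uy; split=> /=; last exact: (hinvP _).1.
  by split=> //; apply/sl => //; rewrite zE row_mxKr.
have c0eq y y' : c0.1 y -> c0.1 y' -> c0.2 y = c0.2 y' -> y = y'.
  by move=> h h'; apply: inj0; rewrite inE.
have Gphi y : U y -> Gi (phi y) = y.
  move=> Uy; have [z0 zE] := zfP y Uy; have [G0 GE] := GiP (phi y) z0.
  by apply: c0eq => //; rewrite GE /= zE row_mxKl (hinvP _).2 hsubmxK.
have phiG zh : W zh -> phi (Gi zh) = zh.
  case: zh => z h [[/= z0 zO] Hh]; have [G0 GE] := GiP (z, h) z0.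
  have [zz0 zzE] := zfP _ G0; rewrite /phi; congr (_, _).
    apply: c0eq => //; rewrite zzE GE row_mxKl -(iffLR (sl z z0) zO).
    by rewrite hsubmxK.
  rewrite GE row_mxKr /=; apply: injL; rewrite ?inE //; first exact: (hinvP _).1.
  exact: (hinvP _).2.
pose a0 : chart T d := (c0.1 `&` S, fun y => \row_(i < d) c0.2 y 0 (widen_ord hd i)).
pose ch : chart (T * vT) (d + p) :=
  (a0.1 `*` H, fun y => row_mx (a0.2 y.1) (LH y.2)).
have row_l (y : T) (c : chart T (d + p)) : \row_(i < d) c.2 y 0 (widen_ord hd i) = lsubmx (c.2 y).
  by apply/rowP => i; rewrite !mxE; congr (c.2 y 0 _); apply/val_inj.
have Mch : atlas UO ch.
  exists a0, (H, LH : vT -> 'rV_p); split=> //; first by exists c0.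
  by exists LH.
(* In the charts [c0] and [ch] the map [phi] is the identity. Its smoothness and that of its inverse
   thus reduce to the transitions between [c0] and the atlas chart [c1]. *)
have chphi y : U y -> ch.2 (phi y) = c0.2 y.
  move=> Uy; have [z0 zE] := zfP y Uy.
  by rewrite /= row_l zE row_mxKl (hinvP _).2 hsubmxK.
exists phi, W; split.
- split=> // c Mc; exact: (tr0 c Mc).2.1.
(* In any product chart the image of [W] consists of all v whose left part, completed by 0, is in
   the image of the slice chart; the right part is free. *)
- split; last by move=> [z h] [/= Sz ->]; split.
  split=> // c [a [a' [[c2 [Mc2 sl2] ->] [L' bL' ->] ->]]] /=.
  have [_ injL' surL'] := bL'; have [_ [_ open2] _] := Mc2.
  rewrite (_ : _ @` _ = [set v : 'rV[R]_(d + p) | (c2.2 @` c2.1) (row_mx (lsubmx v) 0)]).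
    exact: open_row_mx0.
  apply/seteqP; split=> [v [[z h] [/= [[c2z Sz] Hh] _] <-]|v [z c2z zE]].
    exists z => //; rewrite row_mxKl row_l -[LHS]hsubmxK; congr row_mx.
    apply/rowP => j; rewrite !mxE; apply: (iffLR (sl2 z c2z)) => //=.
    exact: leq_addr.
  have Sz : S z.
    apply/(sl2 z c2z) => i di.
    have ip : (i - d < p)%N by have := ltn_ord i; lia.
    have -> : i = rshift d (Ordinal ip) by apply/val_inj; rewrite /= subnKC.
    by rewrite zE row_mxEr mxE.
  have [h Hh hE] := surL' (rsubmx v) I.
  by exists (z, h) => //=; rewrite row_l zE row_mxKl hE hsubmxK.
- split.
  + split=> //.
    * move=> y y'; rewrite !inE => Uy Uy' E.
      by rewrite -(Gphi y Uy) -(Gphi y' Uy') E.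
    * move=> zh Wzh; exists (Gi zh); last exact: phiG.
      by case: (GiP zh Wzh.1.1).
  + move=> x Ux; exists c1, ch, (c1.2 @` (c1.1 `&` U)), g1; split; split=> //.
    * exact: c01.
    * by have [[h1 h2] h3] := phiW x Ux; split=> //; split.
    * by exists x => //; split=> //; exact: c01.
    * move=> y c1y [y' [c1y' Uy'] yE].
      have yy : y' = y by apply: inj1; rewrite ?inE.
      rewrite -yy; split; first by have [[h1 h2] h3] := phiW y' Uy'; split=> //; split.
      by rewrite chphi // g1E.
  + exists Gi; split; first exact: Gphi.
    move=> [z h] Wzh; have [G0 GE] := GiP (z, h) Wzh.1.1.
    exists ch, c1, (c0.2 @` (c0.1 `&` c1.1)), g2; split; split=> //.
    * by have [[h1 h2] h3] := Wzh; split=> //; split.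
    * exact: c01.
    * exists (Gi (z, h)); first by split=> //; exact: c01.
      by rewrite GE /= row_l.
    * move=> v [y [Uy c1y] <-]; exists (phi y); last exact: chphi.
      split; last exact: phiW.
      by have [[h1 h2] h3] := phiW y Uy; split=> //; split.
    * move=> zh [[c0z _] _] _; have [G0' GE'] := GiP zh c0z.
      split; first exact: c01.
      by rewrite /= row_l -GE' g2E //; split=> //; exact: c01.
- by move=> y Uy /=; exact: hinvP.
Qed.

End Assembly.

(** * Linear coordinates adapted to the Hermitian part *)

Section SliceCoordinates.
Context {R : realType}.

Lemma hermitian_part_hermitian k (C : 'M[R]_(k + k)) : C^T = - C -> Hermitian_mx R k (hermitian_part C).
Proof.
move=> HC; apply/hermitianP; split; first exact: hermitian_part_sym.
rewrite /hermitian_part mulmxN mulNmx mulmxDr mulmxDl !mulmxA Jmx_sq -!mulmxA Jmx_sq.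
by rewrite mulNmx mul1mx !mulmxN mulmx1 addrC.
Qed.

(** As H commutes with J and J^2 = -1, both terms J (J H) and (J H) J equal - H. *)
Lemma hermitian_part_section k (H : 'M[R]_(k + k)) : Hermitian_mx R k H ->
  (2^-1 *: (Jmx k *m H))^T = - (2^-1 *: (Jmx k *m H)) /\ hermitian_part (2^-1 *: (Jmx k *m H)) = H.
Proof.
move=> /hermitianP[HT HJ]; split.
  by rewrite linearZ /= trmx_mul HT JmxT mulmxN HJ scalerN.
rewrite /hermitian_part -scalemxAr -scalemxAl mulmxA Jmx_sq -mulmxA -HJ mulmxA Jmx_sq.
by rewrite mulNmx mul1mx; apply/matrixP => i j; rewrite !mxE; field.
Qed.

Lemma eq_mulmx_rV m n (A B : 'M[R]_(m, n)) : (forall u : 'rV_m, u *m A = u *m B) -> A = B.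
Proof. by move=> H; apply/row_matrixP => i; rewrite !rowE H. Qed.

(** The last condition says that the block A depends on the tangential coordinates only:
    it makes the domain of the slice chart invariant under a change of H. *)
Lemma slice_coords m k (LH : {linear 'M[R]_(k + k) -> 'rV[R]_(k * k)}) :
  set_bij (Hermitian_mx R k) setT LH ->
  exists d (hN : 'C(m + (k + k), 2) = (d + k * k)%N)
    (La : {linear 'M[R]_(m + (k + k)) -> 'rV[R]_'C(m + (k + k), 2)})
    (Mu : {linear 'rV[R]_'C(m + (k + k), 2) -> 'M[R]_(m + (k + k))}),
  [/\ forall v, skew_mx R _ (Mu v), forall v, La (Mu v) = v &
      forall X, skew_mx R _ X -> Mu (La X) = X] /\
  [/\ forall X, skew_mx R _ X -> right_part hN (La X) = LH (hermitian_part (drsubmx X)) &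
      forall v v', left_part hN v = left_part hN v' -> ulsubmx (Mu v) = ulsubmx (Mu v')].
Proof.
move=> bLH; have [L bL] := skew_coords (R := R) (m + (k + k)).
have [mu [mus Lmu muL]] := linear_section (@skew_lin R _) bL.
have [hs [hsH Lhs hsL]] := linear_section (@herm_lin R k) bLH.
(* The binomial coefficient becomes a variable, so that its equation with d + k * k can be
   substituted. *)
move: L mu bL mus Lmu muL; move: 'C(_, 2) => N L mu bL mus Lmu muL.
have [f fE] : exists f : {linear 'rV[R]_N -> 'rV[R]_(k * k)},
    f =1 (fun v => LH (hermitian_part (drsubmx (mu v)))).
  apply: linear_build => a u v; rewrite linearP -[RHS]linearP; congr (LH _).
  have -> : drsubmx (a *: mu u + mu v) = a *: drsubmx (mu u) + drsubmx (mu v).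
    by apply/matrixP => i j; rewrite !mxE.
  rewrite /hermitian_part mulmxDr mulmxDl -scalemxAr -scalemxAl.
  by rewrite scalerN -opprD scalerDr addrACA.
(* This section of X |-> H has vanishing A block, so moving along it leaves A unchanged. *)
pose sg (w : 'rV[R]_(k * k)) : 'M[R]_(m + (k + k)) :=
  block_mx 0 0 0 (2^-1 *: (Jmx k *m hs w)).
have sgs w : skew_mx R _ (sg w).
  rewrite /sg -[in X in block_mx _ _ X _](oppr0) -[in X in block_mx _ _ X _](trmx0).
  by apply: skew_block; [rewrite trmx0 oppr0|exact: (hermitian_part_section (hsH w)).1].
have [sl slE] : exists sl : {linear 'rV[R]_(k * k) -> 'rV[R]_N}, sl =1 (fun w => L (sg w)).
  apply: linear_build => a u v; rewrite -linearP /=; congr (L _).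
  rewrite /sg scale_block_mx add_block_mx !scaler0 !addr0 linearP /=.
  by rewrite mulmxDr -scalemxAr scalerDr !scalerA mulrC.
pose Ph := lin1_mx f; pose s := lin1_mx sl.
have sP : s *m Ph = 1%:M.
  apply: eq_mulmx_rV => w; rewrite mulmxA !mul_rV_lin1 mulmx1 fE slE muL //.
  by rewrite block_mxKdr (hermitian_part_section (hsH w)).2 Lhs.
have [d [NE [Kc [Rm [KR RK RP sK]]]]] := split_section sP.
exists d, NE.
have [La LaE] : exists La : {linear 'M[R]_(m + (k + k)) -> 'rV[R]_N},
    La =1 (fun X => castmx (erefl, esym NE) (row_mx (L X *m Kc) (L X *m Ph))).
  clear - NE; subst N; apply: linear_build => a u v; rewrite !castmx_id linearP.
  by rewrite !mulmxDl -!scalemxAl scale_row_mx add_row_mx.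
have [Mu MuE] : exists Mu : {linear 'rV[R]_N -> 'M[R]_(m + (k + k))},
    Mu =1 (fun v => mu (left_part NE v *m Rm + right_part NE v *m s)).
  clear - NE; subst N; apply: linear_build => a u v; rewrite /left_part /right_part !castmx_id -linearP.
  by congr (mu _); rewrite !linearP !mulmxDl -!scalemxAl scalerDr addrACA.
exists La, Mu.
have laE X : left_part NE (La X) = L X *m Kc /\ right_part NE (La X) = L X *m Ph.
  by rewrite LaE /left_part /right_part; clear; subst N; rewrite !castmx_id row_mxKl row_mxKr.
have inj v v' : left_part NE v = left_part NE v' -> right_part NE v = right_part NE v' -> v = v'.
  clear; subst N; rewrite /left_part /right_part !castmx_id => l r.
  by rewrite -[v]hsubmxK l r hsubmxK.
split; split.
- by move=> v; rewrite MuE; exact: mus.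
- move=> v; have [l r] := laE (Mu v); apply: inj; rewrite ?l ?r MuE Lmu.
    by rewrite mulmxDl -!mulmxA RK sK mulmx1 mulmx0 addr0.
  by rewrite mulmxDl -!mulmxA RP sP mulmx1 mulmx0 add0r.
- move=> X Xs; have [l r] := laE X; rewrite MuE l r -!mulmxA -mulmxDr KR mulmx1.
  exact: muL.
- by move=> X Xs; rewrite (laE X).2 mul_rV_lin1 fE muL.
- move=> v v' vv; rewrite !MuE !linearD /= vv !mul_rV_lin1 !slE !muL //.
  have ulD (X Y : 'M[R]_(m + (k + k))) : ulsubmx (X + Y) = ulsubmx X + ulsubmx Y.
    by apply/matrixP => i j; rewrite !mxE.
  by rewrite ?ulD /sg !block_mxKul !addr0.
Qed.

End SliceCoordinates.

(** * The slice chart *)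

Section SliceChart.
Context {R : realType} {r s k : nat}.
Local Notation C := R[i].
Local Notation m := (r + s)%N.
Local Notation n := (m + (k + k))%N.
Context (b : {symmetric 'rV[C]_n}) (hb : nondegenerate b).
Local Notation eps := (inertia_mx r s m : 'M[R]_m).
Local Notation N := 'C(n, 2).
Local Notation T := {vspace 'rV[R]_(n + n)}.

(** Inverts the graph parametrization; the default 0 is taken only outside of the chart domain. *)
Definition graph_coord (E F : 'M[R]_(n, n + n)) (y : T) : 'M[R]_n :=
  xget 0 [set X | skew_mx R n X /\ row_space (E + X *m F) = y].

Lemma graph_coordK E F X : witt b E F -> skew_mx R n X ->
  graph_coord E F (row_space (E + X *m F)) = X.
Proof.
move=> W Xs; apply: xget_unique => [//|Y [Ys YE]].
have f1 := witt_free (witt_graph W Xs); have f2 := witt_free (witt_graph W Ys).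
have [Q Qu QE] := (row_space_eqP f2 f1).1 YE.
by have [] := graph_inj W QE.
Qed.

Lemma smooth_mx_linear_rV q a c (U : set 'rV[R]_q) (L : {linear 'rV[R]_q -> 'M[R]_(a, c)}) :
  open U -> smooth_mx U L.
Proof. by move=> oU; apply: smooth_mx_linear => //; exact: smooth_mx_id. Qed.

Lemma plot_open_small q (O : set 'rV[R]_q) (X : 'rV[R]_q -> 'M[R]_n) : open O ->
  smooth_mx O X -> open [set v | O v /\ small_block (r := r) (s := s) (X v)].
Proof.
move=> oO sX; rewrite openE => v [Ov sv].
have [sul _ _ _] := smooth_mx_blocks oO sX.
have near_ij i j : \forall w \near v, `|ulsubmx (X w) i j| < small_radius (R := R) m.
  have : open [set w | O w /\ `|ulsubmx (X w) i j| < small_radius (R := R) m].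
    apply: (open_smooth_preimage oO (sul i j) (A := [set x : R | `|x| < small_radius m])).
    exact: (open_comp (fun x _ => @norm_continuous _ _ x) (@open_lt _ (small_radius m))).
  rewrite openE => /(_ v (conj Ov (sv i j))) H.
  by apply: filterS H => w [].
apply: filterI; first exact: open_nbhs_nbhs.
have near_i i : \forall w \near v, forall j, `|ulsubmx (X w) i j| < small_radius (R := R) m.
  exact: (@filter_forall _ _ (fun j w => `|ulsubmx (X w) i j| < small_radius m) _ _ (near_ij i)).
exact: (@filter_forall _ _ (fun i w => forall j, `|ulsubmx (X w) i j| < small_radius m) _ _ near_i).
Qed.

Lemma smooth_correction_mx q (O : set 'rV[R]_q) (A : 'rV[R]_q -> 'M[R]_m)
    (B : 'rV[R]_q -> 'M[R]_(m, k + k)) : open O -> smooth_mx O A -> smooth_mx O B ->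
  smooth_mx O (fun v => correction_mx eps (A v) (B v)).
Proof.
move=> oO sA sB; have cst a c (Z : 'M[R]_(a, c)) : smooth_mx O (fun=> Z) by exact: smooth_mx_cst.
have sBT : smooth_mx O (fun v => (B v)^T) by exact: smooth_mx_tr.
have sS : smooth_mx O (fun v => eps_gram eps (B v)) by do 2?apply: smooth_mxM => //.
have sTh : smooth_mx O (fun v => eps_gram3 eps (A v) (B v)) by do 4?apply: smooth_mxM => //.
apply: smooth_mxD => //; last by apply: smooth_mxN => //; do 2?apply: smooth_mxM => //.
by apply: smooth_mxZ => //; apply: smooth_mxD => //; apply: smooth_mxM.
Qed.

Lemma smooth_bend q (O : set 'rV[R]_q) (X : 'rV[R]_q -> 'M[R]_n) : open O ->
  smooth_mx O X -> smooth_mx O (fun v => bend eps (X v)).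
Proof.
move=> oO sX; have cst a c (Z : 'M[R]_(a, c)) : smooth_mx O (fun=> Z) by exact: smooth_mx_cst.
have [sA sB _ sC] := smooth_mx_blocks oO sX.
have sB' : smooth_mx O (fun v => ursubmx (X v) - ulsubmx (X v) *m eps *m ursubmx (X v) *m Jmx k).
  by apply: smooth_mxD => //; apply: smooth_mxN => //; do 3?apply: smooth_mxM => //.
apply: smooth_mx_block => //; first by apply: smooth_mxN => //; exact: smooth_mx_tr.
by apply: smooth_mxD => //; exact: smooth_correction_mx.
Qed.

Lemma smooth_straighten q (O : set 'rV[R]_q) (X : 'rV[R]_q -> 'M[R]_n) : open O ->
  (forall v, O v -> denom_mx eps (ulsubmx (X v)) \in unitmx) ->
  smooth_mx O X -> smooth_mx O (fun v => straighten eps (X v)).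
Proof.
move=> oO Nu sX; have cst a c (Z : 'M[R]_(a, c)) : smooth_mx O (fun=> Z) by exact: smooth_mx_cst.
have [sA sB _ sC] := smooth_mx_blocks oO sX.
have sN : smooth_mx O (fun v => denom_mx eps (ulsubmx (X v))).
  by apply: smooth_mxD => //; do 2?apply: smooth_mxM => //.
have sB0 : smooth_mx O (fun v => invmx (denom_mx eps (ulsubmx (X v))) *m
    (ursubmx (X v) + ulsubmx (X v) *m eps *m ursubmx (X v) *m Jmx k)).
  apply: smooth_mxM => //; first exact: smooth_mx_inv.
  by apply: smooth_mxD => //; do 3?apply: smooth_mxM => //.
apply: smooth_mx_block => //; first by apply: smooth_mxN => //; exact: smooth_mx_tr.
by apply: smooth_mxD => //; apply: smooth_mxN => //; exact: smooth_correction_mx.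
Qed.

Lemma atlas_graph_chart e c : atlas (IGr_manifold b e) c ->
  exists E F La mu, graph_chart b c E F (skew_mx R n) La mu.
Proof.
move=> [E [F [l [_ [EE FF EF] [L bL lE] c1 c2]]]].
have [mu [mus Lmu muL]] := linear_section (@skew_lin R n) bL.
exists E, F, L, mu; have LT : L @` skew_mx R n = setT.
  by apply/seteqP; split=> // v _; exists (mu v).
split; split => //.
- by move=> X Xs; rewrite c2 // lE.
- by rewrite LT; exact: openT.
- by rewrite LT; apply: smooth_mx_linear_rV; exact: openT.
- by move=> q O X oO sX _; exact: smooth_mx_linear.
- move=> q O X oO _ HX; rewrite (_ : [set v | _] = O) //.
  by apply/seteqP; split=> [v []|v Ov] //; split=> //; exact: HX.
Qed.

Lemma skew0 : skew_mx R n 0.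
Proof. by rewrite /skew_mx /= trmx0 oppr0. Qed.

Lemma small_block0 : small_block (r := r) (s := s) (0 : 'M[R]_n).
Proof. by move=> i j; rewrite !mxE normr0 invr_gt0 ltr0n. Qed.

Context (E F : 'M[R]_(n, n + n)) (ad : adapted b eps E F).
Context (La : {linear 'M[R]_n -> 'rV[R]_N}) (Mu : {linear 'rV[R]_N -> 'M[R]_n}).
Hypotheses (Mus : forall v, skew_mx R n (Mu v)) (LaMu : forall v, La (Mu v) = v)
  (MuLa : forall X, skew_mx R n X -> Mu (La X) = X).

Definition small_skew : set 'M[R]_n :=
  [set X | skew_mx R n X /\ small_block (r := r) (s := s) X].

Definition slice_chart_at : chart T N :=
  ([set row_space (E + X *m F) | X in small_skew],
   fun y => La (straighten eps (graph_coord E F y))).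

Lemma small_denom_mx X : small_skew X -> denom_mx eps (ulsubmx X) \in unitmx.
Proof. by move=> [Xs Xd]; have [HA _ _] := skew_blockP Xs; exact: denom_mx_unit. Qed.

Lemma small_straighten X : small_skew X -> small_skew (straighten eps X).
Proof.
move=> [Xs Xd]; split; first by apply: straighten_skew => //; exact: inertia_mx_sym.
by move=> i j; rewrite straighten_ul; exact: Xd.
Qed.

Lemma small_bend X : small_skew X -> small_skew (bend eps X).
Proof.
move=> [Xs Xd]; split; first by apply: bend_skew => //; exact: inertia_mx_sym.
by move=> i j; rewrite bend_ul; exact: Xd.
Qed.

Lemma small_straightenK X : small_skew X -> bend eps (straighten eps X) = X.
Proof. by move=> Xd; apply: straightenK; [exact: Xd.1|exact: small_denom_mx]. Qed.

Lemma small_bendK X : small_skew X -> straighten eps (bend eps X) = X.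
Proof. by move=> Xd; apply: bendK; [exact: Xd.1|exact: small_denom_mx]. Qed.

Lemma slice_graph_chart :
  graph_chart b slice_chart_at E F small_skew (La \o straighten eps) (bend eps \o Mu).
Proof.
have [W _ _] := ad.
(* Straightening and bending leave A unchanged, so the smallness condition is the same in the new
   coordinates. *)
have LD : (La \o straighten eps) @` small_skew = [set v | setT v /\ small_block (r := r) (s := s) (Mu v)].
  apply/seteqP; split=> [_ [X Xd <-]|v [_ vd]]; first split=> //=.
    by rewrite MuLa; [exact: (small_straighten Xd).2|exact: (small_straighten Xd).1].
  have vD : small_skew (Mu v) by split.
  exists (bend eps (Mu v)); first exact: small_bend.
  by rewrite /= small_bendK.
have oT : open (setT : set 'rV[R]_N) by exact: openT.
have oD : open ((La \o straighten eps) @` small_skew).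
  by rewrite LD; apply: plot_open_small => //; exact: smooth_mx_linear_rV.
split; (split; first last).
- by [].
- by move=> X [].
- exact: W.
- by move=> X Xd; rewrite /= MuLa ?small_straightenK //; exact: (small_straighten Xd).1.
- by move=> X [Xs Xd]; rewrite /= graph_coordK.
- by apply: smooth_bend => //; exact: smooth_mx_linear_rV.
- exact: oD.
- move=> q O X oO sX Xs.
  rewrite (_ : [set v | _] = [set v | O v /\ small_block (r := r) (s := s) (X v)]).
    exact: plot_open_small.
  by apply/seteqP; split=> v [Ov]; [move=> []|move=> vd; split=> //; split=> //; exact: Xs].
- move=> q O X oO sX XD; apply: smooth_mx_linear => //; apply: smooth_straighten => // v Ov.
  by apply: small_denom_mx; exact: XD.
Qed.

Lemma slice_maximal_atlas : maximal_atlas (IGr_manifold b (odd r)) slice_chart_at.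
Proof.
have [W _ _] := ad; have gc := slice_graph_chart; split.
- move=> _ [X [Xs _] <-]; apply: (IGr_graph hb) => //; exact: adapted_IGr ad.
- exact: (graph_chart_is_chart gc).1.
- move=> c' /atlas_graph_chart[E' [F' [la [mu gc']]]].
  by split; [exact: graph_chart_transition gc gc'|exact: graph_chart_transition gc' gc].
Qed.

Lemma slice_chart_at_center : slice_chart_at.1 (row_space E).
Proof.
exists 0; first by split; [exact: skew0|exact: small_block0].
by rewrite mul0mx addr0.
Qed.

Lemma slice_chart_atP y : slice_chart_at.1 y -> exists X, [/\ small_skew X,
  y = row_space (E + bend eps X *m F) & slice_chart_at.2 y = La X].
Proof.
move=> [X Xd <-]; have [W _ _] := ad; exists (straighten eps X); split.
- exact: small_straighten.
- by rewrite small_straightenK.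
- by rewrite /= graph_coordK //; case: Xd.
Qed.

Context {d : nat} (hN : N = (d + k * k)%N) (LH : {linear 'M[R]_(k + k) -> 'rV[R]_(k * k)}).
Hypotheses (bLH : set_bij (Hermitian_mx R k) setT LH)
  (rLa : forall X, skew_mx R n X -> right_part hN (La X) = LH (hermitian_part (drsubmx X)))
  (lMu : forall v v', left_part hN v = left_part hN v' -> ulsubmx (Mu v) = ulsubmx (Mu v')).

Lemma slice_orbit y : slice_chart_at.1 y -> orbit_rs b r s y <-> right_part hN (slice_chart_at.2 y) = 0.
Proof.
move=> /slice_chart_atP[X [[Xs Xd] -> ->]]; rewrite rLa //.
have [_ _ HC] := skew_blockP Xs; split=> H.
  have := signature_orbit_bend ad Xs Xd (leqnn r) (leqnn s) H; rewrite !subnn => H0.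
  have [_ _ rk _ _] := has_inertia_unique_aux 0 H0.
  have /eqP := rk; rewrite mxrank_eq0 => /eqP ->; exact: linear0.
have H0 : hermitian_part (drsubmx X) = 0.
  have [_ injL _] := bLH; apply: injL; rewrite ?inE ?H ?linear0 //.
    exact: hermitian_part_hermitian.
  by apply/hermitianP; rewrite trmx0 mulmx0 mul0mx.
have := orbit_bend_signature ad Xs Xd (p := 0) (q := 0); rewrite !addn0; apply.
by rewrite H0; exact: has_inertia0.
Qed.

(** The domain restricts only A, which [lMu] makes a function of the tangential coordinates; so the
    normal ones can be prescribed. *)
Lemma slice_fibre y w : slice_chart_at.1 y -> exists2 y', slice_chart_at.1 y' &
  left_part hN (slice_chart_at.2 y') = left_part hN (slice_chart_at.2 y) /\
  right_part hN (slice_chart_at.2 y') = w.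
Proof.
move=> /slice_chart_atP[X [[Xs Xd] _ ->]]; have [W _ _] := ad.
have [v [vl vr]] : exists v, left_part hN v = left_part hN (La X) /\ right_part hN v = w.
  exists (castmx (erefl, esym hN) (row_mx (left_part hN (La X)) w)).
  by rewrite /left_part /right_part castmxKV row_mxKl row_mxKr.
have vD : small_skew (Mu v).
  by split=> // i j; rewrite (lMu vl) MuLa.
have PD := small_bend vD.
exists (row_space (E + bend eps (Mu v) *m F)); first by exists (bend eps (Mu v)).
by rewrite /= graph_coordK ?small_bendK ?LaMu //; case: PD.
Qed.

End SliceChart.

Unset Implicit Arguments.

Theorem theorem4p5 (R : realType) (n : nat) (hn : (2 <= n)%N)
    (b : {symmetric 'rV[R[i]]_n}) (hb : nondegenerate b)
    (r s k : nat) (hk : n = (r + s + k.*2)%N) :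
  let GP := IGr_manifold b (odd (n - s)) in
  let O := orbit_rs b in
  exists (d : nat) (hd : (d <= 'C(n, 2))%N),
    embedded_submanifold GP hd (O r s) /\
    forall x, O r s x ->
      exists (U : set {vspace 'rV[R]_(n + n)})
             (phi : {vspace 'rV[R]_(n + n)} ->
                    {vspace 'rV[R]_(n + n)} * 'M[R]_(k + k))
             (W : set ({vspace 'rV[R]_(n + n)} * 'M[R]_(k + k))),
        let UO_Hk := product_manifold (submanifold GP hd (U `&` O r s))
                       (linear_manifold (k * k) (Hermitian_mx R k)) in
        [/\ U x /\ mopen GP U,
            mopen UO_Hk W /\ (U `&` O r s) `*` [set 0] `<=` W,
            diffeomorphism GP UO_Hk U W phi,
            U `<=` \bigcup_(p in [set p : nat * nat | (r <= p.1)%N /\ (s <= p.2)%N])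
                     O p.1 p.2 &
            forall y r' s', U y -> (r <= r')%N -> (s <= s')%N ->
              (O r' s' y <-> mx_signature (phi y).2 (r' - r) (s' - s))].
Proof.
have {}hk : n = ((r + s) + (k + k))%N by rewrite hk addnn.
(* The type of G/P is given by the parity of n - s = r + 2k, which is that of r in [adapted_IGr]. *)
subst n; have -> : odd (r + s + (k + k) - s) = odd r.
  have -> : (r + s + (k + k) - s)%N = (r + k.*2)%N by lia.
  by rewrite oddD odd_double addbF.
move=> GP O.
have [LH bLH] := herm_coords (R := R) k.
have [d [hN [La [Mu [[Mus LaMu MuLa] [rLa lMu]]]]]] := slice_coords (r + s) bLH.
have hd : (d <= 'C(r + s + (k + k), 2))%N by rewrite hN leq_addr.
exists d, hd; split.
  split=> x Ox; have [E [F [Ex ad]]] := adapted_exists hb Ox; rewrite -Ex.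
    exact: adapted_IGr ad.
  exists (slice_chart_at E F La); last exact: slice_chart_at_center.
  apply: (slice_chart_part (hN := hN)); first exact: slice_maximal_atlas.
  by move=> y; apply: slice_orbit; eassumption.
move=> x Ox; have [E [F [Ex ad]]] := adapted_exists hb Ox; have [W _ _] := ad.
have [L bL] := skew_coords (R := R) (r + s + (k + k)).
(* Smooth maps are tested in charts of the atlas, while the slice chart is only known to be in the
   maximal atlas. So the full graph chart of the same Witt basis is supplied. *)
pose c1 : chart {vspace 'rV[R]_((r + s + (k + k)) + (r + s + (k + k)))} 'C(r + s + (k + k), 2) :=
  ([set row_space (E + X *m F) | X in skew_mx R _], fun y => L (graph_coord E F y)).
have Mc1 : atlas GP c1.
  exists E, F, (skew_mx R _, L : _ -> _); split=> //.
  - exact: adapted_IGr ad.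
  - by exists L.
  - by move=> X Xs; rewrite /= (graph_coordK W).
have inj1 : set_inj c1.1 c1.2.
  have [E' [F' [la [mu gc]]]] := atlas_graph_chart Mc1.
  exact: (graph_chart_is_chart gc).1.1.
have H0 : Hermitian_mx R k 0 by apply/hermitianP; rewrite trmx0 mulmx0 mul0mx.
have sub01 : (slice_chart_at E F La).1 `<=` c1.1 by move=> _ [X [Xs _] <-]; exists X.
have so y : (slice_chart_at E F La).1 y -> O r s y <-> right_part hN ((slice_chart_at E F La).2 y) = 0.
  by apply: slice_orbit; eassumption.
have [phi [V [oU HV df phiP]]] := slice_chart_splitting hd bLH H0 (slice_maximal_atlas hb ad Mus LaMu MuLa)
  Mc1 inj1 sub01 so (slice_fibre ad Mus LaMu MuLa lMu).
(* The splitting determines only the [LH]-coordinates of the second component; injectivity of [LH]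
   on Hermitian matrices identifies the matrix itself. *)
have phi2 X : small_skew (r := r) (s := s) X ->
    (slice_chart_at E F La).1 (row_space (E + bend (inertia_mx r s (r + s)) X *m F)) ->
    (slice_chart_at E F La).2 (row_space (E + bend (inertia_mx r s (r + s)) X *m F)) = La X ->
    (phi (row_space (E + bend (inertia_mx r s (r + s)) X *m F))).2 = hermitian_part (drsubmx X).
  move=> [Xs Xd] Uy yE; have [Hp pE] := phiP _ Uy; have [_ injL _] := bLH.
  have [_ _ HC] := skew_blockP Xs.
  by apply: injL; rewrite ?inE ?pE ?yE ?rLa //; exact: hermitian_part_hermitian.
exists (slice_chart_at E F La).1, phi, V; split=> //.
- by rewrite -Ex; split=> //; exact: slice_chart_at_center.
- move=> y /(slice_chart_atP ad)[X [[Xs Xd] -> _]]; have [_ _ HC] := skew_blockP Xs.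
  have [p [q Hpq]] := has_inertia_exists (hermitian_part_sym HC).
  exists (r + p, s + q)%N; first by rewrite /= !leq_addr.
  exact: orbit_bend_signature.
move=> y r' s' Uy rr ss; have [X [Xd yE cE]] := slice_chart_atP ad Uy.
have [Xs Xs'] := Xd; subst y; rewrite phi2 // mx_signatureP; split.
  exact: signature_orbit_bend.
by move=> /(orbit_bend_signature ad Xs Xs'); rewrite !subnKC.
Qed.
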